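(* Let $\omega=\frac{-1+\sqrt{-3}}{2}$. The density of prime elements $x+y\omega$ of $\mathbb{Z}[\omega]$ (with $x,y\in\mathbb{Z}$) such that $x>0$, $y\ge 0$ and $N(x+y\omega)\le R^2$ can be estimated as $\frac{3\sqrt{3}}{2\pi\log R}$; that is, this density is asymptotically equal to $$\frac{3\sqrt{3}}{2\pi\log R}\qquad\text{as } R\to\infty .$$
   Context: $N$ is the norm $N(\alpha)=\alpha\bar\alpha$, so $N(x+y\omega)=x^2-xy+y^2$. The density of primes in a region means the number of primes $x+y\omega$ with $(x,y)$ in the region divided by the area of the region in the $(x,y)$-coordinate plane (in which $x^2-xy+y^2=R^2$ is an ellipse). Two functions $f,g$ of $R$ are asymptotically equal if $f(R)/g(R)\to 1$ as $R\to\infty$. $\log$ is the natural logarithm. *)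

(* Defs.v *)
From mathcomp Require Import all_boot all_order all_algebra.
From mathcomp Require Import finmap complex.
From mathcomp Require Import all_classical all_reals all_analysis.
From mathcomp Require Import ring lra.
Set Implicit Arguments.
Unset Strict Implicit.
Unset Printing Implicit Defensive.
Import Order.TTheory GRing.Theory Num.Theory.
Import numFieldNormedType.Exports.
Local Open Scope classical_set_scope.
Local Open Scope ring_scope.
Local Open Scope complex_scope.

Section PrimeElement.
Variable A : comNzRingType.

(* Divisibility, with the cofactor required to lie in the subset S. *)
Definition dvd_in (S : set A) (a b : A) : Prop := exists2 c, S c & b = c * a.

(* The prime elements of a subring S of A; ~ dvd_in S p 1 says that p is not
   a unit of S. *)
Definition prime_in (S : set A) (p : A) : Prop :=
  [/\ S p, p <> 0, ~ dvd_in S p 1 &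
      forall a b, S a -> S b ->
        dvd_in S p (a * b) -> dvd_in S p a \/ dvd_in S p b].

End PrimeElement.

Section Eisenstein.
Variable R : realType.

Definition omega : R[i] := (-1 + sqrtC (- 3%:R)) / 2%:R.

Definition point (p : R * R) : R[i] := p.1%:C + p.2%:C * omega.

Definition int_point (p : int * int) : R * R := (p.1%:~R, p.2%:~R).

Definition Zomega : set R[i] := range (point \o int_point).

(* Complex-valued; the values are nonnegative reals, and the order on R[i]
   restricts to the usual one on reals. *)
Definition normE (z : R[i]) : R[i] := z * z^*.

Definition sector (r : R) : set (R * R) :=
  [set p | [/\ 0 < p.1, 0 <= p.2 & normE (point p) <= (r ^+ 2)%:C]].

(* (x, y) |-> x + y omega is injective, so counting integer pairs is counting
   elements of Z[omega]. *)
Definition primes_in_region (D : set (R * R)) : set (int * int) :=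
  [set p | D (int_point p) /\ prime_in Zomega (point (int_point p))].

Definition area (D : set (R * R)) : \bar R :=
  ((@lebesgue_measure R) \x (@lebesgue_measure R))%E D.

(* fset_set is empty on infinite sets; see finite_primes_in_sector. *)
Definition prime_density (D : set (R * R)) : R :=
  #|` fset_set (primes_in_region D)|%:R / fine (area D).

Definition asymp_eq (f g : R -> R) : Prop := f r / g r @[r --> +oo] --> (1 : R).

Lemma sqrtCN3E : sqrtC (- 3%:R) = 0 +i* Num.sqrt 3%:R :> R[i].
Proof.
have s3 : (Num.sqrt 3%:R : R) ^+ 2 = 3%:R by rewrite sqr_sqrtr.
have -> : - 3%:R = (0 +i* Num.sqrt 3%:R : R[i]) ^+ 2.
  rewrite -(rmorph_nat (real_complex R)).
  by apply/eqP; rewrite eq_complex /= -!expr2 s3; apply/andP; split; apply/eqP; ring.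
apply/sqrCK_P; apply/andP; split; last by rewrite ltcE /= ltxx andbF.
by rewrite -complexIm /= lecR sqrtr_ge0.
Qed.

Lemma omegaE : omega = (- 2%:R^-1) +i* (Num.sqrt 3%:R / 2%:R).
Proof.
rewrite /omega sqrtCN3E -(rmorph_nat (real_complex R)) -fmorphV.
by apply/eqP; rewrite eq_complex /=; apply/andP; split; apply/eqP; field.
Qed.

Lemma normE_point (p : R * R) :
  normE (point p) = (p.1 ^+ 2 - p.1 * p.2 + p.2 ^+ 2)%:C.
Proof.
have s3 : (Num.sqrt 3%:R : R) ^+ 2 = 3%:R by rewrite sqr_sqrtr.
rewrite /normE /point omegaE; apply/eqP; rewrite eq_complex /=.
apply/andP; split; apply/eqP; last by field.
set s := Num.sqrt _ in s3 *.
transitivity (p.1 ^+ 2 - p.1 * p.2 + p.2 ^+ 2 * (1 + s ^+ 2) / 4%:R); first by field.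
by rewrite s3; field.
Qed.

Lemma finite_primes_in_sector (r : R) :
  finite_set (primes_in_region (sector r)).
Proof.
have [B ltB] : exists B : nat, 4%:R * r ^+ 2 + 1 < B%:R.
  by exists (Num.bound (4%:R * r ^+ 2 + 1)); exact: unstable.ltr_bound.
apply: (@sub_finite_set _ _ ((fun n => (Posz n.1, Posz n.2)) @` (`I_B `*` `I_B)));
  last by apply: finite_image; apply: finite_setX; exact: finite_II.
have lt_nat (n : nat) : n%:R <= 4%:R * r ^+ 2 + 1 -> (n < B)%N.
  by move=> /le_lt_trans /(_ ltB); rewrite ltr_nat.
move=> [x y] [[/=]]; rewrite ltr0z ler0z normE_point lecR /=.
case: x => [x|//] _; case: y => [y|//] _; rewrite -!pmulrn => Nle _.
exists (x, y) => //; split; apply: lt_nat => /=.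
  have := sqr_ge0 (x%:R - 2%:R * y%:R : R); have := sqr_ge0 (x%:R - 1 : R).
  by nra.
have := sqr_ge0 (y%:R - 2%:R * x%:R : R); have := sqr_ge0 (y%:R - 1 : R).
by nra.
Qed.

End Eisenstein.

(* Main.v *)
(* The elliptic sector 0 < x, 0 <= y, x^2 - x y + y^2 <= r^2 has area
   2 pi r^2 / (3 sqrt 3).  A prime element of Z[omega] has norm p = 3, a prime
   p = 1 mod 3, or p^2 with p = 2 mod 3.  The first and the last kind contribute
   O(r) elements, while each p = 1 mod 3 is the norm of exactly four elements of
   the sector (two classes up to units, with two of the six associates of each in
   the sector).  The density is therefore governed by the prime number theorem for
   the progression 1 mod 3.

   With zeta and the character chi mod 3, the coefficients Lam n (1 + chi n) - 1
   have a Dirichlet series that extends continuously to Re s = 1, because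
   (s - 1) zeta(s) L(s, chi) does not vanish there by the 3-4-1 inequality.  Abel
   summation transfers the extension to the Dirichlet series of s(n) = S(n)/n,
   where S(n) are the partial sums of the coefficients.  The s(n) are bounded by
   Chebyshev's estimate and slowly decreasing, so a Fejer kernel argument, with
   the Riemann-Lebesgue lemma on the boundary line, gives s(n) -> 0. *)

From Stdlib Require Import Reals Lra Lia Psatz.
From mathcomp Require Import ssreflect.
From Coquelicot Require Import Coquelicot.

(** The constant: about r^2 / (4 ln r) primes p = 1 mod 3 lie below r^2 and each gives four points,
    so the count is r^2 / ln r, to be divided by the area. The product zeta L is kept together
    because its logarithmic derivative has the nonnegative coefficients Lam n (1 + chi n), so that
    the 3-4-1 argument works for it as for zeta alone; only the point s = 1 remains, where L(1, chi)
    is visibly positive. No contour and no complex derivative occurs. Derivatives are taken along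
    the real direction, -zeta' and -L' are Dirichlet series in their own right, and an extension to
    the line is expressed as bounded uniform continuity to the right of it. The averages S(n)/n are
    needed since the coefficients themselves can be as large as ln n, whereas the Fejer argument
    wants a bounded sequence. The analysis lives in Stdlib's reals and the theorem in an arbitrary
    [realType]; what passes between them is a family of inequalities between natural numbers. *)

Module Analytic.

Open Scope R_scope.

(** * Complex series and bounded uniformly continuous functions *)

Fixpoint rsum (a : nat -> R) (n : nat) : R :=
  match n with O => 0 | S k => rsum a k + a k end.

Fixpoint csum (a : nat -> C) (n : nat) : C :=
  match n with O => RtoC 0 | S k => (csum a k + a k)%C end.

Lemma rsum_ext a b n : (forall k, (k < n)%nat -> a k = b k) -> rsum a n = rsum b n.
Proof.
elim: n => //= n IH H; rewrite (H n ltac:(lia)) IH // => k Hk.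
by apply: H; lia.
Qed.

Lemma csum_ext a b n : (forall k, (k < n)%nat -> a k = b k) -> csum a n = csum b n.
Proof.
elim: n => //= n IH H; rewrite (H n ltac:(lia)) IH // => k Hk.
by apply: H; lia.
Qed.

Lemma rsum_le a b n : (forall k, (k < n)%nat -> a k <= b k) -> rsum a n <= rsum b n.
Proof.
elim: n => /= [|n IH] H; first lra.
have := H n ltac:(lia). have := IH (fun k Hk => H k ltac:(lia)); lra.
Qed.

Lemma rsum_nonneg a n : (forall k, (k < n)%nat -> 0 <= a k) -> 0 <= rsum a n.
Proof.
elim: n => /= [|n IH] H; first lra.
have := H n ltac:(lia). have := IH (fun k Hk => H k ltac:(lia)); lra.
Qed.

Lemma rsum_scal c a n : rsum (fun k => c * a k) n = c * rsum a n.
Proof. elim: n => /= [|n ->]; ring. Qed.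

Lemma rsum_plus a b n : rsum (fun k => a k + b k) n = rsum a n + rsum b n.
Proof. elim: n => /= [|n ->]; ring. Qed.

Lemma rsum_add a m n : rsum a (m + n) = rsum a m + rsum (fun k => a (m + k)%nat) n.
Proof.
elim: n => /= [|n IH]; first by rewrite Nat.add_0_r; ring.
by rewrite Nat.add_succ_r /= IH; ring.
Qed.

Lemma rsum_mono a m n : (m <= n)%nat -> (forall k, 0 <= a k) -> rsum a m <= rsum a n.
Proof.
move=> Hmn H. replace n with (m + (n - m))%nat by lia. rewrite rsum_add.
have := rsum_nonneg (fun k => a (m + k)%nat) (n - m) (fun k _ => H _); lra.
Qed.

Lemma csum_add a m n : csum a (m + n) = (csum a m + csum (fun k => a (m + k)%nat) n)%C.
Proof.
elim: n => /= [|n IH]; first by rewrite Nat.add_0_r; ring.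
by rewrite Nat.add_succ_r /= IH; ring.
Qed.

Lemma csum_scal c a n : csum (fun k => c * a k)%C n = (c * csum a n)%C.
Proof. elim: n => /= [|n ->]; ring. Qed.

Lemma csum_plus a b n : csum (fun k => a k + b k)%C n = (csum a n + csum b n)%C.
Proof. elim: n => /= [|n ->]; ring. Qed.

Lemma Cmod_csum_le a m n :
  (forall k, (k < n)%nat -> Cmod (a k) <= m k) -> Cmod (csum a n) <= rsum m n.
Proof.
elim: n => /= [|n IH] H; first by rewrite Cmod_0; lra.
apply: Rle_trans; first exact: Cmod_triangle.
have := H n ltac:(lia). have := IH (fun k Hk => H k ltac:(lia)); lra.
Qed.

Lemma re_csum a n : Re (csum a n) = rsum (fun k => Re (a k)) n.
Proof. by elim: n => //= n <-. Qed.

Lemma im_csum a n : Im (csum a n) = rsum (fun k => Im (a k)) n.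
Proof. by elim: n => //= n <-. Qed.

Lemma im_le_Cmod (z : C) : Rabs (Im z) <= Cmod z.
Proof. apply: Rle_trans (Rmax_Cmod z); exact: Rmax_r. Qed.

Lemma Cmod_le_re_im (z : C) : Cmod z <= Rabs (Re z) + Rabs (Im z).
Proof.
have H : 0 <= Rabs (Re z) + Rabs (Im z).
  by have := Rabs_pos (Re z); have := Rabs_pos (Im z); lra.
rewrite -(Rabs_pos_eq _ H) -(Rabs_pos_eq _ (Cmod_ge_0 z)).
apply: Rsqr_le_abs_0; rewrite !Rsqr_pow2 Cmod2_alt.
have := Rabs_pos (Re z); have := Rabs_pos (Im z).
rewrite -(pow2_abs (Re z)) -(pow2_abs (Im z)); nra.
Qed.

Lemma Cmod_minus_sym (z w : C) : Cmod (z - w) = Cmod (w - z).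
Proof. by rewrite -Cmod_opp; congr Cmod; ring. Qed.

Lemma Cmod_triangle_rev (z w : C) : Cmod z - Cmod w <= Cmod (z - w).
Proof. have := Cmod_triangle (z - w) w; replace (z - w + w)%C with z by ring; lra. Qed.

Lemma Cmod_triangle_minus (z w : C) : Cmod (z - w) <= Cmod z + Cmod w.
Proof. by have := Cmod_triangle z (- w); rewrite Cmod_opp. Qed.

Definition rlim (u : nat -> R) (l : R) :=
  forall eps, 0 < eps -> exists N, forall n, (N <= n)%nat -> Rabs (u n - l) < eps.

Definition clim (u : nat -> C) (l : C) :=
  forall eps, 0 < eps -> exists N, forall n, (N <= n)%nat -> Cmod (u n - l) < eps.

Lemma clim_ext u v l : (forall n, u n = v n) -> clim u l -> clim v l.
Proof. by move=> E H eps He; have [N HN] := H eps He; exists N => n Hn; rewrite -E; apply: HN. Qed.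

Lemma clim_const c : clim (fun _ => c) c.
Proof. move=> eps He; exists O => n _; replace (c - c)%C with (RtoC 0) by ring; by rewrite Cmod_0. Qed.

Lemma clim_plus u v l m : clim u l -> clim v m -> clim (fun n => u n + v n)%C (l + m)%C.
Proof.
move=> Hu Hv eps He.
have [N1 H1] := Hu (eps / 2) ltac:(lra); have [N2 H2] := Hv (eps / 2) ltac:(lra).
exists (Nat.max N1 N2) => n Hn.
replace (u n + v n - (l + m))%C with ((u n - l) + (v n - m))%C by ring.
have := Cmod_triangle (u n - l) (v n - m).
have := H1 n ltac:(lia); have := H2 n ltac:(lia); lra.
Qed.

Lemma clim_scal c u l : clim u l -> clim (fun n => c * u n)%C (c * l)%C.
Proof.
move=> Hu eps He; have Hc := Cmod_ge_0 c.
have [N HN] := Hu (eps / (Cmod c + 1)) ltac:(apply: Rdiv_lt_0_compat; lra).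
exists N => n Hn; replace (c * u n - c * l)%C with (c * (u n - l))%C by ring.
rewrite Cmod_mult; have H := HN n Hn.
have : Cmod (u n - l) * (Cmod c + 1) < eps.
  have : eps / (Cmod c + 1) * (Cmod c + 1) = eps by field; lra.
  nra.
have := Cmod_ge_0 (u n - l); nra.
Qed.

Lemma clim_opp u l : clim u l -> clim (fun n => - u n)%C (- l)%C.
Proof.
move=> H; apply: (clim_ext (fun n => (- (1)) * u n)%C); first by move=> n; ring.
replace (- l)%C with ((- (1)) * l)%C by ring; exact: clim_scal.
Qed.

Lemma clim_minus u v l m : clim u l -> clim v m -> clim (fun n => u n - v n)%C (l - m)%C.
Proof. by move=> Hu Hv; apply: clim_plus => //; apply: clim_opp. Qed.

Lemma clim_le u l B : clim u l -> (exists N, forall n, (N <= n)%nat -> Cmod (u n) <= B) -> Cmod l <= B.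
Proof.
move=> H [N HN]; apply: Rnot_lt_le => Hlt.
have [N' H'] := H (Cmod l - B) ltac:(lra).
have h1 := HN (Nat.max N N') ltac:(lia); have h2 := H' (Nat.max N N') ltac:(lia).
have := Cmod_triangle_rev l (u (Nat.max N N')); rewrite Cmod_minus_sym; lra.
Qed.

Lemma clim_unique u l m : clim u l -> clim u m -> l = m.
Proof.
move=> Hl Hm.
have H : clim (fun n => u n - u n)%C (l - m)%C by apply: clim_minus.
have : Cmod (l - m) <= 0.
  apply: clim_le H _; exists O => n _; replace (u n - u n)%C with (RtoC 0) by ring; rewrite Cmod_0; lra.
move=> H0; have : (l - m = 0)%C by apply: Cmod_eq_0; have := Cmod_ge_0 (l - m); lra.
by move=> E; replace l with (l - m + m)%C by ring; rewrite E; ring.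
Qed.

Lemma clim_re_le u l B : clim u l -> (exists N, forall n, (N <= n)%nat -> B <= Re (u n)) -> B <= Re l.
Proof.
move=> H [N HN]; apply: Rnot_lt_le => Hlt.
have [N' H'] := H (B - Re l) ltac:(lra).
have h1 := HN (Nat.max N N') ltac:(lia); have h2 := H' (Nat.max N N') ltac:(lia).
have := re_le_Cmod (u (Nat.max N N') - l)%C.
have -> : Re (u (Nat.max N N') - l)%C = Re (u (Nat.max N N')) - Re l by [].
move=> h3; have := Rle_abs (Re (u (Nat.max N N')) - Re l); lra.
Qed.

Lemma clim_subseq u l (phi : nat -> nat) :
  (forall n, (n <= phi n)%nat) -> clim u l -> clim (fun n => u (phi n)) l.
Proof.
move=> Hphi H eps He; have [N HN] := H eps He; exists N => n Hn.
by apply: HN; have := Hphi n; lia.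
Qed.

Definition summable (m : nat -> R) :=
  (forall k, 0 <= m k) /\ exists B, forall n, rsum m n <= B.

Lemma summable_cauchy m : summable m ->
  forall eps, 0 < eps -> exists N, forall p, rsum (fun k => m (N + k)%nat) p < eps.
Proof.
move=> [Hm [B HB]] eps He.
have [l [Hl1 Hl2]] : {l | is_lub (fun x => exists n, x = rsum m n) l}.
  apply: completeness; first by exists B => x [n ->].
  by exists (rsum m 0), O.
have [N HN] : exists N, l - eps < rsum m N.
  apply: Classical_Prop.NNPP => Hn.
  have : l <= l - eps.
    apply: Hl2 => x [n ->]; apply: Rnot_lt_le => Hlt; apply: Hn; by exists n.
  lra.
exists N => p; have : rsum m (N + p) <= l by apply: Hl1; exists (N + p)%nat.
rewrite rsum_add; lra.
Qed.

Lemma summable_scal c m : 0 <= c -> summable m -> summable (fun k => c * m k).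
Proof.
move=> Hc [H [B HB]]; split; first by move=> k; apply: Rmult_le_pos.
exists (c * B) => n; rewrite rsum_scal; exact: Rmult_le_compat_l.
Qed.

Lemma summable_le m m' : (forall k, 0 <= m k <= m' k) -> summable m' -> summable m.
Proof.
move=> H [_ [B HB]]; split; first by move=> k; have := H k; lra.
exists B => n; apply: Rle_trans (HB n); apply: rsum_le => k _; exact: (proj2 (H k)).
Qed.

(** Total by way of the default values of [Lim_seq]; the value means something only under a summable
    majorant, through [cser_correct]. *)
Definition cser (a : nat -> C) : C :=
  (real (Lim_seq (rsum (fun k => Re (a k)))), real (Lim_seq (rsum (fun k => Im (a k))))).

Lemma rsum_abs_le a m n : (forall k, Rabs (a k) <= m k) -> Rabs (rsum a n) <= rsum m n.
Proof.
move=> H; elim: n => /= [|n IH]; first by rewrite Rabs_R0; lra.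
apply: Rle_trans (Rabs_triang _ _) _; have := H n; lra.
Qed.

Lemma rsum_conv a m : (forall k, Rabs (a k) <= m k) -> summable m ->
  rlim (rsum a) (real (Lim_seq (rsum a))).
Proof.
move=> H Hm.
have Hex : ex_finite_lim_seq (rsum a).
  apply/ex_lim_seq_cauchy_corr => eps.
  have [N HN] := summable_cauchy _ Hm (eps / 2) ltac:(have := cond_pos eps; lra).
  exists N => p q Hp Hq.
  replace p with (N + (p - N))%nat by lia; replace q with (N + (q - N))%nat by lia.
  rewrite !rsum_add.
  have h1 := rsum_abs_le (fun k => a (N + k)%nat) _ (p - N) (fun k => H _).
  have h2 := rsum_abs_le (fun k => a (N + k)%nat) _ (q - N) (fun k => H _).
  have := HN (p - N)%nat; have := HN (q - N)%nat.
  move: h1 h2; set A := rsum _ _; set A' := rsum _ _; set A1 := rsum _ _ ; set A2 := rsum _ _.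
  move=> h1 h2 h3 h4; apply: Rabs_def1.
    move/Rabs_le_between: h1; move/Rabs_le_between: h2; lra.
  move/Rabs_le_between: h1; move/Rabs_le_between: h2; lra.
have := Lim_seq_correct' _ Hex.
move/is_lim_seq_spec => Hl eps He.
have [N HN] := Hl (mkposreal eps He); exists N => n Hn; exact: HN.
Qed.

Lemma cser_correct a m : (forall k, Cmod (a k) <= m k) -> summable m -> clim (csum a) (cser a).
Proof.
move=> H Hm eps He.
have h1 := rsum_conv (fun k => Re (a k)) m (fun k => Rle_trans _ _ _ (re_le_Cmod _) (H k)) Hm.
have h2 := rsum_conv (fun k => Im (a k)) m (fun k => Rle_trans _ _ _ (im_le_Cmod _) (H k)) Hm.
have [N1 H1] := h1 (eps / 2) ltac:(lra); have [N2 H2] := h2 (eps / 2) ltac:(lra).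
exists (Nat.max N1 N2) => n Hn.
apply: Rle_lt_trans (Cmod_le_re_im _) _.
have -> : Re (csum a n - cser a)%C = rsum (fun k => Re (a k)) n - Re (cser a) by rewrite -re_csum.
have -> : Im (csum a n - cser a)%C = rsum (fun k => Im (a k)) n - Im (cser a) by rewrite -im_csum.
have := H1 n ltac:(lia); have := H2 n ltac:(lia); rewrite /cser /Re /Im /=; lra.
Qed.

Lemma clim_csum_tail a l m N eps : clim (csum a) l -> (forall k, Cmod (a k) <= m k) ->
  (forall p, rsum (fun k => m (N + k)%nat) p <= eps) -> Cmod (csum a N - l) <= eps.
Proof.
move=> Hl H HN.
apply: (clim_le (fun n => csum a N - csum a n)%C).
  by apply: clim_minus => //; apply: clim_const.
exists N => n Hn; replace n with (N + (n - N))%nat by lia; rewrite csum_add.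
rewrite Cmod_minus_sym.
replace (csum a N + csum (fun k => a (N + k)%nat) (n - N) - csum a N)%C
  with (csum (fun k => a (N + k)%nat) (n - N)) by ring.
apply: Rle_trans (HN (n - N)%nat); exact: Cmod_csum_le.
Qed.

Lemma clim_csum_le a l m B : clim (csum a) l -> (forall k, Cmod (a k) <= m k) ->
  (forall n, rsum m n <= B) -> Cmod l <= B.
Proof.
move=> Hl H HB; apply: clim_le Hl _; exists O => n _.
apply: Rle_trans (HB n); exact: Cmod_csum_le.
Qed.

(** Boundedness is part of the notion so that it passes to products. Uniform continuity on a region
    that merely touches the line Re s = 1 replaces continuity of an extension to the line. *)
Definition UC (D : C -> Prop) (f : C -> C) :=
  (exists M, forall s, D s -> Cmod (f s) <= M) /\
  forall eps, 0 < eps -> exists2 d, 0 < d &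
    forall s s', D s -> D s' -> Cmod (s - s') < d -> Cmod (f s - f s') < eps.

Lemma UC_sub (D D' : C -> Prop) f : (forall s, D' s -> D s) -> UC D f -> UC D' f.
Proof.
move=> H [[M HM] Hf]; split; first by exists M => s /H; exact: HM.
by move=> eps He; have [d Hd Hs] := Hf eps He; exists d => // s s' /H h /H h'; apply: Hs.
Qed.

Lemma UC_ext D f g : (forall s, D s -> f s = g s) -> UC D f -> UC D g.
Proof.
move=> H [[M HM] Hf]; split; first by exists M => s Ds; rewrite -H //; exact: HM.
by move=> eps He; have [d Hd Hs] := Hf eps He; exists d => // s s' h h'; rewrite -!H //; apply: Hs.
Qed.

Lemma UC_const D c : UC D (fun _ => c).
Proof.
split; first by exists (Cmod c) => *; lra.
move=> eps He; exists 1; first lra; move=> *; replace (c - c)%C with (RtoC 0) by ring; by rewrite Cmod_0.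
Qed.

Lemma UC_id D M : (forall s, D s -> Cmod s <= M) -> UC D (fun s => s).
Proof. by move=> H; split; [exists M | move=> eps He; exists eps]. Qed.

Lemma UC_plus D f g : UC D f -> UC D g -> UC D (fun s => f s + g s)%C.
Proof.
move=> [[M HM] Hf] [[M' HM'] Hg]; split.
  exists (M + M') => s Ds; apply: Rle_trans (Cmod_triangle _ _) _.
  have := HM s Ds; have := HM' s Ds; lra.
move=> eps He; have [d Hd Hs] := Hf (eps / 2) ltac:(lra); have [d' Hd' Hs'] := Hg (eps / 2) ltac:(lra).
exists (Rmin d d'); first exact: Rmin_pos.
move=> s s' Ds Ds' Hss.
replace (f s + g s - (f s' + g s'))%C with ((f s - f s') + (g s - g s'))%C by ring.
apply: Rle_lt_trans (Cmod_triangle _ _) _.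
have := Hs s s' Ds Ds' (Rlt_le_trans _ _ _ Hss (Rmin_l _ _)).
have := Hs' s s' Ds Ds' (Rlt_le_trans _ _ _ Hss (Rmin_r _ _)); lra.
Qed.

Lemma UC_mult D f g : UC D f -> UC D g -> UC D (fun s => f s * g s)%C.
Proof.
move=> [[M HM] Hf] [[M' HM'] Hg]; split.
  exists (Rabs M * Rabs M') => s Ds; rewrite Cmod_mult.
  apply: Rmult_le_compat; try exact: Cmod_ge_0.
    by apply: Rle_trans (HM s Ds) _; exact: Rle_abs.
  by apply: Rle_trans (HM' s Ds) _; exact: Rle_abs.
move=> eps He; set K := Rabs M + Rabs M' + 1.
have HK : 0 < K by rewrite /K; have := Rabs_pos M; have := Rabs_pos M'; lra.
have He' : 0 < eps / (2 * K) by apply: Rdiv_lt_0_compat; lra.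
have [d Hd Hs] := Hf _ He'; have [d' Hd' Hs'] := Hg _ He'.
exists (Rmin d d'); first exact: Rmin_pos.
move=> s s' Ds Ds' Hss.
replace (f s * g s - f s' * g s')%C with ((f s - f s') * g s + f s' * (g s - g s'))%C by ring.
apply: Rle_lt_trans (Cmod_triangle _ _) _; rewrite !Cmod_mult.
have h1 := Hs s s' Ds Ds' (Rlt_le_trans _ _ _ Hss (Rmin_l _ _)).
have h2 := Hs' s s' Ds Ds' (Rlt_le_trans _ _ _ Hss (Rmin_r _ _)).
have h3 : Cmod (g s) < K by have := HM' s Ds; have := Rle_abs M'; have := Rabs_pos M; rewrite /K; lra.
have h4 : Cmod (f s') < K by have := HM s' Ds'; have := Rle_abs M; have := Rabs_pos M'; rewrite /K; lra.
have E : eps / (2 * K) * K = eps / 2 by field; lra.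
have := Cmod_ge_0 (f s - f s'); have := Cmod_ge_0 (g s - g s').
have := Cmod_ge_0 (g s); have := Cmod_ge_0 (f s').
nra.
Qed.

Lemma UC_opp D f : UC D f -> UC D (fun s => - f s)%C.
Proof.
move=> H; apply: (UC_ext D (fun s => (- (1)) * f s)%C); first by move=> s _; ring.
by apply: UC_mult => //; apply: UC_const.
Qed.

Lemma UC_minus D f g : UC D f -> UC D g -> UC D (fun s => f s - g s)%C.
Proof. by move=> Hf Hg; apply: UC_plus => //; apply: UC_opp. Qed.

Lemma UC_inv D f c : 0 < c -> (forall s, D s -> c <= Cmod (f s)) -> UC D f -> UC D (fun s => / f s)%C.
Proof.
move=> Hc Hlow [[M HM] Hf].
have nz s : D s -> f s <> 0%C by move=> Ds; apply/Cmod_gt_0; have := Hlow s Ds; lra.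
split.
  exists (/ c) => s Ds; rewrite (Cmod_inv _ (nz s Ds)).
  by apply: Rinv_le_contravar => //; apply: Hlow.
move=> eps He; have [d Hd Hs] := Hf (eps * (c * c)) (Rmult_lt_0_compat _ _ He (Rmult_lt_0_compat _ _ Hc Hc)).
exists d => // s s' Ds Ds' Hss.
have n1 := nz s Ds; have n2 := nz s' Ds'.
have -> : (/ f s - / f s' = (f s' - f s) / (f s * f s'))%C by field.
rewrite (Cmod_div _ _ (Cmult_neq_0 _ _ n1 n2)).
rewrite Cmod_mult Cmod_minus_sym.
have h := Hs s s' Ds Ds' Hss; have l1 := Hlow s Ds; have l2 := Hlow s' Ds'.
apply/Rlt_div_l; first nra.
have : c * c <= Cmod (f s) * Cmod (f s') by nra.
nra.
Qed.

(** The Weierstrass M-test: a uniformly continuous partial sum, and a tail of at most eps/4 at each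
    of the two points. *)
Lemma UC_series D (a : nat -> C -> C) f m :
  summable m -> (forall k, UC D (a k)) -> (forall k s, D s -> Cmod (a k s) <= m k) ->
  (forall s, D s -> clim (csum (fun k => a k s)) (f s)) -> UC D f.
Proof.
move=> Hm Ha Hle Hl; split.
  have [_ [B HB]] := Hm; exists B => s Ds.
  by apply: clim_csum_le (Hl s Ds) _ HB => k; apply: Hle.
move=> eps He; have [N HN] := summable_cauchy _ Hm (eps / 4) ltac:(lra).
have [_ Huc] : UC D (fun s => csum (fun k => a k s) N).
  elim: (N) => [|n IH] /=; first exact: UC_const.
  exact: UC_plus.
have [d Hd Hs] := Huc (eps / 4) ltac:(lra).
exists d => // s s' Ds Ds' Hss.
have h1 := clim_csum_tail _ _ m N (eps / 4) (Hl s Ds) (fun k => Hle k s Ds) (fun p => Rlt_le _ _ (HN p)).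
have h2 := clim_csum_tail _ _ m N (eps / 4) (Hl s' Ds') (fun k => Hle k s' Ds') (fun p => Rlt_le _ _ (HN p)).
have h3 := Hs s s' Ds Ds' Hss.
move: h1 h2 h3; set A := csum _ _; set A' := csum _ _ => h1 h2 h3.
replace (f s - f s')%C with ((A - A') + ((A' - f s') - (A - f s)))%C by ring.
apply: Rle_lt_trans (Cmod_triangle _ _) _.
have := Cmod_triangle_minus (A' - f s') (A - f s); lra.
Qed.

(** * The complex powers x^-s of a positive real x *)

Definition pw (x : R) (s : C) : C :=
  (exp (- Re s * ln x) * cos (Im s * ln x), - (exp (- Re s * ln x) * sin (Im s * ln x))).

Lemma C_ext (z w : C) : Re z = Re w -> Im z = Im w -> z = w.
Proof. by case: z w => [a b] [c d] /= -> ->. Qed.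

Lemma Cmod_pw x s : Cmod (pw x s) = exp (- Re s * ln x).
Proof.
have H := exp_pos (- Re s * ln x).
apply: Rsqr_inj; [exact: Cmod_ge_0 | lra | rewrite !Rsqr_pow2 Cmod2_alt].
rewrite /pw /Re /Im /=; have := sin2_cos2 (snd s * ln x); rewrite /Rsqr; nra.
Qed.

Lemma pw_mult x y s : 0 < x -> 0 < y -> pw (x * y) s = (pw x s * pw y s)%C.
Proof.
move=> Hx Hy; rewrite /pw ln_mult // !Rmult_plus_distr_l exp_plus cos_plus sin_plus.
apply: C_ext; rewrite /= ; ring.
Qed.

Lemma pw_add x s s' : pw x (s + s')%C = (pw x s * pw x s')%C.
Proof.
rewrite /pw; have -> : Re (s + s')%C = Re s + Re s' by [].
have -> : Im (s + s')%C = Im s + Im s' by [].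
rewrite Ropp_plus_distr !Rmult_plus_distr_r exp_plus cos_plus sin_plus.
apply: C_ext; rewrite /= ; ring.
Qed.

Lemma pw_1 s : pw 1 s = 1%C.
Proof. by rewrite /pw ln_1 !Rmult_0_r exp_0 cos_0 sin_0; apply: C_ext; rewrite /=; ring. Qed.

Lemma pw_one x : 0 < x -> pw x 1%C = RtoC (/ x).
Proof.
move=> Hx; rewrite /pw /Re /Im /= Rmult_0_l cos_0 sin_0.
have -> : exp (- (1) * ln x) = / x.
  by replace (- (1) * ln x) with (- ln x) by ring; rewrite exp_Ropp exp_ln.
by apply: C_ext; rewrite /=; ring.
Qed.

Lemma exp_le a b : a <= b -> exp a <= exp b.
Proof. by case => [H|->]; [apply: Rlt_le; exact: exp_increasing | lra]. Qed.

Lemma exp_lipschitz a b : a <= 0 -> b <= 0 -> Rabs (exp a - exp b) <= Rabs (a - b).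
Proof.
have main x y : x <= 0 -> y <= x -> 0 <= exp x - exp y <= x - y.
  move=> Hx Hy; have h1 := exp_ineq1_le (y - x).
  have h2 : exp y = exp x * exp (y - x) by rewrite -exp_plus; congr exp; ring.
  have h3 : exp x <= 1 by rewrite -exp_0; apply: exp_le.
  have h4 : exp (y - x) <= 1 by rewrite -exp_0; apply: exp_le; lra.
  have := exp_pos x; rewrite h2; nra.
move=> Ha Hb; case: (Rle_dec a b) => H.
  have := main b a Hb H => h; rewrite (Rabs_minus_sym a b) Rabs_minus_sym !Rabs_pos_eq; lra.
have := main a b Ha ltac:(lra) => h; rewrite !Rabs_pos_eq; lra.
Qed.

Lemma mvt_bound (f df : R -> R) a b M : a <= b ->
  (forall x, a <= x <= b -> is_derive f x (df x)) ->
  (forall x, a <= x <= b -> Rabs (df x) <= M) -> Rabs (f b - f a) <= M * (b - a).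
Proof.
move=> Hab Hd HM.
have [c [Hc ->]] := MVT_gen f a b df
  ltac:(rewrite Rmin_left // Rmax_right // => x Hx; apply: Hd; lra)
  ltac:(rewrite Rmin_left // Rmax_right // => x Hx; apply: derivable_continuous_pt;
        exists (df x); apply/is_derive_Reals; exact: Hd).
rewrite Rmin_left // Rmax_right // in Hc.
rewrite Rabs_mult (Rabs_pos_eq (b - a)); last lra.
apply: Rmult_le_compat_r; first lra; exact: HM.
Qed.

Lemma cos_lipschitz a b : Rabs (cos a - cos b) <= Rabs (a - b).
Proof.
have main x y : x <= y -> Rabs (cos y - cos x) <= 1 * (y - x).
  move=> H; apply: (mvt_bound cos (fun z => - sin z)) => // z _.
    by apply/is_derive_Reals; exact: derivable_pt_lim_cos.
  rewrite Rabs_Ropp; apply/Rabs_le; have := SIN_bound z; lra.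
case: (Rle_dec a b) => H.
  by have := main a b H; rewrite Rabs_minus_sym (Rabs_minus_sym a b) (Rabs_pos_eq (b - a)); lra.
by have := main b a ltac:(lra); rewrite (Rabs_pos_eq (a - b)); lra.
Qed.

Lemma sin_lipschitz a b : Rabs (sin a - sin b) <= Rabs (a - b).
Proof.
rewrite -!cos_shift; apply: Rle_trans (cos_lipschitz _ _) _.
rewrite Rabs_minus_sym; apply: Req_le; congr Rabs; ring.
Qed.

(** The 4 counts two coordinates, in each of which both the modulus and the phase of x^-s vary; each
    variation costs ln x |s - s'|. *)
Lemma pw_lipschitz x s s' : 1 <= x -> 0 <= Re s -> 0 <= Re s' ->
  Cmod (pw x s - pw x s') <= 4 * ln x * Cmod (s - s').
Proof.
move=> Hx Hs Hs'; apply: Rle_trans (Cmod_le_re_im _) _.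
have Hl : 0 <= ln x by rewrite -ln_1; case: Hx => [H|<-]; [apply: Rlt_le; apply: ln_increasing; lra | lra].
have r1 : Rabs (Re s - Re s') <= Cmod (s - s') by exact: (re_le_Cmod (s - s')%C).
have r2 : Rabs (Im s - Im s') <= Cmod (s - s') by exact: (im_le_Cmod (s - s')%C).
have h1 := exp_lipschitz (- Re s * ln x) (- Re s' * ln x) ltac:(nra) ltac:(nra).
have h2 := cos_lipschitz (Im s * ln x) (Im s' * ln x).
have h3 := sin_lipschitz (Im s * ln x) (Im s' * ln x).
have E1 : Rabs (- Re s * ln x - - Re s' * ln x) = Rabs (Re s - Re s') * ln x.
  rewrite -{3}(Rabs_pos_eq (ln x) Hl) -Rabs_mult -Rabs_Ropp; congr Rabs; ring.
have E2 : Rabs (Im s * ln x - Im s' * ln x) = Rabs (Im s - Im s') * ln x.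
  rewrite -{3}(Rabs_pos_eq (ln x) Hl) -Rabs_mult; congr Rabs; ring.
rewrite E1 in h1; rewrite E2 in h2; rewrite E2 in h3.
have gen (e e' c c' : R) : 0 < e' <= 1 -> Rabs c <= 1 ->
    Rabs (e * c - e' * c') <= Rabs (e - e') + Rabs (c - c').
  move=> He Hc; replace (e * c - e' * c') with ((e - e') * c + e' * (c - c')) by ring.
  apply: Rle_trans (Rabs_triang _ _) _; rewrite !Rabs_mult (Rabs_pos_eq e'); last lra.
  have := Rabs_pos (e - e'); have := Rabs_pos (c - c'); have := Rabs_pos c; nra.
have He : 0 < exp (- Re s' * ln x) <= 1.
  by split; [exact: exp_pos | rewrite -exp_0; apply: exp_le; nra].
have hc : Rabs (cos (Im s * ln x)) <= 1 by apply/Rabs_le; have := COS_bound (Im s * ln x); lra.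
have hs : Rabs (sin (Im s * ln x)) <= 1 by apply/Rabs_le; have := SIN_bound (Im s * ln x); lra.
have g1 := gen (exp (- Re s * ln x)) (exp (- Re s' * ln x)) _ (cos (Im s' * ln x)) He hc.
have g2 := gen (exp (- Re s * ln x)) (exp (- Re s' * ln x)) _ (sin (Im s' * ln x)) He hs.
have -> : Re (pw x s - pw x s')%C =
  exp (- Re s * ln x) * cos (Im s * ln x) - exp (- Re s' * ln x) * cos (Im s' * ln x) by [].
have -> : Im (pw x s - pw x s')%C =
  - (exp (- Re s * ln x) * sin (Im s * ln x) - exp (- Re s' * ln x) * sin (Im s' * ln x)).
  by rewrite /pw /Im /=; ring.
rewrite Rabs_Ropp.
have k1 : Rabs (Re s - Re s') * ln x <= Cmod (s - s') * ln x by apply: Rmult_le_compat_r.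
have k2 : Rabs (Im s - Im s') * ln x <= Cmod (s - s') * ln x by apply: Rmult_le_compat_r.
lra.
Qed.

(** Closed at Re s = 1: the continued functions live up to the line, whereas [strip] and [near_line]
    stay where the Dirichlet series converge absolutely. *)
Definition box (T : R) (s : C) := 1 <= Re s <= 2 /\ Rabs (Im s) <= T.

Lemma box_Cmod T s : box T s -> Cmod s <= 2 + T.
Proof. move=> [H1 H2]; apply: Rle_trans (Cmod_le_re_im _) _; rewrite Rabs_pos_eq; lra. Qed.

Lemma UC_lipschitz D f L M : (forall s, D s -> Cmod (f s) <= M) ->
  (forall s s', D s -> D s' -> Cmod (f s - f s') <= L * Cmod (s - s')) -> UC D f.
Proof.
move=> HM HL; split; first by exists M.
move=> eps He; exists (eps / (Rabs L + 1)).
  by apply: Rdiv_lt_0_compat => //; have := Rabs_pos L; lra.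
move=> s s' Ds Ds' Hss; apply: Rle_lt_trans (HL _ _ Ds Ds') _.
have h := Rle_abs L; have h' := Cmod_ge_0 (s - s'); have h0 := Rabs_pos L.
have E : eps / (Rabs L + 1) * (Rabs L + 1) = eps by field; lra.
nra.
Qed.

Lemma ln_ge0 x : 1 <= x -> 0 <= ln x.
Proof. by move=> H; rewrite -ln_1; apply: ln_le; lra. Qed.

Lemma UC_pw T x : 1 <= x -> UC (box T) (pw x).
Proof.
move=> Hx; apply: (UC_lipschitz _ _ (4 * ln x) 1) => [s [Hs _]|s s' [Hs _] [Hs' _]].
  rewrite Cmod_pw -exp_0; apply: exp_le; have := ln_ge0 _ Hx; nra.
by apply: pw_lipschitz; lra.
Qed.

(** * Calculus of complex-valued functions of a real variable *)

Definition dC (f : R -> C) (g : R -> C) x :=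
  is_derive (fun y => Re (f y)) x (Re (g x)) /\ is_derive (fun y => Im (f y)) x (Im (g x)).

Definition contC (f : R -> C) x :=
  continuous (fun y => Re (f y)) x /\ continuous (fun y => Im (f y)) x.

Lemma dC_cont f g x : dC f g x -> contC f x.
Proof.
move=> [H1 H2]; split.
  by apply: ex_derive_continuous; exists (Re (g x)).
by apply: ex_derive_continuous; exists (Im (g x)).
Qed.

(** The factor 2 is the price of applying the mean value theorem to the real and imaginary parts
    separately. *)
Lemma mvt_C f g a b M : a <= b -> (forall x, a <= x <= b -> dC f g x) ->
  (forall x, a <= x <= b -> Cmod (g x) <= M) -> Cmod (f b - f a) <= 2 * M * (b - a).
Proof.
move=> Hab Hd HM; apply: Rle_trans (Cmod_le_re_im _) _.
have h1 := mvt_bound (fun y => Re (f y)) (fun y => Re (g y)) a b M Hab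
  (fun x Hx => proj1 (Hd x Hx)) (fun x Hx => Rle_trans _ _ _ (re_le_Cmod _) (HM x Hx)).
have h2 := mvt_bound (fun y => Im (f y)) (fun y => Im (g y)) a b M Hab
  (fun x Hx => proj2 (Hd x Hx)) (fun x Hx => Rle_trans _ _ _ (im_le_Cmod _) (HM x Hx)).
have -> : Re (f b - f a)%C = Re (f b) - Re (f a) by [].
have -> : Im (f b - f a)%C = Im (f b) - Im (f a) by [].
lra.
Qed.

Definition lpw (x : R) (s : C) : C := (ln x * pw x s)%C.

Lemma pw_succ x s : 0 < x -> pw x (s + 1)%C = (pw x s * RtoC (/ x))%C.
Proof. by move=> Hx; rewrite pw_add pw_one. Qed.

Lemma dC_pw x s : 0 < x -> dC (fun y => pw y s) (fun y => - (s * pw y (s + 1)))%C x.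
Proof.
move=> Hx; rewrite /dC pw_succ // /pw /Re /Im /=; split; auto_derive => //; field; lra.
Qed.

Lemma dC_lpw x s : 0 < x -> dC (fun y => lpw y s) (fun y => pw y (s + 1) - s * lpw y (s + 1))%C x.
Proof.
move=> Hx; rewrite /dC /lpw pw_succ // /pw /Re /Im /=; split; auto_derive => //; field; lra.
Qed.

Lemma dC_pw' x s : 0 < x -> dC (fun y => pw y (s - 1)%C) (fun y => - ((s - 1) * pw y s))%C x.
Proof. by move=> Hx; have := dC_pw x (s - 1)%C Hx; replace (s - 1 + 1)%C with s by ring. Qed.

Lemma dC_lpw' x s : 0 < x ->
  dC (fun y => lpw y (s - 1)%C) (fun y => pw y s - (s - 1) * lpw y s)%C x.
Proof. by move=> Hx; have := dC_lpw x (s - 1)%C Hx; replace (s - 1 + 1)%C with s by ring. Qed.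

Definition cint (f : R -> C) a b : C :=
  (RInt (fun y => Re (f y)) a b, RInt (fun y => Im (f y)) a b).

Lemma ex_RInt_contC f a b : a <= b -> (forall x, a <= x <= b -> contC f x) ->
  ex_RInt (fun y => Re (f y)) a b /\ ex_RInt (fun y => Im (f y)) a b.
Proof.
move=> Hab H; split; apply: (ex_RInt_continuous (V := R_CompleteNormedModule)) => z;
  rewrite Rmin_left // Rmax_right // => Hz; by have [] := H z Hz.
Qed.

Lemma cint_FTC f g a b : a <= b -> (forall x, a <= x <= b -> dC f g x) ->
  (forall x, a <= x <= b -> contC g x) -> cint g a b = (f b - f a)%C.
Proof.
move=> Hab Hd Hc; apply: C_ext; rewrite /cint /=; apply: is_RInt_unique.
- apply (is_RInt_derive (V := R_CompleteNormedModule) (fun y => Re (f y)) (fun y => Re (g y))) => x;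
  rewrite Rmin_left // Rmax_right // => Hx; [exact: (proj1 (Hd x Hx)) | exact: (proj1 (Hc x Hx))].
- apply (is_RInt_derive (V := R_CompleteNormedModule) (fun y => Im (f y)) (fun y => Im (g y))) => x;
  rewrite Rmin_left // Rmax_right // => Hx; [exact: (proj2 (Hd x Hx)) | exact: (proj2 (Hc x Hx))].
Qed.

Lemma cint_bound f a b M : a <= b -> (forall x, a <= x <= b -> contC f x) ->
  (forall x, a <= x <= b -> Cmod (f x) <= M) -> Cmod (cint f a b) <= 2 * M * (b - a).
Proof.
move=> Hab Hc HM; apply: Rle_trans (Cmod_le_re_im _) _.
have [e1 e2] := ex_RInt_contC f a b Hab Hc.
have h1 := abs_RInt_le_const _ a b M Hab e1 (fun x Hx => Rle_trans _ _ _ (re_le_Cmod _) (HM x Hx)).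
have h2 := abs_RInt_le_const _ a b M Hab e2 (fun x Hx => Rle_trans _ _ _ (im_le_Cmod _) (HM x Hx)).
rewrite /cint /Re /Im /=; rewrite /Re /Im /= in h1 h2; lra.
Qed.

Lemma cint_const c a b : cint (fun _ => c) a b = ((b - a)%R * c)%C.
Proof. by rewrite /cint !RInt_const; apply: C_ext; rewrite /scal /= /mult /Re /Im /=; ring. Qed.

Lemma cint_lin c d f g a b : a <= b -> (forall x, a <= x <= b -> contC f x) ->
  (forall x, a <= x <= b -> contC g x) ->
  cint (fun x => c * f x + d * g x)%C a b = (c * cint f a b + d * cint g a b)%C.
Proof.
move=> Hab Hf Hg.
have [f1 f2] := ex_RInt_contC f a b Hab Hf; have [g1 g2] := ex_RInt_contC g a b Hab Hg.
have gen (p q r t : R) (u v w z : R -> R) : ex_RInt u a b -> ex_RInt v a b -> ex_RInt w a b -> ex_RInt z a b ->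
   RInt (fun x => p * u x + q * v x + (r * w x + t * z x)) a b =
   p * RInt u a b + q * RInt v a b + (r * RInt w a b + t * RInt z a b).
  move=> hu hv hw hz; apply: is_RInt_unique.
  apply (is_RInt_plus (V := R_NormedModule) (fun x => p * u x + q * v x) (fun x => r * w x + t * z x));
  [apply (is_RInt_plus (V := R_NormedModule) (fun x => p * u x) (fun x => q * v x)) |
   apply (is_RInt_plus (V := R_NormedModule) (fun x => r * w x) (fun x => t * z x))];
  apply (is_RInt_scal (V := R_NormedModule)); exact: (RInt_correct (V := R_CompleteNormedModule)).
apply: C_ext.
- transitivity (Re c * RInt (fun y => Re (f y)) a b + (- Im c) * RInt (fun y => Im (f y)) a b +
    (Re d * RInt (fun y => Re (g y)) a b + (- Im d) * RInt (fun y => Im (g y)) a b)).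
    rewrite -gen // /cint /=; apply: RInt_ext => x _; rewrite /Re /Im /=; ring.
  by rewrite /cint /Re /Im /=; ring.
- transitivity (Im c * RInt (fun y => Re (f y)) a b + Re c * RInt (fun y => Im (f y)) a b +
    (Im d * RInt (fun y => Re (g y)) a b + Re d * RInt (fun y => Im (g y)) a b)).
    rewrite -gen // /cint /=; apply: RInt_ext => x _; rewrite /Re /Im /=; ring.
  by rewrite /cint /Re /Im /=; ring.
Qed.

Lemma cint_Chasles f a b c : a <= b <= c -> (forall x, a <= x <= c -> contC f x) ->
  (cint f a b + cint f b c)%C = cint f a c.
Proof.
move=> [Hab Hbc] Hf.
have [f1 f2] := ex_RInt_contC f a b Hab (fun x Hx => Hf x ltac:(lra)).
have [g1 g2] := ex_RInt_contC f b c Hbc (fun x Hx => Hf x ltac:(lra)).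
by apply: C_ext; rewrite /cint /=; apply: (RInt_Chasles (V := R_CompleteNormedModule)).
Qed.

Lemma contC_pw x s : 0 < x -> contC (fun y => pw y s) x.
Proof. move=> H; apply: dC_cont; exact: dC_pw. Qed.

Lemma contC_lpw x s : 0 < x -> contC (fun y => lpw y s) x.
Proof. move=> H; apply: dC_cont; exact: dC_lpw. Qed.

(** * Sums compared with integrals *)

Lemma ln_le_sub1 x : 0 < x -> ln x <= x - 1.
Proof. move=> H; have := exp_ineq1_le (ln x); rewrite exp_ln //; lra. Qed.

Lemma INR_S_ge1 k : 1 <= INR (S k).
Proof. rewrite S_INR; have := pos_INR k; lra. Qed.

Lemma ln_S_diff x : 0 < x -> / (x + 1) <= ln (x + 1) - ln x <= / x.
Proof.
move=> H; split.
  have := ln_le_sub1 (x / (x + 1)) ltac:(apply: Rdiv_lt_0_compat; lra).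
  rewrite ln_div; try lra. have -> : x / (x + 1) - 1 = - / (x + 1) by field; lra. lra.
have := ln_le_sub1 ((x + 1) / x) ltac:(apply: Rdiv_lt_0_compat; lra).
rewrite ln_div; try lra. have -> : (x + 1) / x - 1 = / x by field; lra. lra.
Qed.

Lemma exp_ln_inv x a : 0 < x -> exp (- (a + 1) * ln x) = exp (- a * ln x) * / x.
Proof.
move=> H; replace (- (a + 1) * ln x) with (- a * ln x + - ln x) by ring.
by rewrite exp_plus exp_Ropp exp_ln.
Qed.

Lemma summable_pow sg : 1 < sg -> summable (fun k => exp (- sg * ln (INR (S k)))).
Proof.
move=> Hs; split; first by move=> k; apply: Rlt_le; exact: exp_pos.
exists (1 + / (sg - 1)).
have main n : rsum (fun k => exp (- sg * ln (INR (S k)))) (S n) <=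
    1 + (1 - exp (- (sg - 1) * ln (INR (S n)))) / (sg - 1).
  elim: n => [|n IH].
    rewrite /= ln_1 !Rmult_0_r exp_0 /Rdiv; lra.
  change (rsum (fun k => exp (- sg * ln (INR (S k)))) (S n) + exp (- sg * ln (INR (S (S n)))) <=
    1 + (1 - exp (- (sg - 1) * ln (INR (S (S n))))) / (sg - 1)).
  have Hx := INR_S_ge1 n; rewrite (S_INR (S n)); move: IH Hx; set x := INR (S n) => IH Hx.
  have [h1 _] := ln_S_diff x ltac:(lra).
  have E := exp_ln_inv (x + 1) (sg - 1) ltac:(lra).
  replace (sg - 1 + 1) with sg in E by ring.
  have E2 : exp (- (sg - 1) * ln x) =
      exp (- (sg - 1) * ln (x + 1)) * exp ((sg - 1) * (ln (x + 1) - ln x)).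
    by rewrite -exp_plus; congr exp; ring.
  have h2 := exp_ineq1_le ((sg - 1) * (ln (x + 1) - ln x)).
  have h3 := exp_pos (- (sg - 1) * ln (x + 1)).
  (* The term is at most the integral of y^-sg over the preceding unit interval, a difference of
     powers y^(1-sg) that telescopes. *)
  have key : exp (- sg * ln (x + 1)) <=
      (exp (- (sg - 1) * ln x) - exp (- (sg - 1) * ln (x + 1))) / (sg - 1).
    apply/Rle_div_r; first lra; rewrite E E2.
    have h4 : (sg - 1) * / (x + 1) <= exp ((sg - 1) * (ln (x + 1) - ln x)) - 1 by nra.
    nra.
  have -> : 1 + (1 - exp (- (sg - 1) * ln (x + 1))) / (sg - 1) =
    (1 + (1 - exp (- (sg - 1) * ln x)) / (sg - 1)) +
    (exp (- (sg - 1) * ln x) - exp (- (sg - 1) * ln (x + 1))) / (sg - 1) by field; lra.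
  lra.
move=> [|n].
  have : 0 < / (sg - 1) by apply: Rinv_0_lt_compat; lra. rewrite /=; lra.
apply: Rle_trans (main n) _; apply: Rplus_le_compat_l.
rewrite -(Rmult_1_l (/ (sg - 1))) /Rdiv; apply: Rmult_le_compat_r.
  by apply: Rlt_le; apply: Rinv_0_lt_compat; lra.
have := exp_pos (- (sg - 1) * ln (INR (S n))); lra.
Qed.

Lemma ln_le_exp eta x : 0 < eta -> ln x <= / eta * exp (eta * ln x).
Proof.
move=> H; apply: (Rmult_le_reg_l eta) => //; rewrite -Rmult_assoc Rinv_r; last lra.
have := exp_ineq1_le (eta * ln x); lra.
Qed.

Lemma lnexp_le eta x : 0 < eta -> ln x * exp (- eta * ln x) <= 2 / eta * exp (- (eta / 2) * ln x).
Proof.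
move=> H; have h := ln_le_exp (eta / 2) x ltac:(lra).
have -> : exp (- (eta / 2) * ln x) = exp (eta / 2 * ln x) * exp (- eta * ln x).
  by rewrite -exp_plus; congr exp; field.
rewrite -Rmult_assoc; apply: Rmult_le_compat_r; first by apply: Rlt_le; exact: exp_pos.
by have -> : 2 / eta = / (eta / 2) by field; lra.
Qed.

Lemma INR_unbounded A : exists N, forall n, (N <= n)%nat -> A < INR n.
Proof.
have [N HN] := nfloor_ex (Rmax A 0) (Rmax_r _ _).
exists (S N) => n Hn; have h := le_INR _ _ Hn; rewrite S_INR in h; have := Rmax_l A 0; lra.
Qed.

Lemma exp_ln_small eta c eps : 0 < eta -> 0 <= c -> 0 < eps ->
  exists N, forall n, (N <= n)%nat -> c * exp (- eta * ln (INR (S n))) < eps.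
Proof.
move=> He Hc Hp; set A := exp (ln ((c + 1) / eps) / eta).
have [N HN] := INR_unbounded A; exists N => n Hn.
have hA : A < INR (S n) by apply: HN; lia.
have hl : ln A < ln (INR (S n)) by apply: ln_increasing => //; exact: exp_pos.
rewrite /A ln_exp in hl.
have hl' : ln ((c + 1) / eps) < eta * ln (INR (S n)).
  have E : ln ((c + 1) / eps) = eta * (ln ((c + 1) / eps) / eta) by field; lra.
  rewrite E; apply: Rmult_lt_compat_l => //.
have := exp_increasing _ _ hl'; rewrite exp_ln; last by apply: Rdiv_lt_0_compat; lra.
move=> h; have h2 : exp (- eta * ln (INR (S n))) * exp (eta * ln (INR (S n))) = 1.
  by rewrite -exp_plus -exp_0; congr exp; ring.
have h3 := exp_pos (- eta * ln (INR (S n))).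
have h4 : (c + 1) / eps * exp (- eta * ln (INR (S n))) < 1 by nra.
have E : (c + 1) * exp (- eta * ln (INR (S n))) = eps * ((c + 1) / eps * exp (- eta * ln (INR (S n)))) by field; lra.
nra.
Qed.

(** On Re s >= 1 the variation of x^-s and of x^-s ln x over a unit interval is O(n^-2 ln n); the
    exponent 3/2 absorbs the logarithm and is still summable. *)
Definition pow32 (k : nat) := exp (- (3 / 2) * ln (INR (S k))).

Lemma summable_pow32 : summable pow32.
Proof. apply: summable_pow; lra. Qed.

Lemma pow32_pos k : 0 < pow32 k.
Proof. exact: exp_pos. Qed.

Lemma pow32_anti j k : (j <= k)%nat -> pow32 k <= pow32 j.
Proof.
move=> H; apply: exp_le.
have : ln (INR (S j)) <= ln (INR (S k)).
  by apply: ln_le; [have := INR_S_ge1 j; lra | apply: le_INR; lia].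
lra.
Qed.

(* Satisfied by x^-s (pw) and x^-s ln x (lpw), so that the continuations of zeta,
   L and their derivatives are obtained together. *)
Record smooth_kernel (g : R -> C -> C) : Prop := SmoothKernel {
  sk_cont : forall x s, 0 < x -> contC (fun y => g y s) x;
  sk_diff : forall T, 0 <= T -> exists2 K, 0 <= K & forall s k x, box T s ->
    INR (S k) <= x <= INR (S k) + 1 -> Cmod (g x s - g (INR (S k)) s) <= K * pow32 k;
  sk_lip : forall T k, exists L, forall s s' x, box T s -> box T s' ->
    INR (S k) <= x <= INR (S k) + 1 -> Cmod (g x s - g x s') <= L * Cmod (s - s') }.

Lemma Re_plus1 s : Re (s + 1)%C = Re s + 1. Proof. by []. Qed.

Lemma exp2_le_pow32 s k y : 1 <= Re s -> INR (S k) <= y -> exp (- Re (s + 1)%C * ln y) <= pow32 k.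
Proof.
move=> Hs Hy; rewrite Re_plus1 /pow32; apply: exp_le.
have h1 := ln_ge0 _ (INR_S_ge1 k).
have h2 : ln (INR (S k)) <= ln y by apply: ln_le => //; have := INR_S_ge1 k; lra.
nra.
Qed.

Lemma pw_smooth : smooth_kernel pw.
Proof.
split; first by move=> x s; exact: contC_pw.
- move=> T HT; exists (2 * (2 + T)); first lra.
  move=> s k x Hs [Hx1 Hx2]; have h1 := INR_S_ge1 k.
  have hm : forall y, INR (S k) <= y <= x -> Cmod (- (s * pw y (s + 1)))%C <= (2 + T) * pow32 k.
    move=> y Hy; rewrite Cmod_opp Cmod_mult Cmod_pw; apply: Rmult_le_compat.
    - exact: Cmod_ge_0.
    - by apply: Rlt_le; exact: exp_pos.
    - exact: box_Cmod.
    - by apply: exp2_le_pow32; case: Hs => [[]]; lra.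
  have hd : forall y, INR (S k) <= y <= x -> dC (fun z => pw z s) (fun z => - (s * pw z (s + 1)))%C y.
    by move=> y Hy; apply: dC_pw; lra.
  apply: Rle_trans (mvt_C _ _ _ _ _ Hx1 hd hm) _.
  have := pow32_pos k; have : 0 <= (2 + T) * pow32 k by apply: Rmult_le_pos; have := pow32_pos k; lra.
  nra.
- move=> T k; exists (4 * ln (INR (S k) + 1)) => s s' x [Hs _] [Hs' _] Hx; have h1 := INR_S_ge1 k.
  apply: Rle_trans (pw_lipschitz _ _ _ _ _ _) _; try lra.
  apply: Rmult_le_compat_r; first exact: Cmod_ge_0.
  apply: Rmult_le_compat_l; first lra; apply: ln_le; lra.
Qed.

Lemma lpw_smooth : smooth_kernel lpw.
Proof.
split; first by move=> x s; exact: contC_lpw.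
- move=> T HT; exists (2 * (1 + 2 * (2 + T))); first lra.
  move=> s k x Hs [Hx1 Hx2]; have h1 := INR_S_ge1 k.
  have hm : forall y, INR (S k) <= y <= x -> Cmod (pw y (s + 1) - s * lpw y (s + 1))%C <= (1 + 2 * (2 + T)) * pow32 k.
    move=> y Hy; apply: Rle_trans (Cmod_triangle_minus _ _) _.
    rewrite /lpw !Cmod_mult Cmod_R Cmod_pw.
    have hs : 1 <= Re s by case: Hs; lra.
    have hl := ln_ge0 y ltac:(lra); rewrite (Rabs_pos_eq _ hl).
    have e1 := exp2_le_pow32 s k y hs ltac:(lra).
    have hlk : ln (INR (S k)) <= ln y by apply: ln_le; lra.
    have hlk0 := ln_ge0 _ h1.
    have e2 : ln y * exp (- Re (s + 1)%C * ln y) <= 2 * pow32 k.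
      have h := ln_le_exp (1 / 2) y ltac:(lra).
      have -> : 2 * pow32 k = / (1 / 2) * pow32 k by field.
      apply: (Rle_trans _ (/ (1 / 2) * exp (1 / 2 * ln y) * exp (- Re (s + 1)%C * ln y))).
        by apply: Rmult_le_compat_r => //; apply: Rlt_le; exact: exp_pos.
      rewrite Rmult_assoc -exp_plus; apply: Rmult_le_compat_l; first lra.
      rewrite /pow32; apply: exp_le; rewrite Re_plus1; nra.
    have hc := box_Cmod _ _ Hs; have hc0 := Cmod_ge_0 s.
    have e3 : 0 <= ln y * exp (- Re (s + 1)%C * ln y).
      by apply: Rmult_le_pos => //; apply: Rlt_le; exact: exp_pos.
    have hw := pow32_pos k. nra.
  have hd : forall y, INR (S k) <= y <= x ->
     dC (fun z => lpw z s) (fun z => pw z (s + 1) - s * lpw z (s + 1))%C y.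
    by move=> y Hy; apply: dC_lpw; lra.
  apply: Rle_trans (mvt_C _ _ _ _ _ Hx1 hd hm) _.
  have : 0 <= (1 + 2 * (2 + T)) * pow32 k by apply: Rmult_le_pos; have := pow32_pos k; lra.
  nra.
- move=> T k; set l := ln (INR (S k) + 1); exists (l * (4 * l)) => s s' x [Hs _] [Hs' _] Hx.
  have h1 := INR_S_ge1 k.
  have -> : (lpw x s - lpw x s' = ln x * (pw x s - pw x s'))%C by rewrite /lpw; ring.
  rewrite Cmod_mult Cmod_R; have hl := ln_ge0 x ltac:(lra); rewrite (Rabs_pos_eq _ hl).
  have hl2 : ln x <= l by apply: ln_le; lra.
  have h := pw_lipschitz x s s' ltac:(lra) ltac:(lra) ltac:(lra).
  have h0 := Cmod_ge_0 (s - s').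
  rewrite Rmult_assoc; apply: Rmult_le_compat => //; first exact: Cmod_ge_0.
  apply: Rle_trans h _; apply: Rmult_le_compat_r => //; lra.
Qed.

Section Kernel.
Variable g : R -> C -> C.
Hypothesis Hg : smooth_kernel g.

(* The sum of g n over n >= 1 minus the integral of g over [1, +oo), as a series
   that still converges on the line Re s = 1; lterm does the same for the
   character mod 3 by grouping the terms 3j+1, 3j+2, 3j+3. *)
Definition uterm (k : nat) (s : C) : C :=
  (g (INR (S k)) s - cint (fun x => g x s) (INR (S k)) (INR (S k) + 1))%C.

Definition lterm (j : nat) (s : C) : C :=
  (g (INR (S (3 * j))) s - g (INR (S (S (3 * j)))) s)%C.

Lemma UC_kernel T k : UC (box T) (g (INR (S k))).
Proof.
have [L HL] := sk_lip _ Hg T k.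
(* For T < 0 the box is empty; otherwise one of its points turns the Lipschitz estimate into a
   bound. *)
case: (Classical_Prop.classic (exists s0, box T s0)) => [[s0 H0]|H]; last first.
  split; first by exists 0 => s Hs; case: H; exists s.
  by move=> eps _; exists 1; [lra | move=> s s' Hs; case: H; exists s].
apply: (UC_lipschitz _ _ L (Cmod (g (INR (S k)) s0) + Rabs L * (2 * (2 + T)))) => [s Hs|s s' Hs Hs'].
  have h := HL s s0 (INR (S k)) Hs H0 ltac:(lra).
  have := Cmod_triangle_rev (g (INR (S k)) s) (g (INR (S k)) s0).
  have h2 := Cmod_triangle_minus s s0; have := box_Cmod _ _ Hs; have := box_Cmod _ _ H0.
  have := Rle_abs L; have := Rabs_pos L; have := Cmod_ge_0 (s - s0); nra.
by apply: HL => //; lra.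
Qed.

Lemma uterm_bound T : 0 <= T -> exists2 K, 0 <= K & forall k s, box T s -> Cmod (uterm k s) <= K * pow32 k.
Proof.
move=> HT; have [K HK H] := sk_diff _ Hg T HT; exists (2 * K); first lra.
move=> k s Hs; have h1 := INR_S_ge1 k.
(* The interval has length 1, so the term is the integral of g n - g x, and [sk_diff] bounds the
   integrand. *)
have -> : uterm k s = cint (fun x => 1 * g (INR (S k)) s + (- (1)) * g x s)%C (INR (S k)) (INR (S k) + 1).
  rewrite (cint_lin 1%C (- (1))%C (fun _ => g (INR (S k)) s)); [| lra | |].
  - rewrite cint_const /uterm; replace (INR (S k) + 1 - INR (S k)) with 1 by ring; ring.
  - move=> x _; split; exact: continuous_const.
  - move=> x Hx; apply: (sk_cont _ Hg); lra.
apply: Rle_trans (cint_bound _ _ _ (K * pow32 k) _ _ _) _; try lra.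
- move=> x Hx; have [c1 c2] := sk_cont _ Hg x s ltac:(lra).
  split; rewrite /Re /Im /=.
    apply: (continuous_plus (V := R_NormedModule)); first exact: continuous_const.
    apply: (continuous_plus (V := R_NormedModule)).
      by apply: (continuous_scal_r (V := R_NormedModule)).
    apply: (continuous_opp (V := R_NormedModule)); by apply: (continuous_scal_r (V := R_NormedModule)).
  apply: (continuous_plus (V := R_NormedModule)); first exact: continuous_const.
  apply: (continuous_plus (V := R_NormedModule)); by apply: (continuous_scal_r (V := R_NormedModule)).
- move=> x Hx; replace (1 * g (INR (S k)) s + - (1) * g x s)%C with (g (INR (S k)) s - g x s)%C by ring.
  by rewrite Cmod_minus_sym; apply: H.
Qed.

Lemma UC_uterm T k : 0 <= T -> UC (box T) (uterm k).
Proof.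
move=> HT; have [L HL] := sk_lip _ Hg T k; have [K HK H] := uterm_bound T HT; have h1 := INR_S_ge1 k.
apply: (UC_lipschitz _ _ (3 * L) (K * pow32 k)) => [s|s s' Hs Hs']; first exact: H.
have E : (cint (fun x => g x s) (INR (S k)) (INR (S k) + 1) - cint (fun x => g x s') (INR (S k)) (INR (S k) + 1))%C
   = cint (fun x => 1 * g x s + (- (1)) * g x s')%C (INR (S k)) (INR (S k) + 1).
  rewrite cint_lin; [ring | lra | |]; move=> x Hx; apply: (sk_cont _ Hg); lra.
have -> : (uterm k s - uterm k s' = (g (INR (S k)) s - g (INR (S k)) s') -
   (cint (fun x => g x s) (INR (S k)) (INR (S k) + 1) - cint (fun x => g x s') (INR (S k)) (INR (S k) + 1)))%C.
  by rewrite /uterm; ring.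
apply: Rle_trans (Cmod_triangle_minus _ _) _.
have a1 := HL s s' (INR (S k)) Hs Hs' ltac:(lra).
have : Cmod (cint (fun x => 1 * g x s + - (1) * g x s')%C (INR (S k)) (INR (S k) + 1)) <=
   2 * (L * Cmod (s - s')) * (INR (S k) + 1 - INR (S k)).
  apply: cint_bound; first lra.
  - move=> x Hx; have [c1 c2] := sk_cont _ Hg x s ltac:(lra); have [d1 d2] := sk_cont _ Hg x s' ltac:(lra).
    split; rewrite /Re /Im /=; repeat first [apply: (continuous_plus (V := R_NormedModule)) |
      apply: (continuous_opp (V := R_NormedModule)) | apply: (continuous_scal_r (V := R_NormedModule)) | done].
  - move=> x Hx; replace (1 * g x s + - (1) * g x s')%C with (g x s - g x s')%C by ring; exact: HL.
rewrite E; lra.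
Qed.

Definition Usum (s : C) : C := cser (fun k => uterm k s).
Definition Lsum (s : C) : C := cser (fun k => lterm k s).

Lemma Usum_lim T s : 0 <= T -> box T s -> clim (csum (fun k => uterm k s)) (Usum s).
Proof.
move=> HT Hs; have [K HK H] := uterm_bound T HT.
apply: (cser_correct _ (fun k => K * pow32 k)); first by move=> k; exact: H.
exact: summable_scal summable_pow32.
Qed.

Lemma UC_Usum T : 0 <= T -> UC (box T) Usum.
Proof.
move=> HT; have [K HK H] := uterm_bound T HT.
apply: (UC_series _ uterm _ (fun k => K * pow32 k)).
- exact: summable_scal summable_pow32.
- by move=> k; exact: UC_uterm.
- by move=> k s; exact: H.
- by move=> s; exact: Usum_lim.
Qed.

Lemma lterm_bound T : 0 <= T -> exists2 K, 0 <= K & forall k s, box T s -> Cmod (lterm k s) <= K * pow32 k.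
Proof.
move=> HT; have [K HK H] := sk_diff _ Hg T HT; exists K => // k s Hs.
rewrite /lterm Cmod_minus_sym; apply: Rle_trans (H s (3 * k)%nat _ Hs _) _.
  by rewrite (S_INR (S (3 * k))); lra.
by apply: Rmult_le_compat_l => //; apply: pow32_anti; lia.
Qed.

Lemma Lsum_lim T s : 0 <= T -> box T s -> clim (csum (fun k => lterm k s)) (Lsum s).
Proof.
move=> HT Hs; have [K HK H] := lterm_bound T HT.
apply: (cser_correct _ (fun k => K * pow32 k)); first by move=> k; exact: H.
exact: summable_scal summable_pow32.
Qed.

Lemma UC_Lsum T : 0 <= T -> UC (box T) Lsum.
Proof.
move=> HT; have [K HK H] := lterm_bound T HT.
apply: (UC_series _ lterm _ (fun k => K * pow32 k)).
- exact: summable_scal summable_pow32.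
- by move=> k; apply: UC_minus; exact: UC_kernel.
- by move=> k s; exact: H.
- by move=> s; exact: Lsum_lim.
Qed.

End Kernel.

(** * The Dirichlet series of 1 and of the character mod 3 *)

Definition dterm (f : nat -> R) (g : R -> C -> C) (s : C) (k : nat) : C :=
  (f (S k) * g (INR (S k)) s)%C.

Definition dser f g s := cser (dterm f g s).

(** One majorant for both kernels: the coefficients of [pw] may grow like 1 + ln n, as those with
    Lam do, and in [lpw] the ln n sits in the kernel. *)
Definition maj (sg : R) (k : nat) : R := (1 + ln (INR (S k))) * exp (- sg * ln (INR (S k))).

Lemma maj_ge0 sg k : 0 <= maj sg k.
Proof.
apply: Rmult_le_pos; last by apply: Rlt_le; exact: exp_pos.
have := ln_ge0 _ (INR_S_ge1 k); lra.
Qed.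

Lemma summable_maj sg : 1 < sg -> summable (maj sg).
Proof.
move=> H; set eta := (sg - 1) / 2; have He : 0 < eta by rewrite /eta; lra.
apply: (summable_le _ (fun k => (1 + / eta) * exp (- (sg - eta) * ln (INR (S k))))); last first.
  apply: summable_scal; first by have := Rinv_0_lt_compat _ He; lra.
  by apply: summable_pow; rewrite /eta; lra.
move=> k; split; first exact: maj_ge0.
have h1 := ln_le_exp eta (INR (S k)) He; have h2 := exp_ineq1_le (eta * ln (INR (S k))).
have h3 := ln_ge0 _ (INR_S_ge1 k).
have E : exp (- (sg - eta) * ln (INR (S k))) = exp (eta * ln (INR (S k))) * exp (- sg * ln (INR (S k))).
  by rewrite -exp_plus; congr exp; ring.
rewrite E /maj -Rmult_assoc; apply: Rmult_le_compat_r; first by apply: Rlt_le; exact: exp_pos.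
nra.
Qed.

Lemma dser_lim f g s : 1 < Re s -> (forall k, Cmod (dterm f g s k) <= maj (Re s) k) ->
  clim (csum (dterm f g s)) (dser f g s).
Proof. move=> Hs H; apply: cser_correct H _; exact: summable_maj. Qed.

Lemma dterm_pw_le f s k : Rabs (f (S k)) <= 1 + ln (INR (S k)) -> Cmod (dterm f pw s k) <= maj (Re s) k.
Proof.
move=> H; rewrite /dterm Cmod_mult Cmod_R Cmod_pw; apply: Rmult_le_compat_r => //.
by apply: Rlt_le; exact: exp_pos.
Qed.

Lemma dterm_lpw_le f s k : Rabs (f (S k)) <= 1 -> Cmod (dterm f lpw s k) <= maj (Re s) k.
Proof.
move=> H; rewrite /dterm /lpw !Cmod_mult !Cmod_R Cmod_pw /maj -Rmult_assoc.
have h := ln_ge0 _ (INR_S_ge1 k); rewrite (Rabs_pos_eq _ h).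
apply: Rmult_le_compat_r; first by apply: Rlt_le; exact: exp_pos.
have := Rabs_pos (f (S k)); nra.
Qed.

Lemma Rabs1_le k (x : R) : Rabs x <= 1 -> Rabs x <= 1 + ln (INR (S k)).
Proof. have := ln_ge0 _ (INR_S_ge1 k); lra. Qed.

Definition one (n : nat) : R := 1.

Definition chi (n : nat) : R :=
  match (n mod 3)%nat with 1%nat => 1 | 2%nat => - (1) | _ => 0 end.

Lemma chi_cases n : chi n = 0 \/ chi n = 1 \/ chi n = - (1).
Proof. rewrite /chi; case: (n mod 3)%nat => [|[|[|m]]]; tauto. Qed.

Lemma chi_le1 n : Rabs (chi n) <= 1.
Proof. by apply/Rabs_le; case: (chi_cases n) => [->|[->|->]]; lra. Qed.

Lemma one_le1 n : Rabs (one n) <= 1.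
Proof. rewrite /one Rabs_R1; lra. Qed.

Lemma chi_mult m n : chi (m * n) = chi m * chi n.
Proof.
rewrite /chi Nat.Div0.mul_mod.
have hm := Nat.mod_upper_bound m 3 ltac:(lia); have hn := Nat.mod_upper_bound n 3 ltac:(lia).
move: (m mod 3)%nat (n mod 3)%nat hm hn => [|[|[|a]]] [|[|[|b]]] /= ha hb; try lia; ring.
Qed.

Lemma chi_triple g s N : csum (dterm chi g s) (3 * N) = csum (fun k => lterm g k s) N.
Proof.
elim: N => // N IH.
replace (3 * S N)%nat with (S (S (S (3 * N)))) by lia.
have c1 : chi (S (3 * N)) = 1.
  by rewrite /chi; replace (S (3 * N)) with (1 + N * 3)%nat by lia; rewrite Nat.Div0.mod_add.
have c2 : chi (S (S (3 * N))) = - (1).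
  by rewrite /chi; replace (S (S (3 * N))) with (2 + N * 3)%nat by lia; rewrite Nat.Div0.mod_add.
have c3 : chi (S (S (S (3 * N)))) = 0.
  by rewrite /chi; replace (S (S (S (3 * N)))) with (0 + (S N) * 3)%nat by lia; rewrite Nat.Div0.mod_add.
change (csum (dterm chi g s) (3 * N) + dterm chi g s (3 * N) + dterm chi g s (S (3 * N)) +
  dterm chi g s (S (S (3 * N))) = csum (fun k => lterm g k s) N + lterm g N s)%C.
rewrite IH /dterm /lterm c1 c2 c3 RtoC_opp; ring.
Qed.

Definition strip (s : C) := 1 < Re s <= 2.

Lemma strip_box s : strip s -> box (Rabs (Im s)) s.
Proof. by move=> [h1 h2]; split; lra. Qed.

Lemma dser_chi g s : smooth_kernel g -> strip s -> (forall k, Cmod (dterm chi g s k) <= maj (Re s) k) ->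
  dser chi g s = Lsum g s.
Proof.
move=> Hg Hs H; have h := dser_lim chi g s (proj1 Hs) H.
have h2 : clim (fun N => csum (dterm chi g s) (3 * N)) (dser chi g s).
  by apply: (clim_subseq _ _ (fun N => (3 * N)%nat) _ h) => n; lia.
apply: clim_unique h2 _; apply: (clim_ext (csum (fun k => lterm g k s))).
  by move=> N; rewrite chi_triple.
exact: (Lsum_lim _ Hg _ _ (Rabs_pos _) (strip_box _ Hs)).
Qed.

Lemma csum_uterm g s N : smooth_kernel g ->
  csum (dterm one g s) N = (csum (fun k => uterm g k s) N + cint (fun x => g x s) 1 (INR (S N)))%C.
Proof.
move=> Hg; elim: N => [|N IH].
  by rewrite /= /cint !RInt_point /zero /=; apply: C_ext; rewrite /=; ring.
have E := cint_Chasles (fun x => g x s) 1 (INR (S N)) (INR (S N) + 1).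
rewrite (S_INR (S N)) -E; first last.
- move=> x Hx; apply: (sk_cont _ Hg); lra.
- by have := INR_S_ge1 N; lra.
change (csum (dterm one g s) N + dterm one g s N = csum (fun k => uterm g k s) N + uterm g N s +
  (cint (fun x => g x s) 1 (INR (S N)) + cint (fun x => g x s) (INR (S N)) (INR (S N) + 1)))%C.
by rewrite IH /dterm /uterm /one; ring.
Qed.

Lemma pw_lim0 s : 0 < Re s -> clim (fun N => pw (INR (S N)) s) 0%C.
Proof.
move=> Hs eps He; have [N HN] := exp_ln_small (Re s) 1 eps Hs ltac:(lra) He.
exists N => n Hn; replace (pw (INR (S n)) s - 0)%C with (pw (INR (S n)) s) by ring.
by rewrite Cmod_pw; have := HN n Hn; lra.
Qed.

Lemma lpw_lim0 s : 0 < Re s -> clim (fun N => lpw (INR (S N)) s) 0%C.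
Proof.
move=> Hs eps He.
have [N HN] := exp_ln_small (Re s / 2) (2 / Re s) eps ltac:(lra)
  ltac:(apply: Rlt_le; apply: Rdiv_lt_0_compat; lra) He.
exists N => n Hn; replace (lpw (INR (S n)) s - 0)%C with (lpw (INR (S n)) s) by ring.
rewrite /lpw Cmod_mult Cmod_R Cmod_pw Rabs_pos_eq; last exact: ln_ge0 (INR_S_ge1 n).
by apply: Rle_lt_trans (HN n Hn); exact: lnexp_le.
Qed.

Lemma dC_val f g g' x : g x = g' x -> dC f g x -> dC f g' x.
Proof. by rewrite /dC => ->. Qed.

Lemma cint_pw s x : 1 <= x -> ((s - 1) * cint (fun y => pw y s) 1 x = 1 - pw x (s - 1))%C.
Proof.
move=> Hx.
(* The zero summand gives the integrand the two-term shape that [cint_lin] handles. *)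
have E : cint (fun y => (- (s - 1)) * pw y s + 0 * pw y s)%C 1 x = (pw x (s - 1) - pw 1 (s - 1))%C.
  rewrite -(cint_FTC (fun y => pw y (s - 1)%C) (fun y => (- (s - 1)) * pw y s + 0 * pw y s)%C) //.
  - move=> y Hy; apply: dC_val (dC_pw' y s _); [ring | lra].
  - move=> y Hy.
    have h := sk_cont _ pw_smooth y s ltac:(lra).
    case: h => [c1 c2]; split; rewrite /Re /Im /=;
    repeat first [exact: c1 | exact: c2 | apply: (continuous_plus (V := R_NormedModule)) |
      apply: (continuous_opp (V := R_NormedModule)) | apply: (continuous_scal_r (V := R_NormedModule)) | done].
rewrite cint_lin // in E; last first; try by move=> y Hy; apply: (sk_cont _ pw_smooth); lra.
rewrite pw_1 in E.
have -> : ((s - 1) * cint (fun y => pw y s) 1 x =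
  - (- (s - 1) * cint (fun y => pw y s) 1 x + 0 * cint (fun y => pw y s) 1 x))%C by ring.
rewrite E; ring.
Qed.

Lemma cint_lpw s x : 1 <= x ->
  ((s - 1) * cint (fun y => lpw y s) 1 x = cint (fun y => pw y s) 1 x - lpw x (s - 1))%C.
Proof.
move=> Hx.
have E : cint (fun y => 1 * pw y s + (- (s - 1)) * lpw y s)%C 1 x = (lpw x (s - 1) - lpw 1 (s - 1))%C.
  rewrite -(cint_FTC (fun y => lpw y (s - 1)%C) (fun y => 1 * pw y s + (- (s - 1)) * lpw y s)%C) //.
  - move=> y Hy; apply: dC_val (dC_lpw' y s _); [ring | lra].
  - move=> y Hy.
    have [c1 c2] := sk_cont _ pw_smooth y s ltac:(lra).
    have [d1 d2] := sk_cont _ lpw_smooth y s ltac:(lra).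
    split; rewrite /Re /Im /=;
    repeat first [exact: c1 | exact: c2 | exact: d1 | exact: d2 | apply: (continuous_plus (V := R_NormedModule)) |
      apply: (continuous_opp (V := R_NormedModule)) | apply: (continuous_scal_r (V := R_NormedModule)) | done].
rewrite cint_lin // in E; try by move=> y Hy; first [apply: (sk_cont _ pw_smooth); lra | apply: (sk_cont _ lpw_smooth); lra].
have -> : ((s - 1) * cint (fun y => lpw y s) 1 x = cint (fun y => pw y s) 1 x -
  (1 * cint (fun y => pw y s) 1 x + - (s - 1) * cint (fun y => lpw y s) 1 x))%C by ring.
rewrite E /lpw ln_1; ring.
Qed.

(** [zetaD] and [LfunD] are -zeta' and -L', since [lpw] carries ln n without a sign. *)
Definition zeta s := dser one pw s.
Definition zetaD s := dser one lpw s.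
Definition Lfun s := dser chi pw s.
Definition LfunD s := dser chi lpw s.

Lemma strip_neq1 s : strip s -> (s - 1)%C <> 0%C.
Proof.
move=> [h _] E; have : Re (s - 1)%C = 0 by rewrite E.
change (Re s - 1 = 0 -> False); lra.
Qed.

(** Comparison with the integral of x^-s, whose boundary term N^(1-s) vanishes for Re s > 1;
    multiplying by s - 1 keeps the pole out of the statement. *)
Lemma zeta_eq s : strip s -> ((s - 1) * zeta s = 1 + (s - 1) * Usum pw s)%C.
Proof.
move=> Hs.
have h := clim_scal (s - 1)%C _ _ (dser_lim one pw s (proj1 Hs)
   (fun k => dterm_pw_le _ _ _ (Rabs1_le k _ (one_le1 _)))).
apply: clim_unique h _.
apply: (clim_ext (fun N => (1 - pw (INR (S N)) (s - 1)) + (s - 1) * csum (fun k => uterm pw k s) N)%C).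
  move=> N; rewrite (csum_uterm pw s N pw_smooth) -cint_pw; last exact: INR_S_ge1.
  ring.
replace (1 + (s - 1) * Usum pw s)%C with ((1 - 0) + (s - 1) * Usum pw s)%C by ring.
apply: clim_plus; last first.
  apply: clim_scal; exact: (Usum_lim _ pw_smooth _ _ (Rabs_pos _) (strip_box _ Hs)).
apply: clim_minus; first exact: clim_const.
by apply: pw_lim0; change (0 < Re s - 1); case: Hs; lra.
Qed.

(** The integral of x^-s ln x over [1, +oo) is 1/(s - 1)^2, found by parts in [cint_lpw]; hence the
    squared factor. *)
Lemma zetaD_eq s : strip s -> ((s - 1) * (s - 1) * zetaD s = 1 + (s - 1) * (s - 1) * Usum lpw s)%C.
Proof.
move=> Hs; set z := (s - 1)%C.
have h := clim_scal (z * z)%C _ _ (dser_lim one lpw s (proj1 Hs) (fun k => dterm_lpw_le _ _ _ (one_le1 _))).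
apply: clim_unique h _.
apply: (clim_ext (fun N => (1 - pw (INR (S N)) z) - z * lpw (INR (S N)) z + z * z * csum (fun k => uterm lpw k s) N)%C).
  move=> N; rewrite (csum_uterm lpw s N lpw_smooth) -cint_pw; last exact: INR_S_ge1.
  have E := cint_lpw s (INR (S N)) (INR_S_ge1 N); fold z in E |- *.
  have -> : lpw (INR (S N)) z = (cint (fun y => pw y s) 1 (INR (S N)) - z * cint (fun y => lpw y s) 1 (INR (S N)))%C.
    rewrite E; ring.
  ring.
replace (1 + z * z * Usum lpw s)%C with ((1 - 0) - z * 0 + z * z * Usum lpw s)%C by ring.
have hz : 0 < Re z by change (0 < Re s - 1); case: Hs; lra.
apply: clim_plus; last first.
  apply: clim_scal; exact: (Usum_lim _ lpw_smooth _ _ (Rabs_pos _) (strip_box _ Hs)).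
apply: clim_minus; last by apply: clim_scal; exact: lpw_lim0.
apply: clim_minus; [exact: clim_const | exact: pw_lim0].
Qed.

Lemma Lfun_eq s : strip s -> Lfun s = Lsum pw s.
Proof.
move=> Hs; apply: dser_chi => //; first exact: pw_smooth.
by move=> k; apply: dterm_pw_le; apply: Rabs1_le; exact: chi_le1.
Qed.

Lemma LfunD_eq s : strip s -> LfunD s = Lsum lpw s.
Proof.
move=> Hs; apply: dser_chi => //; first exact: lpw_smooth.
by move=> k; apply: dterm_lpw_le; exact: chi_le1.
Qed.

(** * Term-by-term differentiation in the real direction *)

Lemma exp_taylor2 x : Rabs (exp x - 1 - x) <= x * x * exp (Rabs x).
Proof.
have h1 := exp_ineq1_le x; have h2 := exp_ineq1_le (- x); have p := exp_pos x.
have e : exp x * exp (- x) = 1 by rewrite -exp_plus -exp_0; congr exp; ring.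
rewrite Rabs_pos_eq; last lra.
have h3 : exp x - 1 - x <= x * (exp x - 1) by nra.
apply: Rle_trans h3 _.
case: (Rle_dec 0 x) => Hx.
  rewrite Rabs_pos_eq //; have : exp x - 1 <= x * exp x by nra. nra.
rewrite Rabs_left; last lra.
have : 1 - exp x <= - x by lra. have : 1 <= exp (- x) by lra. nra.
Qed.

Lemma derive_quadratic (f : R -> R) x l K eta : 0 < eta ->
  (forall h, Rabs h <= eta -> Rabs (f (x + h) - f x - h * l) <= K * (h * h)) -> is_derive f x l.
Proof.
move=> He H; apply/is_derive_Reals => eps Hep.
have HK := Rabs_pos K.
have Hd : 0 < Rmin eta (eps / (Rabs K + 1)).
  by apply: Rmin_pos => //; apply: Rdiv_lt_0_compat; lra.
exists (mkposreal _ Hd) => h Hh0 /= Hh.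
have h1 := H h (Rle_trans _ _ _ (Rlt_le _ _ Hh) (Rmin_l _ _)).
have h2 := Rlt_le_trans _ _ _ Hh (Rmin_r _ _).
have hp : 0 < Rabs h by apply: Rabs_pos_lt.
have -> : (f (x + h) - f x) / h - l = (f (x + h) - f x - h * l) / h by field.
rewrite /Rdiv Rabs_mult Rabs_inv; apply/Rlt_div_l => //.
have E : h * h = Rabs h * Rabs h by rewrite -Rabs_mult Rabs_pos_eq //; nra.
rewrite E in h1; have hK := Rle_abs K.
have E2 : eps / (Rabs K + 1) * (Rabs K + 1) = eps by field; lra.
have h3 : (Rabs K + 1) * Rabs h < eps by nra.
nra.
Qed.

Lemma csum_minus a b n : csum (fun k => a k - b k)%C n = (csum a n - csum b n)%C.
Proof. elim: n => /= [|n ->]; ring. Qed.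

Lemma dser_derive f sg t : (forall n, Rabs (f n) <= 1) -> 1 < sg ->
  dC (fun y => dser f pw (y, t)) (fun y => - dser f lpw (y, t))%C sg.
Proof.
(* Of the margin sg - 1 = 4 eta, one eta pays for the shift by h and two for the factor (ln n)^2;
   the exponent sg - 3 eta is still above 1. *)
move=> Hf Hs; set eta := (sg - 1) / 4; have He : 0 < eta by rewrite /eta; lra.
set m := fun k => exp (- (sg - eta) * ln (INR (S k))) * (ln (INR (S k)) * ln (INR (S k))).
have [_ [B HB]] : summable m.
  apply: (summable_le _ (fun k => (/ eta * / eta) * exp (- (sg - 3 * eta) * ln (INR (S k))))); last first.
    apply: summable_scal; last by apply: summable_pow; rewrite /eta; lra.
    by have := Rinv_0_lt_compat _ He; nra.
  move=> k; rewrite /m; have h0 := ln_ge0 _ (INR_S_ge1 k); have p := exp_pos (- (sg - eta) * ln (INR (S k))).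
  split; first by apply: Rmult_le_pos; [lra | nra].
  have h := ln_le_exp eta (INR (S k)) He.
  have -> : exp (- (sg - 3 * eta) * ln (INR (S k))) = exp (- (sg - eta) * ln (INR (S k))) *
     (exp (eta * ln (INR (S k))) * exp (eta * ln (INR (S k)))) by rewrite -!exp_plus; congr exp; ring.
  have h2 : ln (INR (S k)) * ln (INR (S k)) <=
     / eta * exp (eta * ln (INR (S k))) * (/ eta * exp (eta * ln (INR (S k)))) by apply: Rmult_le_compat.
  nra.
have main h : Rabs h <= eta ->
   Cmod (dser f pw ((sg + h)%R, t) - dser f pw (sg, t) + h * dser f lpw (sg, t))%C <= B * (h * h).
  move=> Hh; have Hh' := Rabs_le_between h eta; have [Hl Hr] := proj1 Hh' Hh.
  have l1 := dser_lim f pw ((sg + h)%R, t) ltac:(rewrite /Re /= /eta in He Hl |- *; lra)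
    (fun k => dterm_pw_le _ _ _ (Rabs1_le k _ (Hf _))).
  have l2 := dser_lim f pw (sg, t) Hs (fun k => dterm_pw_le _ _ _ (Rabs1_le k _ (Hf _))).
  have l3 := clim_scal h _ _ (dser_lim f lpw (sg, t) Hs (fun k => dterm_lpw_le _ _ _ (Hf _))).
  apply: (clim_le _ _ _ (clim_plus _ _ _ _ (clim_minus _ _ _ _ l1 l2) l3)).
  exists O => n _; rewrite -csum_scal -csum_minus -csum_plus.
  apply: (Rle_trans _ (rsum (fun k => (h * h) * m k) n)); last first.
    rewrite rsum_scal Rmult_comm; apply: Rmult_le_compat_r => //; nra.
  apply: Cmod_csum_le => k _.
  rewrite /dterm /lpw; set x := INR (S k); have hx : 0 <= ln x by exact: ln_ge0 (INR_S_ge1 k).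
  have -> : pw x ((sg + h)%R, t) = (RtoC (exp (- h * ln x)) * pw x (sg, t))%C.
    rewrite /pw /Re /Im /=; replace (- (sg + h) * ln x) with (- h * ln x + - sg * ln x) by ring.
    rewrite exp_plus; apply: C_ext; rewrite /=; ring.
  have -> : (f (S k) * (exp (- h * ln x) * pw x (sg, t)) - f (S k) * pw x (sg, t) +
     h * (f (S k) * (ln x * pw x (sg, t))))%C =
     (RtoC (f (S k)) * (RtoC (exp (- h * ln x) - 1 - (- h * ln x))%R * pw x (sg, t)))%C.
    by apply: C_ext; rewrite /=; ring.
  rewrite !Cmod_mult !Cmod_R Cmod_pw.
  have ht := exp_taylor2 (- h * ln x).
  have he : exp (Rabs (- h * ln x)) <= exp (eta * ln x).
    apply: exp_le; rewrite Rabs_mult Rabs_Ropp (Rabs_pos_eq _ hx); exact: Rmult_le_compat_r.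
  have -> : h * h * m k = 1 * (h * h * (ln x * ln x) * exp (eta * ln x) * exp (- Re (sg, t) * ln x)).
    rewrite /m -/x /Re /=; have -> : exp (- (sg - eta) * ln x) = exp (eta * ln x) * exp (- sg * ln x).
      by rewrite -exp_plus; congr exp; ring.
    ring.
  apply: Rmult_le_compat => //; first exact: Rabs_pos.
    by apply: Rmult_le_pos; [exact: Rabs_pos | apply: Rlt_le; exact: exp_pos].
  apply: Rmult_le_compat_r; first by apply: Rlt_le; exact: exp_pos.
  apply: Rle_trans ht _.
  replace (- h * ln x * (- h * ln x)) with (h * h * (ln x * ln x)) by ring.
  apply: Rmult_le_compat_l => //; apply: Rmult_le_pos; nra.
split; apply: (derive_quadratic _ _ _ B eta He) => h Hh.
- apply: Rle_trans (main h Hh); apply: Rle_trans (re_le_Cmod _).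
  by apply: Req_le; congr Rabs; rewrite /Re /=; ring.
- apply: Rle_trans (main h Hh); apply: Rle_trans (im_le_Cmod _).
  by apply: Req_le; congr Rabs; rewrite /Im /=; ring.
Qed.

(** * Logarithmic derivatives and the 3-4-1 inequality *)

Definition divb (d n : nat) : bool := Nat.eqb (n mod d) 0.

Lemma div_succ_divb d N : (1 <= d)%nat -> divb d (S N) = true -> (d * S (N / d) = S N /\ S N / d = S (N / d))%nat.
Proof.
move=> Hd /Nat.eqb_eq H.
have E := Nat.div_mod (S N) d ltac:(lia); rewrite H Nat.add_0_r in E.
case Eq : (S N / d)%nat E => [|q] E; first lia.
have E2 : (N / d = q)%nat by symmetry; apply: (Nat.div_unique _ _ _ (d - 1)); nia.
by rewrite E2.
Qed.

Lemma div_succ_ndivb d N : (1 <= d)%nat -> divb d (S N) = false -> (S N / d = N / d)%nat.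
Proof.
move=> Hd /Nat.eqb_neq H.
have E := Nat.div_mod (S N) d ltac:(lia); have h := Nat.mod_upper_bound (S N) d ltac:(lia).
apply: (Nat.div_unique _ _ _ (S N mod d - 1)); nia.
Qed.

Lemma csum_dvd (F : nat -> C) d N : (1 <= d)%nat ->
  csum (fun k => if divb d (S k) then F (S k) else 0%C) N = csum (fun m => F (d * S m)%nat) (N / d).
Proof.
move=> Hd; elim: N => [|N IH]; first by rewrite Nat.Div0.div_0_l.
change (csum (fun k => if divb d (S k) then F (S k) else 0%C) N + (if divb d (S N) then F (S N) else 0) =
  csum (fun m => F (d * S m)%nat) (S N / d))%C; rewrite IH.
case E : (divb d (S N)).
  have [E1 E2] := div_succ_divb d N Hd E; by rewrite E2 /= -E1.
by rewrite (div_succ_ndivb d N Hd E); ring.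
Qed.

Lemma csum_const0 N : csum (fun _ => 0%C) N = 0%C.
Proof. by elim: N => //= N ->; ring. Qed.

Lemma csum_swap (a : nat -> nat -> C) N M :
  csum (fun i => csum (fun j => a i j) M) N = csum (fun j => csum (fun i => a i j) N) M.
Proof.
elim: N => /= [|N ->]; first by rewrite csum_const0.
by rewrite -csum_plus.
Qed.

Lemma csum_RtoC a n : csum (fun k => RtoC (a k)) n = RtoC (rsum a n).
Proof. by elim: n => //= n ->; rewrite RtoC_plus. Qed.

Lemma is_derive_sqr_sum (u v : R -> R) x du dv : is_derive u x du -> is_derive v x dv ->
  is_derive (fun y => u y ^ 2 + v y ^ 2) x (2 * u x * du + 2 * v x * dv).
Proof.
move=> h1 h2; auto_derive; first by repeat split; eexists; eassumption.
rewrite (is_derive_unique u _ _ h1) (is_derive_unique v _ _ h2); ring.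
Qed.

Lemma is_derive_prod2 (u v p q : R -> R) x du dv dp dq a :
  is_derive u x du -> is_derive v x dv -> is_derive p x dp -> is_derive q x dq ->
  is_derive (fun y => u y * p y + a * (v y * q y)) x
    (du * p x + u x * dp + a * (dv * q x + v x * dq)).
Proof.
move=> h1 h2 h3 h4; auto_derive; first by repeat split; eexists; eassumption.
rewrite (is_derive_unique u _ _ h1) (is_derive_unique v _ _ h2) (is_derive_unique p _ _ h3)
  (is_derive_unique q _ _ h4); ring.
Qed.

(** Logarithmic differentiation without logarithms: a, b, c are logarithmic derivatives up to the
    factor -2, but the factors are not yet known to be nonzero. *)
Lemma is_derive_341 (u v p : R -> R) x a b c :
  is_derive u x (- 2 * u x * a) -> is_derive v x (- 2 * v x * b) -> is_derive p x (- 2 * p x * c) ->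
  is_derive (fun y => u y ^ 3 * v y ^ 4 * p y) x (- 2 * (u x ^ 3 * v x ^ 4 * p x) * (3 * a + 4 * b + c)).
Proof.
move=> h1 h2 h3; auto_derive; first by repeat split; eexists; eassumption.
rewrite (is_derive_unique u _ _ h1) (is_derive_unique v _ _ h2) (is_derive_unique p _ _ h3); ring.
Qed.

Lemma dC_mult f g f' g' x : dC f f' x -> dC g g' x ->
  dC (fun y => f y * g y)%C (fun y => f' y * g y + f y * g' y)%C x.
Proof.
move=> [f1 f2] [g1 g2]; split.
- apply: (is_derive_ext (fun y => Re (f y) * Re (g y) + (- (1)) * (Im (f y) * Im (g y)))).
    by move=> y; rewrite /Re /Im /=; ring.
  have -> : Re (f' x * g x + f x * g' x)%C = Re (f' x) * Re (g x) + Re (f x) * Re (g' x) +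
    (- (1)) * (Im (f' x) * Im (g x) + Im (f x) * Im (g' x)) by rewrite /Re /Im /=; ring.
  exact: (is_derive_prod2 (fun y => Re (f y)) (fun y => Im (f y)) (fun y => Re (g y)) (fun y => Im (g y))).
- apply: (is_derive_ext (fun y => Re (f y) * Im (g y) + 1 * (Im (f y) * Re (g y)))).
    by move=> y; rewrite /Re /Im /=; ring.
  have -> : Im (f' x * g x + f x * g' x)%C = Re (f' x) * Im (g x) + Re (f x) * Im (g' x) +
    1 * (Im (f' x) * Re (g x) + Im (f x) * Re (g' x)) by rewrite /Re /Im /=; ring.
  exact: (is_derive_prod2 (fun y => Re (f y)) (fun y => Im (f y)) (fun y => Im (g y)) (fun y => Re (g y))).
Qed.

Section VonMangoldt.
(** The analysis sees the von Mangoldt function only through these three properties; it is built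
    from prime powers later on. *)
Variable Lam : nat -> R.
Hypothesis Lam_ge0 : forall n, 0 <= Lam n.
Hypothesis Lam_le : forall n, (1 <= n)%nat -> Lam n <= ln (INR n).
Hypothesis Lam_div : forall n, (1 <= n)%nat ->
  rsum (fun d => if divb (S d) n then Lam (S d) else 0) n = ln (INR n).

Lemma Lam_div_le n N : (1 <= n <= N)%nat ->
  rsum (fun d => if divb (S d) n then Lam (S d) else 0) N = ln (INR n).
Proof.
move=> [H1 H2]; rewrite -Lam_div //; replace N with (n + (N - n))%nat by lia.
rewrite rsum_add; set X := rsum _ (N - n); suff -> : X = 0 by ring.
rewrite /X; elim: (N - n)%nat => //= m ->.
have -> : divb (S (n + m)) n = false by apply/Nat.eqb_neq; rewrite Nat.mod_small; lia.
ring.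
Qed.

Definition mulLam (c : nat -> R) (n : nat) : R := c n * Lam n.

Lemma mulLam_le c k : (forall n, Rabs (c n) <= 1) -> Rabs (mulLam c (S k)) <= 1 + ln (INR (S k)).
Proof.
move=> H; rewrite /mulLam Rabs_mult (Rabs_pos_eq _ (Lam_ge0 _)).
have := H (S k); have := Lam_le (S k) ltac:(lia); have := Lam_ge0 (S k); have := Rabs_pos (c (S k)); nra.
Qed.

(** Finite form of -L' = L (-L'/L): insert ln n as the sum of Lam d over d | n, write n = d m, and
    use that c and x^-s are multiplicative. *)
Lemma dterm_conv c s N : (forall m n, c (m * n)%nat = c m * c n) ->
  csum (dterm c lpw s) N =
  csum (fun d => dterm (mulLam c) pw s d * csum (dterm c pw s) (N / S d))%C N.
Proof.
move=> Hc.
transitivity (csum (fun k => csum (fun d => if divb (S d) (S k) then (Lam (S d) * (c (S k) * pw (INR (S k)) s))%C else 0%C) N) N).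
  apply: csum_ext => k Hk.
  rewrite /dterm /lpw -(Lam_div_le (S k) N ltac:(lia)) -csum_RtoC.
  have -> : forall x y z : C, (x * (y * z) = (x * z) * y)%C by move=> *; ring.
  rewrite -csum_scal; apply: csum_ext => d _; case: (divb _ _); ring.
rewrite csum_swap; apply: csum_ext => d Hd.
rewrite (csum_dvd (fun n => (Lam (S d) * (c n * pw (INR n) s))%C)); last lia.
rewrite -csum_scal; apply: csum_ext => m _.
rewrite Hc mult_INR pw_mult; try by have := INR_S_ge1 d; have := INR_S_ge1 m; lra.
by rewrite /dterm /mulLam !RtoC_mult; ring.
Qed.

(** In the finite identity each inner partial sum, of length N/d, is replaced by its limit: for
    small d it is long, and for large d the outer terms form a small tail. *)
Lemma dser_conv c s : (forall m n, c (m * n)%nat = c m * c n) -> (forall n, Rabs (c n) <= 1) ->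
  1 < Re s -> dser c lpw s = (dser c pw s * dser (mulLam c) pw s)%C.
Proof.
move=> Hc Hc1 Hs.
have lD := dser_lim c lpw s Hs (fun k => dterm_lpw_le _ _ _ (Hc1 _)).
have hL := fun k => dterm_pw_le c s k (Rabs1_le k _ (Hc1 _)).
have lL := dser_lim c pw s Hs hL.
have hP := fun k => dterm_pw_le (mulLam c) s k (mulLam_le c k Hc1).
have lP := dser_lim (mulLam c) pw s Hs hP.
have sm := summable_maj _ Hs; have [_ [B0 HB0]] := sm.
set B := Rabs B0 + 1; have HB n : rsum (maj (Re s)) n <= B.
  by apply: Rle_trans (HB0 n) _; rewrite /B; have := Rle_abs B0; lra.
have HBp : 0 < B by rewrite /B; have := Rabs_pos B0; lra.
set L := dser c pw s in lL |- *; set P := dser (mulLam c) pw s in lP |- *.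
have LB M : Cmod (csum (dterm c pw s) M - L) <= 2 * B.
  apply: Rle_trans (Cmod_triangle_minus _ _) _.
  have := Rle_trans _ _ _ (Cmod_csum_le _ _ M (fun k _ => hL k)) (HB M).
  have := clim_csum_le _ _ _ _ lL hL HB; lra.
have key : clim (fun N => csum (fun d => dterm (mulLam c) pw s d * (csum (dterm c pw s) (N / S d) - L))%C N) 0%C.
  move=> eps He; set e1 := eps / (4 * B).
  have He1 : 0 < e1 by apply: Rdiv_lt_0_compat; lra.
  have [M0 HM0] := lL e1 He1.
  have [N1 HN1] := summable_cauchy _ sm e1 He1.
  (* For an index d < N1 this gives N / (d + 1) >= M0, so the inner sum is within e1 of L. *)
  exists (N1 + N1 * M0)%nat => N HN.
  set a := fun d => _.
  replace (csum a N - 0)%C with (csum a N) by ring.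
  replace N with (N1 + (N - N1))%nat by lia; rewrite csum_add.
  apply: Rle_lt_trans (Cmod_triangle _ _) _.
  have h1 : Cmod (csum a N1) <= e1 * B.
    apply: (Rle_trans _ (rsum (fun k => e1 * maj (Re s) k) N1)).
      apply: Cmod_csum_le => k Hk; rewrite /a Cmod_mult Rmult_comm.
      apply: Rmult_le_compat; try exact: Cmod_ge_0; last exact: hP.
      apply: Rlt_le; apply: HM0; apply: (Nat.le_trans _ (N1 * M0 / N1)).
        by rewrite Nat.mul_comm Nat.div_mul; lia.
      apply: (Nat.le_trans _ (N / N1)); first by apply: Nat.Div0.div_le_mono; lia.
      by apply: Nat.div_le_compat_l; lia.
    by rewrite rsum_scal; apply: Rmult_le_compat_l (HB _); lra.
  have h2 : Cmod (csum (fun k => a (N1 + k)%nat) (N - N1)) <= 2 * B * e1.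
    apply: (Rle_trans _ (rsum (fun k => (2 * B) * maj (Re s) (N1 + k)%nat) (N - N1))).
      apply: Cmod_csum_le => k Hk; rewrite /a Cmod_mult Rmult_comm.
      by apply: Rmult_le_compat; [exact: Cmod_ge_0 | exact: Cmod_ge_0 | exact: LB | exact: hP].
    by rewrite rsum_scal; apply: Rmult_le_compat_l; [lra | exact: Rlt_le (HN1 _)].
  have E : e1 * B = eps / 4 by rewrite /e1; field; lra.
  nra.
apply: clim_unique lD _.
replace (L * P)%C with (0 + L * P)%C by ring.
apply: clim_ext (clim_plus _ _ _ _ key (clim_scal L _ _ lP)) => N.
rewrite dterm_conv // -csum_scal -csum_plus; apply: csum_ext => d _; ring.
Qed.

Definition zetaLam s := dser (mulLam one) pw s.
Definition chiLam s := dser (mulLam chi) pw s.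

Lemma zetaD_conv s : 1 < Re s -> zetaD s = (zeta s * zetaLam s)%C.
Proof. by move=> Hs; apply: dser_conv => //; [move=> *; rewrite /one; ring | exact: one_le1]. Qed.

Lemma LfunD_conv s : 1 < Re s -> LfunD s = (Lfun s * chiLam s)%C.
Proof. by move=> Hs; apply: dser_conv => //; [exact: chi_mult | exact: chi_le1]. Qed.

(* |zeta L|^2, a polynomial in real functions so that it can be differentiated along the real direction. *)
Definition zetaL_sqnorm (s : C) : R := (Re (zeta s) ^ 2 + Im (zeta s) ^ 2) * (Re (Lfun s) ^ 2 + Im (Lfun s) ^ 2).

Lemma zetaL_sqnorm_Cmod s : zetaL_sqnorm s = Cmod (zeta s * Lfun s) ^ 2.
Proof. by rewrite /zetaL_sqnorm Cmod_mult Rpow_mult_distr !Cmod2_alt. Qed.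

Lemma is_derive_norm2 (f g : R -> C) (q : C) x : dC f g x -> g x = (- (f x * q))%C ->
  is_derive (fun y => Re (f y) ^ 2 + Im (f y) ^ 2) x (- 2 * (Re (f x) ^ 2 + Im (f x) ^ 2) * Re q).
Proof.
move=> [h1 h2] E; rewrite E in h1 h2.
have -> : - 2 * (Re (f x) ^ 2 + Im (f x) ^ 2) * Re q =
  2 * Re (f x) * Re (- (f x * q))%C + 2 * Im (f x) * Im (- (f x * q))%C.
  by rewrite /Re /Im /=; ring.
exact: (is_derive_sqr_sum (fun y => Re (f y)) (fun y => Im (f y))).
Qed.

Lemma zetaL_sqnorm_derive sg t : 1 < sg ->
  is_derive (fun y => zetaL_sqnorm (y, t)) sg (- 2 * zetaL_sqnorm (sg, t) * Re (zetaLam (sg, t) + chiLam (sg, t))%C).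
Proof.
move=> Hs.
have dz := dser_derive one sg t one_le1 Hs; have dl := dser_derive chi sg t chi_le1 Hs.
have hz := is_derive_norm2 _ _ (zetaLam (sg, t)) _ dz (f_equal Copp (zetaD_conv (sg, t) Hs)).
have hl := is_derive_norm2 _ _ (chiLam (sg, t)) _ dl (f_equal Copp (LfunD_conv (sg, t) Hs)).
have h := is_derive_mult _ _ _ _ _ hz hl Rmult_comm.
move: h; rewrite /plus /mult /=.
set v := (_ + _) => h; suff <- : v = - 2 * zetaL_sqnorm (sg, t) * Re (zetaLam (sg, t) + chiLam (sg, t))%C by exact: h.
rewrite /v /zetaL_sqnorm /zeta /Lfun re_plus /=; ring.
Qed.

Lemma zetaLam_chiLam_lim s : 1 < Re s ->
  clim (csum (dterm (fun n => Lam n * (1 + chi n)) pw s)) (zetaLam s + chiLam s)%C.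
Proof.
move=> Hs.
have l1 := dser_lim (mulLam one) pw s Hs (fun k => dterm_pw_le (mulLam one) s k (mulLam_le one k one_le1)).
have l2 := dser_lim (mulLam chi) pw s Hs (fun k => dterm_pw_le (mulLam chi) s k (mulLam_le chi k chi_le1)).
apply: clim_ext (clim_plus _ _ _ _ l1 l2) => N; rewrite -csum_plus; apply: csum_ext => k _.
by rewrite /dterm /mulLam /one -Cmult_plus_distr_r -RtoC_plus; congr (RtoC _ * _)%C; ring.
Qed.

(* 3 + 4 cos a + cos 2a = 2 (1 + cos a)^2, with a = t ln n. *)
Lemma re_341 sg t : 1 < sg ->
  0 <= 3 * Re (zetaLam (sg, 0) + chiLam (sg, 0))%C + 4 * Re (zetaLam (sg, t) + chiLam (sg, t))%C
       + Re (zetaLam (sg, 2 * t)%R + chiLam (sg, 2 * t)%R)%C.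
Proof.
move=> Hs.
have l0 := clim_scal 3%C _ _ (zetaLam_chiLam_lim (sg, 0) Hs).
have l1 := clim_scal 4%C _ _ (zetaLam_chiLam_lim (sg, t) Hs).
have l2 := zetaLam_chiLam_lim (sg, 2 * t)%R Hs.
have l := clim_plus _ _ _ _ (clim_plus _ _ _ _ l0 l1) l2.
have := clim_re_le _ _ 0 l.
rewrite !re_plus !re_scal_l => H; apply: H; exists O => n _.
rewrite !re_plus !re_scal_l !re_csum -!rsum_scal -!rsum_plus; apply: rsum_nonneg => k _.
rewrite /dterm !re_scal_l /pw /Re /Im /= Rmult_0_l cos_0.
set x := match k with O => _ | _ => _ end.
replace (2 * t * ln x) with (2 * (t * ln x)) by ring; rewrite cos_2a_cos.
have h1 := Lam_ge0 (S k); have h2 : 0 <= 1 + chi (S k) by case: (chi_cases (S k)) => [->|[->|->]]; lra.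
have h3 := exp_pos (- sg * ln x); set c := cos _.
have -> : 3 * (Lam (S k) * (1 + chi (S k)) * (exp (- sg * ln x) * 1)) +
  4 * (Lam (S k) * (1 + chi (S k)) * (exp (- sg * ln x) * c)) +
  Lam (S k) * (1 + chi (S k)) * (exp (- sg * ln x) * (2 * c * c - 1)) =
  Lam (S k) * (1 + chi (S k)) * exp (- sg * ln x) * (2 * ((1 + c) * (1 + c))) by ring.
apply: Rmult_le_pos; last by have := Rle_0_sqr (1 + c); rewrite /Rsqr; lra.
apply: Rmult_le_pos; last lra.
exact: Rmult_le_pos.
Qed.

(** |F(sg)|^6 |F(sg + it)|^8 |F(sg + 2it)|^2 with F = zeta L; squared moduli double the exponents 3,
    4, 1. *)
Definition prod341 t sg := zetaL_sqnorm (sg, 0) ^ 3 * zetaL_sqnorm (sg, t) ^ 4 * zetaL_sqnorm (sg, 2 * t).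

Lemma zetaL_sqnorm_ge0 s : 0 <= zetaL_sqnorm s.
Proof. rewrite zetaL_sqnorm_Cmod; exact: pow2_ge_0. Qed.

(** The derivative is -2 times the product times the expression of [re_341], so it is at most 0. *)
Lemma prod341_decreasing t sg : 1 < sg <= 2 -> prod341 t 2 <= prod341 t sg.
Proof.
move=> [H1 H2].
set p := fun y u => Re (zetaLam (y, u) + chiLam (y, u))%C.
set d := fun y => - 2 * prod341 t y * (3 * p y 0 + 4 * p y t + p y (2 * t)).
have hd : forall y, sg <= y <= 2 -> is_derive (prod341 t) y (d y).
  move=> y Hy; have hy : 1 < y by lra.
  have d0 := zetaL_sqnorm_derive y 0 hy; have d1 := zetaL_sqnorm_derive y t hy; have d2 := zetaL_sqnorm_derive y (2 * t) hy.
  exact: (is_derive_341 (fun y => zetaL_sqnorm (y, 0)) (fun y => zetaL_sqnorm (y, t)) (fun y => zetaL_sqnorm (y, 2 * t))).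
have [c [Hc E]] := MVT_gen (prod341 t) sg 2 d
  ltac:(rewrite Rmin_left // Rmax_right // => x Hx; apply: hd; lra)
  ltac:(rewrite Rmin_left // Rmax_right // => x Hx; apply: derivable_continuous_pt;
        exists (d x); apply/is_derive_Reals; exact: hd).
rewrite Rmin_left // Rmax_right // in Hc.
have hP : 0 <= prod341 t c.
  rewrite /prod341; apply: Rmult_le_pos; last exact: zetaL_sqnorm_ge0.
  apply: Rmult_le_pos; apply: pow_le; exact: zetaL_sqnorm_ge0.
have h3 := re_341 c t ltac:(lra).
have : d c <= 0 by rewrite /d /p; nra.
nra.
Qed.

(** 1/4 from n = 2, and a telescoping 1/2 from n >= 3. *)
Lemma sum_inv_sq N : rsum (fun k => exp (- 2 * ln (INR (S (S k))))) N <= 3 / 4.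
Proof.
have e k : exp (- 2 * ln (INR (S (S k)))) = / INR (S (S k)) * / INR (S (S k)).
  have h := INR_S_ge1 (S k).
  by replace (- 2 * ln (INR (S (S k)))) with (- ln (INR (S (S k))) + - ln (INR (S (S k)))) by ring;
     rewrite exp_plus exp_Ropp exp_ln //; lra.
have main n : rsum (fun k => exp (- 2 * ln (INR (S (S k))))) (S n) <= 3 / 4 - / INR (S (S n)).
  elim: n => [|n IH]; first by rewrite /= -/(INR 2) (e O) /=; lra.
  change (rsum (fun k => exp (- 2 * ln (INR (S (S k))))) (S n) + exp (- 2 * ln (INR (S (S (S n)))))
    <= 3 / 4 - / INR (S (S (S n)))).
  rewrite e (S_INR (S (S n))); have h := INR_S_ge1 (S n); move: IH h; set x := INR (S (S n)) => IH h.
  have : / (x + 1) * / (x + 1) <= / x - / (x + 1).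
    have -> : / x - / (x + 1) = / x * / (x + 1) by field; lra.
    apply: Rmult_le_compat_r; first by apply: Rlt_le; apply: Rinv_0_lt_compat; lra.
    by apply: Rinv_le_contravar; lra.
  lra.
case: N => [|n]; first by rewrite /=; lra.
apply: Rle_trans (main n) _; have : 0 < / INR (S (S n)) by apply: Rinv_0_lt_compat; have := INR_S_ge1 (S n); lra.
lra.
Qed.

(** The first term is 1 and the others add up to at most 3/4 in modulus. *)
Lemma dser_2_neq0 f t : f 1%nat = 1 -> (forall n, Rabs (f n) <= 1) -> dser f pw (2, t) <> 0%C.
Proof.
move=> f1 Hf.
have l := dser_lim f pw (2, t) ltac:(rewrite /Re /=; lra) (fun k => dterm_pw_le _ _ _ (Rabs1_le k _ (Hf _))).
have h : Cmod (1 - dser f pw (2, t))%C <= 3 / 4.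
  apply: (clim_le _ _ _ (clim_minus _ _ _ _ (clim_const 1%C) l)); exists 1%nat => n Hn.
  replace n with (1 + (n - 1))%nat by lia; rewrite csum_add /=.
  have -> : dterm f pw (2, t) 0 = 1%C by rewrite /dterm f1 /= pw_1; ring.
  set X := csum _ _; replace (1 - (0 + 1 + X))%C with (- X)%C by ring.
  rewrite Cmod_opp; apply: Rle_trans (sum_inv_sq (n - 1)); apply: Cmod_csum_le => k _.
  change (Cmod (f (S (S k)) * pw (INR (S (S k))) (2, t))%C <= exp (- 2 * ln (INR (S (S k))))).
  rewrite Cmod_mult Cmod_R Cmod_pw; change (Re (2, t)) with 2; have -> : - (2) = -2 by ring.
  have h1 := exp_pos (-2 * ln (INR (S (S k)))); have h2 := Hf (S (S k)).
  apply: (Rle_trans _ (1 * exp (-2 * ln (INR (S (S k)))))); last by apply: Req_le; ring.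
  by apply: Rmult_le_compat_r => //; exact: Rlt_le.
move=> E; rewrite E in h; replace (1 - 0)%C with (RtoC 1) in h by ring; rewrite Cmod_1 in h; lra.
Qed.

Lemma zetaL_sqnorm_2_pos t : 0 < zetaL_sqnorm (2, t).
Proof.
rewrite zetaL_sqnorm_Cmod; apply: pow_lt; apply/Cmod_gt_0; apply: Cmult_neq_0; apply: dser_2_neq0 => //.
- exact: one_le1.
- exact: chi_le1.
Qed.

Lemma prod341_pos t sg : 1 < sg <= 2 -> 0 < prod341 t sg.
Proof.
move=> H; apply: Rlt_le_trans (prod341_decreasing t sg H).
have h0 := zetaL_sqnorm_2_pos 0; have h1 := zetaL_sqnorm_2_pos t; have h2 := zetaL_sqnorm_2_pos (2 * t).
rewrite /prod341; apply: Rmult_lt_0_compat => //; apply: Rmult_lt_0_compat; exact: pow_lt.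
Qed.

(** A zero would make [prod341] vanish, whereas it is positive at 2 and at least as large to the
    left; this takes the place of the Euler product. *)
Lemma zeta_L_neq0 s : strip s -> (zeta s * Lfun s)%C <> 0%C.
Proof.
case: s => sg t Hs E.
have := prod341_pos t sg Hs; rewrite /prod341.
have -> : zetaL_sqnorm (sg, t) = 0 by rewrite zetaL_sqnorm_Cmod E Cmod_0 /=; ring.
rewrite /=; lra.
Qed.

(** * Non-vanishing on the line Re s = 1 *)

(** (s - 1) zeta(s), and next to it (s - 1) zeta(s) L(s, chi), written so as to make sense on the
    line Re s = 1. *)
Definition zeta_fac (s : C) : C := (1 + (s - 1) * Usum pw s)%C.
Definition zetaL_fac (s : C) : C := (zeta_fac s * Lsum pw s)%C.

Lemma UC_sub1 T : UC (box T) (fun s => s - 1)%C.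
Proof. by apply: UC_minus; [exact: (UC_id _ _ (box_Cmod T)) | exact: UC_const]. Qed.

Lemma UC_zeta_fac T : 0 <= T -> UC (box T) zeta_fac.
Proof.
move=> HT; apply: UC_plus; first exact: UC_const.
by apply: UC_mult; [exact: UC_sub1 | exact: (UC_Usum _ pw_smooth)].
Qed.

Lemma UC_zetaL_fac T : 0 <= T -> UC (box T) zetaL_fac.
Proof. by move=> HT; apply: UC_mult; [exact: UC_zeta_fac | exact: (UC_Lsum _ pw_smooth)]. Qed.

Lemma zetaL_fac_eq s : strip s -> zetaL_fac s = ((s - 1) * (zeta s * Lfun s))%C.
Proof. by move=> Hs; rewrite /zetaL_fac /zeta_fac -zeta_eq // -Lfun_eq //; ring. Qed.

(** At s = 1 the value is L(1, chi) = (1 - 1/2) + (1/4 - 1/5) + ..., whose brackets are nonnegative,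
    the first being 1/2. *)
Lemma zetaL_fac_1_neq0 : zetaL_fac 1%C <> 0%C.
Proof.
have Hb : box 1 1%C by split; rewrite /Re /Im /= ?Rabs_R0; lra.
have l := Lsum_lim _ pw_smooth 1 1%C ltac:(lra) Hb.
have h : 1 / 2 <= Re (Lsum pw 1%C).
  apply: (clim_re_le _ _ _ l); exists 1%nat => n Hn; rewrite re_csum.
  have hp k : Re (lterm pw k 1%C) = / INR (S (3 * k)) - / INR (S (S (3 * k))).
    rewrite /lterm !pw_one; first by [].
      by have := INR_S_ge1 (S (3 * k)); lra.
    by have := INR_S_ge1 (3 * k); lra.
  have -> : 1 / 2 = rsum (fun k => Re (lterm pw k 1%C)) 1 by rewrite /rsum hp /=; field.
  apply: rsum_mono => // k; rewrite hp.
  have : / INR (S (S (3 * k))) <= / INR (S (3 * k)).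
    by apply: Rinv_le_contravar; [have := INR_S_ge1 (3 * k); lra | apply: le_INR; lia].
  lra.
rewrite /zetaL_fac /zeta_fac => E; have E2 : Lsum pw 1%C = 0%C by rewrite -E; ring.
by rewrite E2 /Re /= in h; lra.
Qed.

Lemma derive_Cmod_bound f g sg sg' M : sg <= sg' -> (forall y, sg <= y <= sg' -> dC f g y) ->
  (forall y, sg <= y <= sg' -> Cmod (g y) <= M) -> Cmod (f sg') <= Cmod (f sg) + 2 * M * (sg' - sg).
Proof.
move=> H Hd HM; have := mvt_C f g sg sg' M H Hd HM.
have := Cmod_triangle_rev (f sg') (f sg); lra.
Qed.

Lemma strip_pair sg t : 1 < sg <= 2 -> box (Rabs t) (sg, t) /\ strip (sg, t).
Proof. by move=> H; split; split; rewrite /Re /Im /=; lra. Qed.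

Lemma UC_bound D f : UC D f -> exists2 M, 0 < M & forall s, D s -> Cmod (f s) <= M.
Proof.
move=> [[M HM] _]; exists (Rabs M + 1); first by have := Rabs_pos M; lra.
by move=> s Hs; apply: Rle_trans (HM s Hs) _; have := Rle_abs M; lra.
Qed.

Lemma Re_Cmod_t sg t : Rabs t <= Cmod ((sg, t) - 1)%C.
Proof.
apply: Rle_trans (im_le_Cmod _); apply: Req_le; congr Rabs; rewrite /Im /=; ring.
Qed.

(* If zetaL_fac vanished at 1 + it, then F = zeta L would vanish there to first order
   along the real direction, and prod341 would tend to 0 at 1. *)
Lemma zetaL_fac_line_neq0 t : zetaL_fac (1, t) <> 0%C.
Proof.
case: (Req_dec t 0) => [->|Ht]; first exact: zetaL_fac_1_neq0.
move=> E.
have ht : 0 < Rabs t by apply: Rabs_pos_lt.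
have ht0 := Rlt_le _ _ ht.
have [Mu Mu0 HMu] := UC_bound _ _ (UC_Usum _ pw_smooth _ ht0).
have [Mk Mk0 HMk] := UC_bound _ _ (UC_Usum _ lpw_smooth _ ht0).
have [Ml Ml0 HMl] := UC_bound _ _ (UC_Lsum _ pw_smooth _ ht0).
have [Md Md0 HMd] := UC_bound _ _ (UC_Lsum _ lpw_smooth _ ht0).
have [Mq Mq0 HMq] := UC_bound _ _ (UC_zetaL_fac 0 ltac:(lra)).
have [Mr Mr0 HMr] := UC_bound _ _ (UC_zetaL_fac (Rabs (2 * t)) (Rabs_pos _)).
set it := / Rabs t; have it0 : 0 < it by exact: Rinv_0_lt_compat.
have inv_le sg : 1 < sg <= 2 -> Cmod (/ ((sg, t) - 1))%C <= it.
  move=> Hs; have [_ Hsg] := strip_pair sg t Hs; rewrite Cmod_inv; last exact: strip_neq1.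
  by apply: Rinv_le_contravar => //; exact: Re_Cmod_t.
have bz sg : 1 < sg <= 2 -> Cmod (zeta (sg, t)) <= it + Mu.
  move=> Hs; have [Hb Hsg] := strip_pair sg t Hs; have n1 := strip_neq1 _ Hsg.
  have -> : zeta (sg, t) = (/ ((sg, t) - 1) + Usum pw (sg, t))%C.
    have h := zeta_eq _ Hsg.
    have -> : zeta (sg, t) = (((sg, t) - 1) * zeta (sg, t) / ((sg, t) - 1))%C by field.
    by rewrite h; field.
  by apply: Rle_trans (Cmod_triangle _ _) _; have := inv_le sg Hs; have := HMu _ Hb; lra.
have bzd sg : 1 < sg <= 2 -> Cmod (zetaD (sg, t)) <= it * it + Mk.
  move=> Hs; have [Hb Hsg] := strip_pair sg t Hs; have n1 := strip_neq1 _ Hsg.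
  have -> : zetaD (sg, t) = (/ ((sg, t) - 1) * / ((sg, t) - 1) + Usum lpw (sg, t))%C.
    have h := zetaD_eq _ Hsg.
    have -> : zetaD (sg, t) = (((sg, t) - 1) * ((sg, t) - 1) * zetaD (sg, t) / (((sg, t) - 1) * ((sg, t) - 1)))%C by field.
    by rewrite h; field.
  apply: Rle_trans (Cmod_triangle _ _) _; rewrite Cmod_mult.
  have h1 := inv_le sg Hs; have := HMk _ Hb; have := Cmod_ge_0 (/ ((sg, t) - 1))%C; nra.
have bl sg : 1 < sg <= 2 -> Cmod (Lfun (sg, t)) <= Ml.
  by move=> Hs; have [Hb Hsg] := strip_pair sg t Hs; rewrite Lfun_eq //; exact: HMl.
have bld sg : 1 < sg <= 2 -> Cmod (LfunD (sg, t)) <= Md.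
  by move=> Hs; have [Hb Hsg] := strip_pair sg t Hs; rewrite LfunD_eq //; exact: HMd.
(* Bounds the derivative of F = zeta L at height t, where |s - 1| >= |t| keeps away from the
   pole. *)
set M := (it * it + Mk) * Ml + (it + Mu) * Md.
have M0 : 0 < M by rewrite /M; nra.
have hd sg : 1 < sg <= 2 -> dC (fun y => zeta (y, t) * Lfun (y, t))%C
    (fun y => - (zetaD (y, t) * Lfun (y, t) + zeta (y, t) * LfunD (y, t)))%C sg.
  move=> [Hs _].
  apply: dC_val (dC_mult _ _ _ _ _ (dser_derive one sg t one_le1 Hs) (dser_derive chi sg t chi_le1 Hs)).
  by rewrite /zetaD /LfunD /zeta /Lfun; ring.
have bd sg : 1 < sg <= 2 -> Cmod (- (zetaD (sg, t) * Lfun (sg, t) + zeta (sg, t) * LfunD (sg, t)))%C <= M.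
  move=> Hs; rewrite Cmod_opp; apply: Rle_trans (Cmod_triangle _ _) _; rewrite !Cmod_mult /M.
  apply: Rplus_le_compat; apply: Rmult_le_compat; try exact: Cmod_ge_0; auto.
(* The assumed zero makes F at most eps at some sg0 close to 1; the bound M on the derivative
   carries the estimate over to sg. *)
have small sg : 1 < sg <= 2 -> Cmod (zeta (sg, t) * Lfun (sg, t))%C <= 2 * M * (sg - 1).
  move=> Hs; apply: le_epsilon => eps He.
  have [_ HQ] := UC_zetaL_fac _ ht0.
  have [d Hd Hq] := HQ (eps * Rabs t) ltac:(nra).
  set sg0 := Rmin sg (1 + d / 2).
  have h0 : 1 < sg0 <= sg by split; [apply: Rmin_glb_lt; lra | exact: Rmin_l].
  have h0' : sg0 - 1 < d by have := Rmin_r sg (1 + d / 2); rewrite -/sg0; lra.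
  have [Hb Hsg] := strip_pair sg0 t ltac:(lra); have n1 := strip_neq1 _ Hsg.
  have h1 := derive_Cmod_bound _ _ sg0 sg M (proj2 h0) (fun y Hy => hd y ltac:(lra)) (fun y Hy => bd y ltac:(lra)).
  apply: Rle_trans h1 _.
  have h2 : Cmod (zetaL_fac (sg0, t)) < eps * Rabs t.
    replace (zetaL_fac (sg0, t)) with (zetaL_fac (sg0, t) - zetaL_fac (1, t))%C by (rewrite E; ring).
    apply: Hq => //; first by split; rewrite /Re /Im /=; lra.
    have -> : ((sg0, t) - (1, t))%C = RtoC (sg0 - 1) by apply: C_ext; rewrite /=; ring.
    by rewrite Cmod_R Rabs_pos_eq; lra.
  rewrite zetaL_fac_eq // Cmod_mult in h2.
  have h3 := Re_Cmod_t sg0 t; have h4 := Cmod_ge_0 (zeta (sg0, t) * Lfun (sg0, t)).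
  have : Cmod (zeta (sg0, t) * Lfun (sg0, t)) <= eps by nra.
  nra.
have F0 sg : 1 < sg <= 2 -> Cmod (zeta (sg, 0) * Lfun (sg, 0))%C <= Mq / (sg - 1).
  move=> Hs; have [Hb Hsg] := strip_pair sg 0 Hs; rewrite Rabs_R0 in Hb.
  have h := HMq _ Hb; rewrite zetaL_fac_eq // Cmod_mult in h.
  have e : Cmod ((sg, 0) - 1)%C = sg - 1.
    have -> : ((sg, 0) - 1)%C = RtoC (sg - 1) by apply: C_ext; rewrite /=; ring.
    by rewrite Cmod_R Rabs_pos_eq; lra.
  by rewrite e in h; apply/Rle_div_r; lra.
have F2 sg : 1 < sg <= 2 -> Cmod (zeta (sg, 2 * t)%R * Lfun (sg, 2 * t)%R)%C <= Mr * it.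
  move=> Hs; have [Hb Hsg] := strip_pair sg (2 * t) Hs.
  have h := HMr _ Hb; rewrite zetaL_fac_eq // Cmod_mult in h.
  have h2 := Re_Cmod_t sg (2 * t); rewrite Rabs_mult (Rabs_pos_eq 2) in h2; last lra.
  have h3 := Cmod_ge_0 (zeta (sg, 2 * t)%R * Lfun (sg, 2 * t)%R).
  apply/Rle_div_r => //; nra.
set c0 := prod341 t 2; have c0p : 0 < c0 by apply: prod341_pos; lra.
set K := (Mq ^ 2) ^ 3 * ((2 * M) ^ 2) ^ 4 * (Mr * it) ^ 2.
have Kp : 0 < K.
  have Mri : 0 < Mr * it by nra.
  by rewrite /K; apply: Rmult_lt_0_compat; [apply: Rmult_lt_0_compat|]; repeat apply: pow_lt; lra.
(* (sg - 1)^-6 from the simple pole at 1 against (sg - 1)^8 from the assumed zero leaves (sg - 1)^2,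
   which cannot stay above c0 > 0. *)
have fin sg : 1 < sg <= 2 -> c0 <= K * (sg - 1) ^ 2.
  move=> Hs; apply: Rle_trans (prod341_decreasing t sg Hs) _; rewrite /prod341 !zetaL_sqnorm_Cmod.
  have -> : K * (sg - 1) ^ 2 =
     ((Mq / (sg - 1)) ^ 2) ^ 3 * ((2 * M * (sg - 1)) ^ 2) ^ 4 * (Mr * it) ^ 2 by rewrite /K; field; lra.
  have c1 := Cmod_ge_0 (zeta (sg, 0) * Lfun (sg, 0)).
  have c2 := Cmod_ge_0 (zeta (sg, t) * Lfun (sg, t)).
  have c3 := Cmod_ge_0 (zeta (sg, 2 * t)%R * Lfun (sg, 2 * t)%R).
  apply: Rmult_le_compat.
  - by apply: Rmult_le_pos; repeat apply: pow_le.
  - exact: pow_le.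
  - apply: Rmult_le_compat; try by repeat apply: pow_le.
    + by apply: pow_incr; split; [exact: pow_le | apply: pow_incr; split; auto].
    + by apply: pow_incr; split; [exact: pow_le | apply: pow_incr; split; auto].
  - by apply: pow_incr; split; auto.
set e := Rmin 1 (c0 / (2 * K)).
have ep : 0 < e by apply: Rmin_pos; [lra | apply: Rdiv_lt_0_compat; lra].
have e1 : e <= 1 by exact: Rmin_l.
have e2 : e * (2 * K) <= c0 by apply/Rle_div_r; [lra | exact: Rmin_r].
have h := fin (1 + e) ltac:(lra).
replace (1 + e - 1) with e in h by ring.
have : K * e ^ 2 <= K * e by rewrite /=; nra.
nra.
Qed.
End VonMangoldt.

(** * Continuous extension to the line Re s = 1 *)

(** Open at Re s = 1. The width d will depend on the height T, because the lower bound for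
    [zetaL_fac] comes from compactness. *)
Definition near_line (d T : R) (s : C) := 1 < Re s <= 1 + d /\ Rabs (Im s) <= T.

Lemma near_line_box d T s : d <= 1 -> near_line d T s -> box T s /\ strip s.
Proof. move=> Hd [h1 h2]; split; split; lra. Qed.

Section Extension.
Variable Lam : nat -> R.
Hypothesis Lam_ge0 : forall n, 0 <= Lam n.
Hypothesis Lam_le : forall n, (1 <= n)%nat -> Lam n <= ln (INR n).
Hypothesis Lam_div : forall n, (1 <= n)%nat ->
  rsum (fun d => if divb (S d) n then Lam (S d) else 0) n = ln (INR n).

(** Compactness: the modulus is continuous and nonzero on the segment, so it has a positive
    minimum. *)
Lemma zetaL_fac_lower T : 0 <= T -> exists2 m, 0 < m & forall t, Rabs t <= T -> m <= Cmod (zetaL_fac (1, t)).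
Proof.
move=> HT; have [_ HU] := UC_zetaL_fac (T + 1) ltac:(lra).
have cont : forall c, - T <= c <= T -> continuity_pt (fun t => Cmod (zetaL_fac (1, t))) c.
  move=> c Hc eps He; have [d Hd H] := HU eps He.
  exists (Rmin d 1); split; first by apply: Rmin_pos; lra.
  move=> x [_ Hx]; change (Rabs (x - c) < Rmin d 1) in Hx.
  have hx1 := Rlt_le_trans _ _ _ Hx (Rmin_l _ _); have hx2 := Rlt_le_trans _ _ _ Hx (Rmin_r _ _).
  move/Rabs_lt_between: (hx2) => hx3.
  have h : Cmod (zetaL_fac (1, x) - zetaL_fac (1, c))%C < eps.
    apply: H.
    - split; rewrite /Re /Im /=; first lra. apply/Rabs_le; lra.
    - split; rewrite /Re /Im /=; first lra. apply/Rabs_le; lra.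
    - apply: Rle_lt_trans (Cmod_le_re_im _) _; rewrite /Re /Im /=.
      replace (1 + - (1)) with 0 by ring; rewrite Rabs_R0; rewrite /Rminus in hx1; lra.
  change (Rabs (Cmod (zetaL_fac (1, x)) - Cmod (zetaL_fac (1, c))) < eps); apply: Rabs_def1.
    by have := Cmod_triangle_rev (zetaL_fac (1, x)) (zetaL_fac (1, c)); lra.
  by have := Cmod_triangle_rev (zetaL_fac (1, c)) (zetaL_fac (1, x)); rewrite Cmod_minus_sym; lra.
have [t0 [Ht0 _]] := continuity_ab_min _ (- T) T ltac:(lra) cont.
exists (Cmod (zetaL_fac (1, t0))); first by apply/Cmod_gt_0; exact: (zetaL_fac_line_neq0 Lam).
by move=> t Ht; apply: Ht0; apply/Rabs_le_between.
Qed.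

(** The derivative of [zeta_fac], as [Usum lpw] is minus the derivative of [Usum pw]; thus
    -zeta'/zeta is 1/(s - 1) minus [zetaD_fac] over [zeta_fac]. *)
Definition zetaD_fac (s : C) : C := (Usum pw s - (s - 1) * Usum lpw s)%C.

(** -zeta'/zeta and zeta share the polar part 1/(s - 1), which cancels. The fractions are brought to
    the denominator [zetaL_fac], the one that is bounded below. *)
Lemma log_deriv_extension_eq s : strip s -> (zetaLam Lam s + chiLam Lam s - zeta s =
  - (zetaD_fac s * Lsum pw s * / zetaL_fac s) - Usum pw s + Lsum lpw s * zeta_fac s * / zetaL_fac s)%C.
Proof.
move=> Hs; have nz := zeta_L_neq0 Lam Lam_ge0 Lam_le Lam_div s Hs.
have n1 := strip_neq1 _ Hs.
have nzeta : zeta s <> 0%C by move=> E; apply: nz; rewrite E; ring.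
have nL : Lfun s <> 0%C by move=> E; apply: nz; rewrite E; ring.
have eH : zeta_fac s = ((s - 1) * zeta s)%C by rewrite /zeta_fac -zeta_eq.
have nH : zeta_fac s <> 0%C by rewrite eH; exact: Cmult_neq_0.
have ePL : chiLam Lam s = (LfunD s / Lfun s)%C.
  by rewrite (LfunD_conv Lam Lam_ge0 Lam_le Lam_div) ?(proj1 Hs) //; [field | exact: (proj1 Hs)].
have ePz : zetaLam Lam s = (zetaD s / zeta s)%C.
  by rewrite (zetaD_conv Lam Lam_ge0 Lam_le Lam_div) //; [field | exact: (proj1 Hs)].
have ezD : zetaD s = ((1 + (s - 1) * (s - 1) * Usum lpw s) / ((s - 1) * (s - 1)))%C.
  by rewrite -zetaD_eq //; field.
have ez : zeta s = (zeta_fac s / (s - 1))%C by rewrite eH; field.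
rewrite ePL ePz ezD /zetaL_fac -Lfun_eq // -LfunD_eq // ez /zetaD_fac; move: nH nL n1; rewrite /zeta_fac.
set z := (s - 1)%C; set U := Usum pw s; set k := Usum lpw s; set L := Lfun s; set D := LfunD s.
by move=> nH nL n1; field.
Qed.

Lemma log_deriv_extension T : 0 <= T -> exists2 d, 0 < d <= 1 &
  UC (near_line d T) (fun s => zetaLam Lam s + chiLam Lam s - zeta s)%C.
Proof.
move=> HT; have [m Hm HQ] := zetaL_fac_lower T HT; have [_ HU] := UC_zetaL_fac T HT.
have [d0 Hd0 Hd] := HU (m / 2) ltac:(lra).
(* Within d of the line, uniform continuity keeps the modulus of [zetaL_fac] above m/2. *)
set d := Rmin 1 (d0 / 2); have hd1 : d <= 1 by exact: Rmin_l.
have hd2 : d <= d0 / 2 by exact: Rmin_r.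
have hd : 0 < d by apply: Rmin_pos; lra.
exists d => //.
have sub s : near_line d T s -> box T s by move=> H; exact: (proj1 (near_line_box _ _ _ hd1 H)).
apply: (UC_ext _ (fun s => - (zetaD_fac s * Lsum pw s * / zetaL_fac s) - Usum pw s + Lsum lpw s * zeta_fac s * / zetaL_fac s)%C).
  by move=> s Hs; rewrite log_deriv_extension_eq //; exact: (proj2 (near_line_box _ _ _ hd1 Hs)).
have uU := UC_sub _ _ _ sub (UC_Usum _ pw_smooth T HT).
have uk := UC_sub _ _ _ sub (UC_Usum _ lpw_smooth T HT).
have uL := UC_sub _ _ _ sub (UC_Lsum _ pw_smooth T HT).
have uD := UC_sub _ _ _ sub (UC_Lsum _ lpw_smooth T HT).
have uH := UC_sub _ _ _ sub (UC_zeta_fac T HT).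
have us := UC_sub _ _ _ sub (UC_sub1 T).
have uQ : UC (near_line d T) (fun s => / zetaL_fac s)%C.
  apply: (UC_inv _ _ (m / 2)); [lra | | exact: UC_sub sub (UC_zetaL_fac T HT)].
  case=> sg t Hs; have [h1 h2] := Hs; rewrite /Re /Im /= in h1 h2.
  have h := HQ t h2.
  have : Cmod (zetaL_fac (1, t) - zetaL_fac (sg, t))%C < m / 2.
    apply: Hd; [by split; rewrite /Re /Im /=; lra | exact: sub |].
    have -> : ((1, t) - (sg, t))%C = RtoC (1 - sg) by apply: C_ext; rewrite /=; ring.
    by rewrite Cmod_R Rabs_left; lra.
  have := Cmod_triangle_rev (zetaL_fac (1, t)) (zetaL_fac (sg, t)); lra.
apply: UC_plus.
  apply: UC_minus => //; apply: UC_opp; apply: UC_mult => //; apply: UC_mult => //.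
  by apply: UC_minus => //; apply: UC_mult.
by apply: UC_mult => //; apply: UC_mult.
Qed.

(** * Abel summation of the coefficients *)

Definition fcoef (n : nat) : R := Lam n * (1 + chi n) - 1.
Definition Ssum (N : nat) : R := rsum (fun k => fcoef (S k)) N.

Lemma fcoef_lim s : 1 < Re s -> clim (csum (dterm fcoef pw s)) (zetaLam Lam s + chiLam Lam s - zeta s)%C.
Proof.
move=> Hs.
have l1 := zetaLam_chiLam_lim Lam Lam_ge0 Lam_le s Hs.
have l2 := dser_lim one pw s Hs (fun k => dterm_pw_le _ _ _ (Rabs1_le k _ (one_le1 _))).
apply: clim_ext (clim_minus _ _ _ _ l1 l2) => N; rewrite -csum_minus; apply: csum_ext => k _.
by rewrite /dterm /fcoef /one RtoC_minus; ring.
Qed.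

(* n^-s - (n+1)^-s minus its main term s n^(-s-1). *)
Definition eterm (k : nat) (s : C) : C :=
  (pw (INR (S k)) s - pw (INR (S (S k))) s - s * pw (INR (S k)) (s + 1))%C.

(** The partial sums S(n) may grow like n, so the remainder must be O(n^-5/2) to remain summable
    after multiplication by them. The mean value theorem is applied to -y^-s - y s n^(-s-1), whose
    derivative s (y^(-s-1) - n^(-s-1)) is small. *)
Lemma eterm_bound T : 0 <= T -> exists2 K, 0 <= K &
  forall k s, box T s -> INR (S k) * Cmod (eterm k s) <= K * pow32 k.
Proof.
move=> HT; have [K HK Hd] := sk_diff _ pw_smooth T HT.
exists (2 * ((2 + T) * (K + 1))); first nra.
move=> k s Hs; set n := INR (S k); have hn : 1 <= n by exact: INR_S_ge1.
set M := (2 + T) * (K + 1) * pow32 k * / n.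
have in0 : 0 < / n by apply: Rinv_0_lt_compat; lra.
have hw := pow32_pos k.
have hd x : n <= x <= n + 1 ->
   dC (fun y => - pw y s - RtoC y * (s * pw n (s + 1)))%C (fun y => s * (pw y (s + 1) - pw n (s + 1)))%C x.
  move=> Hx; have [p1 p2] := dC_pw x s ltac:(lra).
  have lin (u : R -> R) du a : is_derive u x du -> is_derive (fun y => - u y - y * a) x (- du - a).
    by move=> h; auto_derive; [repeat split; eexists; eassumption | rewrite (is_derive_unique u _ _ h); ring].
  split.
    apply: (is_derive_ext (fun y => - Re (pw y s) - y * Re (s * pw n (s + 1))%C)).
      by move=> y; rewrite /Re /Im /=; ring.
    have -> : Re (s * (pw x (s + 1) - pw n (s + 1)))%C = - Re (- (s * pw x (s + 1)))%C - Re (s * pw n (s + 1))%C.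
      by rewrite /Re /Im /=; ring.
    exact: (lin (fun y => Re (pw y s))).
  apply: (is_derive_ext (fun y => - Im (pw y s) - y * Im (s * pw n (s + 1))%C)).
    by move=> y; rewrite /Re /Im /=; ring.
  have -> : Im (s * (pw x (s + 1) - pw n (s + 1)))%C = - Im (- (s * pw x (s + 1)))%C - Im (s * pw n (s + 1))%C.
    by rewrite /Re /Im /=; ring.
  exact: (lin (fun y => Im (pw y s))).
have hb x : n <= x <= n + 1 -> Cmod (s * (pw x (s + 1) - pw n (s + 1)))%C <= M.
  move=> Hx; rewrite Cmod_mult /M.
  have hs := box_Cmod _ _ Hs; have h := Hd s k x Hs Hx; rewrite -/n in h.
  rewrite !pw_succ; try lra.
  have -> : (pw x s * RtoC (/ x) - pw n s * RtoC (/ n) =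
    (pw x s - pw n s) * RtoC (/ x) + pw n s * (RtoC (/ x) - RtoC (/ n)))%C by ring.
  have h1 : Cmod (pw n s) <= / n.
    rewrite Cmod_pw; have -> : / n = exp (- ln n) by rewrite exp_Ropp exp_ln //; lra.
    by apply: exp_le; have := ln_ge0 _ hn; case: Hs => [[h1 _] _]; nra.
  have h2 : Cmod (RtoC (/ x) - RtoC (/ n))%C <= / n * / n.
    rewrite -RtoC_minus Cmod_R Rabs_minus_sym.
    have -> : / n - / x = / n * ((x - n) * / x) by field; lra.
    have ix : 0 < / x <= / n by split; [apply: Rinv_0_lt_compat | apply: Rinv_le_contravar]; lra.
    rewrite Rabs_pos_eq; first by apply: Rmult_le_compat_l; nra.
    by apply: Rmult_le_pos; nra.
  have h3 : Cmod (RtoC (/ x)) <= / n.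
    rewrite Cmod_R Rabs_pos_eq; first by apply: Rinv_le_contravar; lra.
    by apply: Rlt_le; apply: Rinv_0_lt_compat; lra.
  have h4 : / n * / n <= pow32 k.
    rewrite /pow32 -/n; have -> : / n * / n = exp (- (2) * ln n).
      by replace (- (2) * ln n) with (- ln n + - ln n) by ring; rewrite exp_plus exp_Ropp exp_ln //; lra.
    by apply: exp_le; have := ln_ge0 _ hn; lra.
  have h5 : Cmod ((pw x s - pw n s) * RtoC (/ x) + pw n s * (RtoC (/ x) - RtoC (/ n)))%C <= (K + 1) * pow32 k * / n.
    apply: Rle_trans (Cmod_triangle _ _) _; rewrite !Cmod_mult.
    have a1 : Cmod (pw x s - pw n s) * Cmod (RtoC (/ x)) <= K * pow32 k * / n.
      by apply: Rmult_le_compat => //; exact: Cmod_ge_0.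
    have a2 : Cmod (pw n s) * Cmod (RtoC (/ x) - RtoC (/ n))%C <= / n * (/ n * / n).
      by apply: Rmult_le_compat => //; exact: Cmod_ge_0.
    have a3 : / n * (/ n * / n) <= / n * pow32 k by apply: Rmult_le_compat_l => //; lra.
    lra.
  rewrite !Rmult_assoc; apply: Rmult_le_compat; [exact: Cmod_ge_0 | exact: Cmod_ge_0 | exact: hs |].
  by apply: Rle_trans h5 _; lra.
have := mvt_C _ _ n (n + 1) M ltac:(lra) hd hb.
have -> : (- pw (n + 1) s - RtoC (n + 1) * (s * pw n (s + 1)) - (- pw n s - RtoC n * (s * pw n (s + 1))))%C = eterm k s.
  by rewrite /eterm (S_INR (S k)) -/n RtoC_plus; ring.
move=> h; apply: (Rle_trans _ (n * (2 * M * (n + 1 - n)))); first by apply: Rmult_le_compat_l; lra.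
by apply: Req_le; rewrite /M; field; lra.
Qed.

Lemma UC_eterm T k : 0 <= T -> UC (box T) (eterm k).
Proof.
move=> HT; have h1 := INR_S_ge1 k; have h2 := INR_S_ge1 (S k).
apply: (UC_ext _ (fun s => pw (INR (S k)) s - pw (INR (S (S k))) s - s * (pw (INR (S k)) s * RtoC (/ INR (S k))))%C).
  by move=> s _; rewrite /eterm pw_succ //; lra.
apply: UC_minus; first by apply: UC_minus; exact: UC_pw.
apply: UC_mult; first exact: (UC_id _ _ (box_Cmod T)).
by apply: UC_mult; [exact: UC_pw | exact: UC_const].
Qed.

Lemma abel_sum s N : csum (dterm fcoef pw s) N =
  (Ssum N * pw (INR (S N)) s +
   csum (fun k => Ssum (S k) * (pw (INR (S k)) s - pw (INR (S (S k))) s)) N)%C.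
Proof.
elim: N => [|N IH]; first by rewrite /= /Ssum /=; ring.
change (csum (dterm fcoef pw s) N + fcoef (S N) * pw (INR (S N)) s =
  (Ssum N + fcoef (S N))%R * pw (INR (S (S N))) s +
  (csum (fun k => Ssum (S k) * (pw (INR (S k)) s - pw (INR (S (S k))) s)) N +
   (Ssum N + fcoef (S N))%R * (pw (INR (S N)) s - pw (INR (S (S N))) s)))%C.
rewrite IH RtoC_plus; ring.
Qed.

Variable M : R.
Hypothesis M_ge0 : 0 <= M.
Hypothesis Ssum_le : forall n, Rabs (Ssum n) <= M * INR n.

Definition scoef (n : nat) : R := Ssum n / INR n.

Lemma scoef_le k : Rabs (scoef (S k)) <= M.
Proof.
have h := INR_S_ge1 k; rewrite /scoef /Rdiv Rabs_mult Rabs_inv (Rabs_pos_eq (INR (S k))); last lra.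
by apply/Rle_div_l; [lra | exact: Ssum_le].
Qed.

Lemma scoef_lim s : 1 < Re s -> clim (csum (dterm scoef pw s)) (dser scoef pw s).
Proof.
move=> Hs; apply: (cser_correct _ (fun k => M * exp (- Re s * ln (INR (S k))))).
  move=> k; rewrite /dterm Cmod_mult Cmod_R Cmod_pw; apply: Rmult_le_compat_r; last exact: scoef_le.
  by apply: Rlt_le; exact: exp_pos.
by apply: summable_scal => //; exact: summable_pow.
Qed.

Definition Efun (s : C) : C := cser (fun k => Ssum (S k) * eterm k s)%C.

Lemma Eterm_bound T : 0 <= T -> exists2 K, 0 <= K &
  forall k s, box T s -> Cmod (Ssum (S k) * eterm k s)%C <= K * pow32 k.
Proof.
move=> HT; have [K HK H] := eterm_bound T HT; exists (M * K); first nra.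
move=> k s Hs; rewrite Cmod_mult Cmod_R.
apply: (Rle_trans _ (M * INR (S k) * Cmod (eterm k s))).
  by apply: Rmult_le_compat_r; [exact: Cmod_ge_0 | exact: Ssum_le].
by rewrite !Rmult_assoc; apply: Rmult_le_compat_l => //; exact: H.
Qed.

Lemma Efun_lim T s : 0 <= T -> box T s -> clim (csum (fun k => Ssum (S k) * eterm k s)%C) (Efun s).
Proof.
move=> HT Hs; have [K HK H] := Eterm_bound T HT.
apply: (cser_correct _ (fun k => K * pow32 k)); first by move=> k; exact: H.
exact: summable_scal summable_pow32.
Qed.

Lemma UC_Efun T : 0 <= T -> UC (box T) Efun.
Proof.
move=> HT; have [K HK H] := Eterm_bound T HT.
apply: (UC_series _ (fun k s => Ssum (S k) * eterm k s)%C _ (fun k => K * pow32 k)).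
- exact: summable_scal summable_pow32.
- by move=> k; apply: UC_mult; [exact: UC_const | exact: UC_eterm].
- by move=> k s; exact: H.
- by move=> s; exact: Efun_lim.
Qed.

(** The main terms of Abel summation are s S(n) n^(-s-1), that is s times S(n)/n times n^-s; the
    boundary term S(N) (N + 1)^-s tends to 0 because S(N) = O(N) and Re s > 1. *)
Lemma scoef_eq s : strip s ->
  (s * dser scoef pw s = zetaLam Lam s + chiLam Lam s - zeta s - Efun s)%C.
Proof.
move=> Hs; have hs : 1 < Re s := proj1 Hs.
have l1 := fcoef_lim s hs.
have l2 := Efun_lim _ s (Rabs_pos _) (strip_box _ Hs).
have l3 : clim (fun N => Ssum N * pw (INR (S N)) s)%C 0%C.
  move=> eps He; have [N HN] := exp_ln_small (Re s - 1) M eps ltac:(lra) M_ge0 He.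
  exists N => n Hn; set X := (_ * _)%C; replace (X - 0)%C with X by ring.
  rewrite /X Cmod_mult Cmod_R Cmod_pw; apply: Rle_lt_trans (HN n Hn).
  have h := INR_S_ge1 n.
  have E := exp_ln_inv (INR (S n)) (Re s - 1) ltac:(lra).
  replace (Re s - 1 + 1) with (Re s) in E by ring; rewrite E.
  have p := exp_pos (- (Re s - 1) * ln (INR (S n))).
  have h2 : Rabs (Ssum n) <= M * INR (S n).
    by apply: Rle_trans (Ssum_le n) _; apply: Rmult_le_compat_l => //; apply: le_INR; lia.
  apply: (Rle_trans _ (M * INR (S n) * (exp (- (Re s - 1) * ln (INR (S n))) * / INR (S n)))).
    apply: Rmult_le_compat_r => //; apply: Rmult_le_pos; first lra.
    by apply: Rlt_le; apply: Rinv_0_lt_compat; lra.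
  by apply: Req_le; field; lra.
have l4 := clim_minus _ _ _ _ (clim_minus _ _ _ _ l1 l3) l2.
have l5 := clim_scal s _ _ (scoef_lim s hs).
apply: clim_unique l5 _.
replace (zetaLam Lam s + chiLam Lam s - zeta s - Efun s)%C with (zetaLam Lam s + chiLam Lam s - zeta s - 0 - Efun s)%C by ring.
apply: clim_ext l4 => N; rewrite abel_sum.
set X := (Ssum N * _)%C; have -> : forall u v : C, (X + u - X - v = u - v)%C by move=> *; ring.
rewrite -csum_minus -csum_scal; apply: csum_ext => k _; rewrite /eterm /dterm /scoef.
have h := INR_S_ge1 k; rewrite pw_succ; last lra.
rewrite /Rdiv RtoC_mult; ring.
Qed.

Lemma scoef_extension T : 0 <= T -> exists2 d, 0 < d <= 1 & UC (near_line d T) (dser scoef pw).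
Proof.
move=> HT; have [d Hd HU] := log_deriv_extension T HT; exists d => //.
have sub s : near_line d T s -> box T s by move=> H; exact: (proj1 (near_line_box _ _ _ (proj2 Hd) H)).
have low s : near_line d T s -> 1 <= Cmod s.
  by move=> [h _]; apply: Rle_trans (re_le_Cmod _); rewrite Rabs_pos_eq; lra.
have us : UC (near_line d T) (fun s => s) := UC_sub _ _ _ sub (UC_id _ _ (box_Cmod T)).
apply: (UC_ext _ (fun s => (zetaLam Lam s + chiLam Lam s - zeta s - Efun s) * / s)%C).
  move=> s Hs; rewrite -scoef_eq; last exact: (proj2 (near_line_box _ _ _ (proj2 Hd) Hs)).
  have n0 : s <> 0%C by apply/Cmod_gt_0; have := low s Hs; lra.
  by field.
apply: UC_mult; last by apply: (UC_inv _ (fun s => s) 1); [lra | | ].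
by apply: UC_minus => //; apply: UC_sub sub (UC_Efun T HT).
Qed.

End Extension.

(** * The Fejer kernel *)

(** The triangular weight makes this cosine transform nonnegative, 2 sin^2(T u/2)/(T u^2), with
    decay u^-2. *)
Definition fejer (T u : R) : R := RInt (fun t => (1 - t / T) * cos (t * u)) 0 T.

Lemma is_RInt_fejer T u : is_RInt (fun t => (1 - t / T) * cos (t * u)) 0 T (fejer T u).
Proof.
apply: (RInt_correct (V := R_CompleteNormedModule)).
apply: (ex_RInt_continuous (V := R_CompleteNormedModule)) => z _.
apply: (ex_derive_continuous (V := R_NormedModule)); auto_derive => //.
Qed.

Lemma fejer_eq T u : 0 < T -> u <> 0 -> fejer T u = (1 - cos (T * u)) / (T * (u * u)).
Proof.
move=> HT Hu; apply: is_RInt_unique.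
have -> : (1 - cos (T * u)) / (T * (u * u)) =
   minus ((1 - T / T) * sin (T * u) / u - cos (T * u) / (T * (u * u)))
         ((1 - 0 / T) * sin (0 * u) / u - cos (0 * u) / (T * (u * u))).
  by rewrite /minus /plus /opp /= Rmult_0_l sin_0 cos_0; field; lra.
apply: (is_RInt_derive (V := R_CompleteNormedModule)
  (fun t => (1 - t / T) * sin (t * u) / u - cos (t * u) / (T * (u * u)))) => x _.
  auto_derive => //; field; lra.
apply: (ex_derive_continuous (V := R_NormedModule)); auto_derive => //.
Qed.

Lemma fejer_le T u : 0 < T -> u <> 0 -> 0 <= fejer T u <= 2 / T * / (u * u).
Proof.
move=> HT Hu; rewrite fejer_eq //.
have hu : 0 < u * u by apply: (Rsqr_pos_lt u).
have h := COS_bound (T * u); have hi : 0 < / (T * (u * u)) by apply: Rinv_0_lt_compat; nra.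
rewrite /Rdiv; split; first by apply: Rmult_le_pos; lra.
have -> : 2 * / T * / (u * u) = 2 * / (T * (u * u)) by field; lra.
by apply: Rmult_le_compat_r; lra.
Qed.

Lemma cos_ge_half x : Rabs x <= 1 -> 1 / 2 <= cos x.
Proof.
move=> H; have h3 : 3 < PI by have := PI2_3_2; lra.
rewrite -cos_PI3; have -> : cos x = cos (Rabs x).
  by rewrite /Rabs; case: Rcase_abs => // _; rewrite cos_neg.
have h0 := Rabs_pos x; apply: cos_decr_1; lra.
Qed.

(** Here cos(t u) >= 1/2 on the whole range, and the triangle has area T/2. *)
Lemma fejer_near T u : 0 < T -> Rabs u <= / T -> T / 4 <= fejer T u.
Proof.
move=> HT Hu.
have E : is_RInt (fun t => (1 - t / T) * (1 / 2)) 0 T (T / 4).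
  have -> : T / 4 = minus ((T - T * T / (2 * T)) / 2) ((0 - 0 * 0 / (2 * T)) / 2).
    by rewrite /minus /plus /opp /=; field; lra.
  apply: (is_RInt_derive (V := R_CompleteNormedModule) (fun t => (t - t * t / (2 * T)) / 2)) => x _.
    auto_derive => //; field; lra.
  apply: (ex_derive_continuous (V := R_NormedModule)); auto_derive => //.
apply: (is_RInt_le _ _ _ _ _ _ (Rlt_le _ _ HT) E (is_RInt_fejer T u)) => x Hx.
have hx : x / T <= 1 by apply/Rle_div_l; lra.
apply: Rmult_le_compat_l; first lra.
apply: cos_ge_half; rewrite Rabs_mult (Rabs_pos_eq x); last lra.
have : x * Rabs u <= T * / T by apply: Rmult_le_compat; try lra; exact: Rabs_pos.
rewrite Rinv_r; lra.
Qed.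

Lemma fejer_ge0 T u : 0 < T -> 0 <= fejer T u.
Proof.
move=> HT; case: (Req_dec u 0) => [->|Hu]; last by have := fejer_le T u HT Hu; lra.
apply: Rle_trans (fejer_near T 0 HT _); first lra.
by rewrite Rabs_R0; apply: Rlt_le; exact: Rinv_0_lt_compat.
Qed.

(** * The Riemann-Lebesgue lemma by translation *)

Lemma ex_RInt_cont (f : R -> R) a b : a <= b -> (forall x, a <= x <= b -> continuous f x) -> ex_RInt f a b.
Proof.
move=> H Hf; apply: (ex_RInt_continuous (V := R_CompleteNormedModule)) => z.
by rewrite Rmin_left // Rmax_right //; exact: Hf.
Qed.

(** Translation by h changes the sign of c, so twice the integral is the integral of (g(t) - g(t +
    h)) c(t) plus two end pieces of length h. *)
Lemma riemann_lebesgue (g c : R -> R) T h B om : 0 < h <= T ->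
  (forall t, 0 <= t <= T -> continuous g t) -> (forall t, continuous c t) ->
  (forall t, c (t + h) = - c t) -> (forall t, Rabs (c t) <= 1) ->
  (forall t, 0 <= t <= T -> Rabs (g t) <= B) ->
  (forall t, 0 <= t <= T - h -> Rabs (g t - g (t + h)) <= om) ->
  Rabs (RInt (fun t => g t * c t) 0 T) <= om * T + B * h.
Proof.
move=> Hh Hg Hc Hper Hc1 HB Hom.
have cgc t : 0 <= t <= T -> continuous (fun t => g t * c t) t.
  by move=> Ht; apply: (continuous_mult (K := R_AbsRing)); [exact: Hg | exact: Hc].
have csh (f : R -> R) t : continuous f (t + h) -> continuous (fun t => f (t + h)) t.
  move=> Hf; apply: (continuous_comp (fun t => t + h) f) => //.
  by apply: (continuous_plus (V := R_NormedModule)); [exact: continuous_id | exact: continuous_const].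
have e1 : ex_RInt (fun t => g t * c t) 0 (T - h) by apply: ex_RInt_cont => [|x Hx]; [lra | apply: cgc; lra].
have e2 : ex_RInt (fun t => g t * c t) (T - h) T by apply: ex_RInt_cont => [|x Hx]; [lra | apply: cgc; lra].
have e3 : ex_RInt (fun t => g t * c t) 0 h by apply: ex_RInt_cont => [|x Hx]; [lra | apply: cgc; lra].
have e4 : ex_RInt (fun t => g t * c t) h T by apply: ex_RInt_cont => [|x Hx]; [lra | apply: cgc; lra].
have e5 : ex_RInt (fun t => g (t + h) * c t) 0 (T - h).
  apply: ex_RInt_cont => [|x Hx]; first lra.
  apply: (continuous_mult (K := R_AbsRing)); last exact: Hc.
  by apply: csh; apply: Hg; lra.
set I := RInt _ 0 T.
have E1 : RInt (fun t => g t * c t) 0 (T - h) + RInt (fun t => g t * c t) (T - h) T = I.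
  exact: (RInt_Chasles (V := R_CompleteNormedModule) _ _ _ _ e1 e2).
have E2 : RInt (fun t => g t * c t) 0 h + RInt (fun t => g t * c t) h T = I.
  exact: (RInt_Chasles (V := R_CompleteNormedModule) _ _ _ _ e3 e4).
have E3 : RInt (fun t => g t * c t) h T = - RInt (fun t => g (t + h) * c t) 0 (T - h).
  have e4' : ex_RInt (fun t => g t * c t) (1 * 0 + h) (1 * (T - h) + h).
    replace (1 * 0 + h) with h by ring; replace (1 * (T - h) + h) with T by ring; exact: e4.
  have := RInt_comp_lin (V := R_CompleteNormedModule) _ 1 h 0 (T - h) e4'.
  replace (1 * 0 + h) with h by ring; replace (1 * (T - h) + h) with T by ring.
  move=> <-.
  have -> : - RInt (fun t => g (t + h) * c t) 0 (T - h) = RInt (fun t => - (g (t + h) * c t)) 0 (T - h).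
    by symmetry; exact: (RInt_opp (V := R_CompleteNormedModule) (fun t => g (t + h) * c t)).
  apply: RInt_ext => x _; rewrite /scal /= /mult /= /opp /=.
  by replace (1 * x + h) with (x + h) by ring; rewrite Hper; ring.
have E4 : RInt (fun t => g t * c t) 0 (T - h) - RInt (fun t => g (t + h) * c t) 0 (T - h) =
   RInt (fun t => (g t - g (t + h)) * c t) 0 (T - h).
  transitivity (RInt (fun t => g t * c t - g (t + h) * c t) 0 (T - h)).
    by symmetry; exact: (RInt_minus (V := R_CompleteNormedModule) (fun t => g t * c t) (fun t => g (t + h) * c t)).
  by apply: RInt_ext => x _; rewrite /minus /plus /opp /=; ring.
have bnd (f : R -> R) t K : Rabs (f t) <= K -> Rabs (f t * c t) <= K.
  move=> H; rewrite Rabs_mult; have := Hc1 t; have := Rabs_pos (f t); have := Rabs_pos (c t); nra.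
have b1 : Rabs (RInt (fun t => (g t - g (t + h)) * c t) 0 (T - h)) <= (T - h - 0) * om.
  apply: abs_RInt_le_const; first lra.
    apply: ex_RInt_cont => [|x Hx]; first lra.
    apply: (continuous_mult (K := R_AbsRing)); last exact: Hc.
    apply: (continuous_minus (V := R_NormedModule)); first by apply: Hg; lra.
    by apply: csh; apply: Hg; lra.
  by move=> t Ht; apply: (bnd (fun t => g t - g (t + h))); exact: Hom.
have b2 : Rabs (RInt (fun t => g t * c t) (T - h) T) <= (T - (T - h)) * B.
  by apply: abs_RInt_le_const => //; [lra | move=> t Ht; apply: bnd; apply: HB; lra].
have b3 : Rabs (RInt (fun t => g t * c t) 0 h) <= (h - 0) * B.
  by apply: abs_RInt_le_const => //; [lra | move=> t Ht; apply: bnd; apply: HB; lra].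
have om0 : 0 <= om by apply: Rle_trans (Rabs_pos _) (Hom 0 _); lra.
move/Rabs_le_between: b1; move/Rabs_le_between: b2; move/Rabs_le_between: b3 => b3 b2 b1.
apply/Rabs_le; split; nra.
Qed.

(** * Sums over n weighted by the distance of log n to x *)

(* The increments of clamp along ln n are at most 1/n near xi and nonpositive
   elsewhere, so telescoping bounds from below the sum of 1/n over the n with
   ln n close to xi. *)
Definition clamp (lo hi x : R) := Rmin (Rmax x lo) hi.

Lemma clamp_cases lo hi x : lo <= hi -> (x <= lo /\ clamp lo hi x = lo) \/
  (lo <= x <= hi /\ clamp lo hi x = x) \/ (hi <= x /\ clamp lo hi x = hi).
Proof.
move=> H; rewrite /clamp; case: (Rle_dec x lo) => H1.
  by left; rewrite Rmax_right // Rmin_left.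
rewrite Rmax_left; last lra.
case: (Rle_dec x hi) => H2; right; [left | right].
  by rewrite Rmin_left; lra.
by rewrite Rmin_right; lra.
Qed.

Lemma clamp_step xi r n : 0 < r -> 1 <= n -> ln (/ r + 1) <= xi ->
  clamp xi (xi + r) (ln (n + 1)) - clamp xi (xi + r) (ln n) <= / n /\
  (r < Rabs (ln n - xi) -> clamp xi (xi + r) (ln (n + 1)) - clamp xi (xi + r) (ln n) <= 0).
Proof.
move=> Hr Hn Hxi; have [_ h1] := ln_S_diff n ltac:(lra).
have h0 : 0 < / n by apply: Rinv_0_lt_compat; lra.
have h2 : ln n < ln (n + 1) by apply: ln_increasing; lra.
(* A step of ln from below xi - r to above xi is longer than r, so 1/n > r; but then ln(n + 1) <
   ln(1/r + 1) <= xi. *)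
have h3 : ln n < xi - r -> ln (n + 1) <= xi.
  move=> H; apply: Rnot_lt_le => H2.
  have h4 : r < / n by lra.
  have h5 : n < / r by rewrite -(Rinv_inv n); apply: Rinv_lt_contravar => //; nra.
  have : ln (n + 1) < ln (/ r + 1) by apply: ln_increasing; lra.
  lra.
have c1 := clamp_cases xi (xi + r) (ln n) ltac:(lra).
have c2 := clamp_cases xi (xi + r) (ln (n + 1)) ltac:(lra).
split; first lra.
move=> Ha; case: (Rle_dec (ln n) xi) => Hc.
  rewrite Rabs_left1 in Ha; last lra.
  have := h3 ltac:(lra); lra.
rewrite Rabs_pos_eq in Ha; lra.
Qed.

Lemma clamp_sum xi r N : 0 <= xi -> 0 < r -> xi + r <= ln (INR (S N)) ->
  rsum (fun k => clamp xi (xi + r) (ln (INR (S k) + 1)) - clamp xi (xi + r) (ln (INR (S k)))) N = r.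
Proof.
move=> Hx Hr HN.
have E n : rsum (fun k => clamp xi (xi + r) (ln (INR (S k) + 1)) - clamp xi (xi + r) (ln (INR (S k)))) n =
   clamp xi (xi + r) (ln (INR (S n))) - clamp xi (xi + r) (ln 1).
  elim: n => [|n IH]; first by rewrite /=; ring.
  by rewrite /rsum -/rsum IH (S_INR (S n)); ring.
rewrite E ln_1.
have := clamp_cases xi (xi + r) (ln (INR (S N))) ltac:(lra).
have := clamp_cases xi (xi + r) 0 ltac:(lra); lra.
Qed.

(** Up to a constant, a majorant for the part of the Fejer sum outside the window of radius rho: the
    decay of [fejer_le], with n^-1 in place of n^-sg. *)
Definition far (xi rho : R) (k : nat) : R :=
  match Rle_dec (Rabs (ln (INR (S k)) - xi)) rho with
  | left _ => 0
  | right _ => / INR (S k) * / ((xi - ln (INR (S k))) * (xi - ln (INR (S k))))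
  end.

(* Differences of this potential dominate the terms of far with ln n < xi and,
   after reflection, those with ln n > xi. *)
Definition plow (xi rho x : R) := / Rmax (xi - x) rho.

Lemma plow_mono xi rho x y : 0 < rho -> x <= y -> plow xi rho x <= plow xi rho y.
Proof.
move=> H Hxy; apply: Rinv_le_contravar.
  by apply: Rlt_le_trans H (Rmax_r _ _).
by apply: Rle_max_compat_r; lra.
Qed.

Lemma plow_le xi rho x : 0 < rho -> 0 < plow xi rho x <= / rho.
Proof.
move=> H; have h := Rmax_r (xi - x) rho; split; first by apply: Rinv_0_lt_compat; lra.
by apply: Rinv_le_contravar.
Qed.

Lemma inv_gap a b m c : 0 < a -> a <= b -> 0 < m -> m <= b - a -> b <= c * a ->
  m * / (a * a) <= c * (/ a - / b).
Proof.
move=> Ha Hab Hm Hm2 Hc.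
have E : / a - / b = (b - a) * (/ a * / b) by field; lra.
have ia : 0 < / a by exact: Rinv_0_lt_compat.
have ib : 0 < / b by apply: Rinv_0_lt_compat; lra.
rewrite E Rinv_mult.
have h : / a <= c * / b.
  apply: (Rmult_le_reg_r (a * b)); first nra.
  have -> : / a * (a * b) = b by field; lra.
  have -> : c * / b * (a * b) = c * a by field; lra.
  exact: Hc.
have c0 : 0 < c by nra.
apply: (Rle_trans _ ((b - a) * (/ a * / a))); first by apply: Rmult_le_compat_r; nra.
have -> : c * ((b - a) * (/ a * / b)) = (b - a) * (/ a * (c * / b)) by ring.
apply: Rmult_le_compat_l; first lra.
by apply: Rmult_le_compat_l; lra.
Qed.

Lemma ln2_le1 : ln 2 <= 1.
Proof. have := ln_le_sub1 2 ltac:(lra); lra. Qed.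

Lemma ln_0 : ln 0 = 0.
Proof. by rewrite /ln; case: Rlt_dec => [h|//]; have := Rlt_irrefl _ h. Qed.

Lemma far_step xi rho k : 0 < rho -> 1 <= xi ->
  far xi rho k <= match k with O => 1 | _ => 0 end +
    (1 + / rho) * (plow xi rho (ln (INR (S k))) - plow xi rho (ln (INR k))) +
    2 * (1 + / rho) * (plow (- xi) rho (- ln (INR (S k))) - plow (- xi) rho (- ln (INR (S k) + 1))).
Proof.
move=> Hr Hxi; have hn := INR_S_ge1 k; set n := INR (S k) in hn |- *.
have ir : 0 < / rho by exact: Rinv_0_lt_compat.
have hk : ln (INR k) <= ln n.
  (* For k = 0 the left side is the default value [ln 0 = 0]. *)
  case: (k) @n hn => [|j] n hn; first by rewrite /n /= ln_1 ln_0; lra.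
  by apply: ln_le; [apply: lt_0_INR; lia | apply: le_INR; lia].
have p1 := plow_mono xi rho _ _ Hr hk.
have hn1 : ln n < ln (n + 1) by apply: ln_increasing; lra.
have p2 := plow_mono (- xi) rho (- ln (n + 1)) (- ln n) Hr ltac:(lra).
have q1 : 0 <= (1 + / rho) * (plow xi rho (ln n) - plow xi rho (ln (INR k))) by apply: Rmult_le_pos; lra.
have q2 : 0 <= 2 * (1 + / rho) * (plow (- xi) rho (- ln n) - plow (- xi) rho (- ln (n + 1))).
  by apply: Rmult_le_pos; lra.
have q0 : 0 <= match k with O => 1 | _ => 0 end by case: (k) => [|?]; lra.
rewrite /far -/n; case: Rle_dec => Hd; first lra.
have in0 : 0 < / n by apply: Rinv_0_lt_compat; lra.
case: (Rle_dec (ln n) xi) => Hc.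
  have Hd' : rho < xi - ln n by rewrite Rabs_left1 in Hd; lra.
  case: (k) @n hn hk p1 hn1 p2 q1 q2 q0 Hd in0 Hc Hd' => [|j] n hn hk p1 hn1 p2 q1 q2 q0 Hd in0 Hc Hd'.
    have -> : / n * / ((xi - ln n) * (xi - ln n)) = / xi * / xi.
      by rewrite /n /= ln_1; field; lra.
    have : / xi <= / 1 by apply: Rinv_le_contravar; lra.
    have : 0 < / xi by apply: Rinv_0_lt_compat; lra.
    rewrite Rinv_1; nra.
  have hj := INR_S_ge1 j; have En : n = INR (S j) + 1 by rewrite /n S_INR.
  have [d1 d2] := ln_S_diff (INR (S j)) ltac:(lra); rewrite -En in d1 d2.
  have d3 : ln n - ln (INR (S j)) <= 1.
    have : / INR (S j) <= / 1 by apply: Rinv_le_contravar; lra.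
    rewrite Rinv_1; lra.
  have hg : 1 <= / rho * (xi - ln n).
    by apply: (Rmult_le_reg_l rho) => //; rewrite -Rmult_assoc Rinv_r; lra.
  have := inv_gap (xi - ln n) (xi - ln (INR (S j))) (/ n) (1 + / rho) ltac:(lra) ltac:(lra) in0 ltac:(lra) ltac:(lra).
  have -> : plow xi rho (ln n) = / (xi - ln n) by rewrite /plow Rmax_left; lra.
  have -> : plow xi rho (ln (INR (S j))) = / (xi - ln (INR (S j))) by rewrite /plow Rmax_left; lra.
  lra.
have Hd' : rho < ln n - xi by rewrite Rabs_pos_eq in Hd; lra.
have [d1 d2] := ln_S_diff n ltac:(lra).
have d3 : ln (n + 1) - ln n <= 1.
  have : / n <= / 1 by apply: Rinv_le_contravar; lra.
  rewrite Rinv_1; lra.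
have d4 : 0 < / (n + 1) by apply: Rinv_0_lt_compat; lra.
have hg : 1 <= / rho * (ln n - xi).
  by apply: (Rmult_le_reg_l rho) => //; rewrite -Rmult_assoc Rinv_r; lra.
have := inv_gap (ln n - xi) (ln (n + 1) - xi) (/ (n + 1)) (1 + / rho) ltac:(lra) ltac:(lra) d4 ltac:(lra) ltac:(lra).
have -> : plow (- xi) rho (- ln n) = / (ln n - xi).
  by rewrite /plow Rmax_left; [congr Rinv; ring | lra].
have -> : plow (- xi) rho (- ln (n + 1)) = / (ln (n + 1) - xi).
  by rewrite /plow Rmax_left; [congr Rinv; ring | lra].
have -> : (xi - ln n) * (xi - ln n) = (ln n - xi) * (ln n - xi) by ring.
set v := / ((ln n - xi) * (ln n - xi)).
have v0 : 0 < v by apply: Rinv_0_lt_compat; nra.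
have hn2 : / n <= 2 * / (n + 1).
  have -> : 2 * / (n + 1) = / ((n + 1) / 2) by field; lra.
  by apply: Rinv_le_contravar; lra.
nra.
Qed.

Definition farC (rho : R) := 1 + 3 * ((1 + / rho) * / rho).

(** The differences in [far_step] telescope, and both potentials lie between 0 and 1/rho; the bound
    is uniform in xi and N. *)
Lemma far_sum xi rho N : 0 < rho -> 1 <= xi -> rsum (far xi rho) N <= farC rho.
Proof.
move=> Hr Hxi; have ir : 0 < / rho by exact: Rinv_0_lt_compat.
apply: Rle_trans (rsum_le _ _ N (fun k _ => far_step xi rho k Hr Hxi)) _.
rewrite !rsum_plus !rsum_scal.
have s1 n : rsum (fun k => match k with O => 1 | _ => 0 end) n <= 1.
  elim: n => [|[|n] IH]; rewrite /=; [lra | lra |]; rewrite /= in IH; lra.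
have s2 n : rsum (fun k => plow xi rho (ln (INR (S k))) - plow xi rho (ln (INR k))) n =
   plow xi rho (ln (INR n)) - plow xi rho (ln (INR 0)).
  elim: n => [|n IH]; first by rewrite /=; ring.
  by rewrite /rsum -/rsum IH; ring.
have s3 n : rsum (fun k => plow (- xi) rho (- ln (INR (S k))) - plow (- xi) rho (- ln (INR (S k) + 1))) n =
   plow (- xi) rho (- ln 1) - plow (- xi) rho (- ln (INR (S n))).
  elim: n => [|n IH]; first by rewrite /=; ring.
  by rewrite /rsum -/rsum IH (S_INR (S n)); ring.
rewrite s2 s3.
have := s1 N; have := plow_le xi rho (ln (INR N)) Hr; have := plow_le xi rho (ln (INR 0)) Hr.
have := plow_le (- xi) rho (- ln 1) Hr; have := plow_le (- xi) rho (- ln (INR (S N))) Hr.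
rewrite /farC; nra.
Qed.

(** * The Tauberian theorem *)

Lemma Rabs_le1_mult x y : Rabs x <= 1 -> Rabs (x * y) <= Rabs y.
Proof. move=> H; rewrite Rabs_mult; have := Rabs_pos x; have := Rabs_pos y; nra. Qed.

Section Tauberian.
Variable s : nat -> R.
Variable M : R.
Hypothesis s_le : forall k, Rabs (s (S k)) <= M.
Hypothesis HUC : forall T, 0 <= T -> exists2 d, 0 < d <= 1 & UC (near_line d T) (dser s pw).

Lemma M_ge0 : 0 <= M.
Proof. exact: Rle_trans (Rabs_pos _) (s_le 0). Qed.

Definition fsum (T xi sg : R) (N : nat) : R :=
  rsum (fun k => s (S k) * exp (- sg * ln (INR (S k))) * fejer T (xi - ln (INR (S k)))) N.

(** The real part of e^(i t xi) A(t). *)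
Definition ftrig (xi : R) (A : R -> C) (t : R) : R := cos (t * xi) * Re (A t) - sin (t * xi) * Im (A t).

Lemma fejer_id T xi sg N :
  is_RInt (fun t => (1 - t / T) * ftrig xi (fun t => csum (dterm s pw (sg, t)) N) t) 0 T (fsum T xi sg N).
Proof.
rewrite /fsum /ftrig; elim: N => [|N IH].
  apply: (is_RInt_ext (fun _ => 0)).
    by move=> x _; rewrite /Re /Im /=; ring.
  have -> : rsum (fun k => s (S k) * exp (- sg * ln (INR (S k))) * fejer T (xi - ln (INR (S k)))) 0 = scal (T - 0) 0.
    by rewrite /scal /= /mult /=; ring.
  exact: (is_RInt_const (V := R_NormedModule)).
set n := INR (S N); set c := s (S N) * exp (- sg * ln n).
have h := is_RInt_plus (V := R_NormedModule) _ _ _ _ _ _ IH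
  (is_RInt_scal (V := R_NormedModule) _ _ _ c _ (is_RInt_fejer T (xi - ln n))).
apply: (is_RInt_ext _ _ _ _ _ _ h) => t _.
set X := csum (dterm s pw (sg, t)) N.
change ((1 - t / T) * (cos (t * xi) * Re X - sin (t * xi) * Im X) + c * ((1 - t / T) * cos (t * (xi - ln n))) =
  (1 - t / T) * (cos (t * xi) * Re (X + s (S N) * pw n (sg, t))%C - sin (t * xi) * Im (X + s (S N) * pw n (sg, t))%C)).
have -> : t * (xi - ln n) = t * xi - t * ln n by ring.
rewrite /c; clearbody n X; rewrite cos_minus /pw /Re /Im /=; ring.
Qed.

Lemma scoef_cv sg t : 1 < sg -> clim (csum (dterm s pw (sg, t))) (dser s pw (sg, t)).
Proof.
move=> Hs; apply: (cser_correct _ (fun k => M * exp (- sg * ln (INR (S k))))).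
  move=> k; rewrite /dterm Cmod_mult Cmod_R Cmod_pw; apply: Rmult_le_compat_r; last exact: s_le.
  by apply: Rlt_le; exact: exp_pos.
by apply: summable_scal; [exact: M_ge0 | exact: summable_pow].
Qed.

(** Uniform in t, since the majorant sees only |n^-s| = n^-sg. *)
Lemma scoef_tail sg e : 1 < sg -> 0 < e -> exists N0, forall N, (N0 <= N)%nat ->
  forall t, Cmod (csum (dterm s pw (sg, t)) N - dser s pw (sg, t))%C <= e.
Proof.
move=> Hs He; set m := fun k => M * exp (- sg * ln (INR (S k))).
have sm : summable m by apply: summable_scal; [exact: M_ge0 | exact: summable_pow].
have [N0 HN0] := summable_cauchy _ sm e He.
exists N0 => N HN t; apply: (clim_csum_tail _ _ m _ _ (scoef_cv sg t Hs)).
  move=> k; rewrite /dterm Cmod_mult Cmod_R Cmod_pw; apply: Rmult_le_compat_r; last exact: s_le.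
  by apply: Rlt_le; exact: exp_pos.
move=> p; have h := HN0 (N - N0 + p)%nat; rewrite rsum_add in h.
have h0 : 0 <= rsum (fun k => m (N0 + k)%nat) (N - N0) by apply: rsum_nonneg => k _; exact: (proj1 sm).
rewrite (rsum_ext _ (fun k => m (N0 + (N - N0 + k))%nat)); first lra.
by move=> k _; congr m; lia.
Qed.

Lemma UC_continuous d T sg (f : C -> C) : 1 < sg <= 1 + d -> UC (near_line d (T + 1)) f ->
  forall t, 0 <= t <= T -> contC (fun t => f (sg, t)) t.
Proof.
move=> Hs [_ HU] t Ht.
have main (p : C -> R) : (forall z w, Rabs (p z - p w) <= Cmod (z - w)%C) -> continuous (fun t => p (f (sg, t))) t.
  move=> Hp; apply/continuity_pt_filterlim => eps He; have [dl Hd H] := HU eps He.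
  exists (Rmin dl 1); split; first by apply: Rmin_pos; lra.
  move=> x [_ Hx]; change (Rabs (x - t) < Rmin dl 1) in Hx.
  have hx1 := Rlt_le_trans _ _ _ Hx (Rmin_l _ _); have hx2 := Rlt_le_trans _ _ _ Hx (Rmin_r _ _).
  move/Rabs_lt_between: (hx2) => hx3.
  change (Rabs (p (f (sg, x)) - p (f (sg, t))) < eps).
  apply: Rle_lt_trans (Hp _ _) _; apply: H.
  - split; rewrite /Re /Im /=; first lra. apply/Rabs_le; lra.
  - split; rewrite /Re /Im /=; first lra. apply/Rabs_le; lra.
  - apply: Rle_lt_trans (Cmod_le_re_im _) _; rewrite /Re /Im /=.
    replace (sg + - sg) with 0 by ring; rewrite Rabs_R0; rewrite /Rminus in hx1; lra.
split; apply: main => z w; [exact: (re_le_Cmod (z - w)%C) | exact: (im_le_Cmod (z - w)%C)].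
Qed.

(** Riemann-Lebesgue on the vertical lines Re s = sg, uniformly in sg, for the bound and the modulus
    of continuity on [near_line] do not depend on sg. Hence no integral over the boundary line
    itself occurs; only the cut-off N0 varies with sg and xi. *)
Lemma fejer_bound T eta : 0 < T -> 0 < eta -> exists2 d, 0 < d <= 1 & exists Xi, forall xi sg,
  Xi <= xi -> 1 < sg <= 1 + d -> exists N0, forall N, (N0 <= N)%nat -> Rabs (fsum T xi sg N) <= eta.
Proof.
move=> HT He; have [d Hd HU] := HUC (T + 1) ltac:(lra); exists d => //.
have [B B0 HB] := UC_bound _ _ HU.
have e1p : 0 < eta / (8 * T) by apply: Rdiv_lt_0_compat; lra.
have [dl Hdl Hmod] := proj2 HU _ e1p.
(* A half period h = pi/xi below h0 makes each of the two integrals at most eta/8 + 2 B h <= eta/4;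
   the truncation at N costs another eta/4. *)
set h0 := Rmin T (Rmin (dl / 2) (eta / (24 * B))).
have h0p : 0 < h0.
  by apply: Rmin_pos => //; apply: Rmin_pos; [lra | apply: Rdiv_lt_0_compat; lra].
exists (PI / h0) => xi sg Hxi Hsg.
have xip : 0 < xi by apply: Rlt_le_trans Hxi; apply: Rdiv_lt_0_compat => //; exact: PI_RGT_0.
set h := PI / xi.
have hp : 0 < h by apply: Rdiv_lt_0_compat => //; exact: PI_RGT_0.
have hh0 : h <= h0.
  apply/Rle_div_l => //; rewrite Rmult_comm; apply/Rle_div_l => //.
have hT : h <= T by apply: Rle_trans hh0 (Rmin_l _ _).
have hdl : h < dl by have := Rmin_r T (Rmin (dl / 2) (eta / (24 * B)));
  have := Rmin_l (dl / 2) (eta / (24 * B)); rewrite -/h0; lra.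
have hB : B * h <= eta / 24.
  have h1 : h <= eta / (24 * B) by have := Rmin_r T (Rmin (dl / 2) (eta / (24 * B)));
    have := Rmin_r (dl / 2) (eta / (24 * B)); rewrite -/h0; lra.
  have -> : eta / 24 = B * (eta / (24 * B)) by field; lra.
  by apply: Rmult_le_compat_l; lra.
set A := fun t => dser s pw (sg, t).
have inreg t : 0 <= t <= T -> near_line d (T + 1) (sg, t).
  by move=> Ht; split; rewrite /Re /Im /=; [lra | rewrite Rabs_pos_eq; lra].
have cA := UC_continuous d T sg _ Hsg HU.
have RL (p : C -> R) (c : R -> R) : (forall z w, Rabs (p z - p w) <= Cmod (z - w)%C) ->
   (forall z, Rabs (p z) <= Cmod z) ->
   (forall t, 0 <= t <= T -> continuous (fun t => p (A t)) t) ->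
   (forall t, continuous c t) -> (forall t, c (t + h) = - c t) -> (forall t, Rabs (c t) <= 1) ->
   Rabs (RInt (fun t => (1 - t / T) * p (A t) * c t) 0 T) <= eta / 4.
  move=> Hp Hp0 Hc c1 c2 c3.
  have ph t : 0 <= t <= T -> 0 <= 1 - t / T <= 1.
    move=> Ht; have : 0 <= t / T <= 1; last lra.
    by split; [apply: Rdiv_le_0_compat; lra | apply/Rle_div_l; lra].
  apply: Rle_trans (riemann_lebesgue _ c T h B (eta / (8 * T) + B * h / T) (conj hp hT) _ c1 c2 c3 _ _) _.
  - move=> t Ht; apply: (continuous_mult (K := R_AbsRing)); last exact: Hc.
    by apply: (ex_derive_continuous (V := R_NormedModule)); auto_derive.
  - move=> t Ht; apply: Rle_trans (Rabs_le1_mult _ _ _) _; first by apply/Rabs_le; have := ph t Ht; lra.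
    by apply: Rle_trans (Hp0 _) _; apply: HB; exact: inreg.
  - move=> t Ht; have ht1 : 0 <= t <= T by lra. have ht2 : 0 <= t + h <= T by lra.
    have -> : (1 - t / T) * p (A t) - (1 - (t + h) / T) * p (A (t + h)) =
       (1 - t / T) * (p (A t) - p (A (t + h))) + h / T * p (A (t + h)) by field; lra.
    apply: Rle_trans (Rabs_triang _ _) _; apply: Rplus_le_compat.
      apply: Rle_trans (Rabs_le1_mult _ _ _) _; first by apply/Rabs_le; have := ph t ht1; lra.
      apply: Rle_trans (Hp _ _) _; apply: Rlt_le; apply: Hmod; [exact: inreg | exact: inreg |].
      apply: Rle_lt_trans (Cmod_le_re_im _) _; rewrite /Re /Im /=.
      replace (sg + - sg) with 0 by ring; replace (t + - (t + h)) with (- h) by ring.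
      by rewrite Rabs_R0 Rabs_Ropp Rabs_pos_eq; lra.
    have hTp : 0 < h / T by apply: Rdiv_lt_0_compat; lra.
    rewrite Rabs_mult (Rabs_pos_eq (h / T)); last lra.
    replace (B * h / T) with (h / T * B) by (field; lra).
    apply: Rmult_le_compat_l; first lra.
    by apply: Rle_trans (Hp0 _) _; apply: HB; exact: inreg.
  have -> : (eta / (8 * T) + B * h / T) * T = eta / 8 + B * h by field; lra.
  lra.
have shift : (forall t, (t + h) * xi = t * xi + PI) by move=> t; rewrite /h; field; lra.
have b1 : Rabs (RInt (fun t => (1 - t / T) * Re (A t) * cos (t * xi)) 0 T) <= eta / 4.
  apply: RL => //.
  - by move=> z w; exact: (re_le_Cmod (z - w)%C).
  - exact: re_le_Cmod.
  - by move=> t Ht; exact: (proj1 (cA t Ht)).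
  - by move=> t; apply: (ex_derive_continuous (V := R_NormedModule)); auto_derive.
  - by move=> t; rewrite shift neg_cos.
  - by move=> t; apply/Rabs_le; have := COS_bound (t * xi); lra.
have b2 : Rabs (RInt (fun t => (1 - t / T) * Im (A t) * sin (t * xi)) 0 T) <= eta / 4.
  apply: RL => //.
  - by move=> z w; exact: (im_le_Cmod (z - w)%C).
  - exact: im_le_Cmod.
  - by move=> t Ht; exact: (proj2 (cA t Ht)).
  - by move=> t; apply: (ex_derive_continuous (V := R_NormedModule)); auto_derive.
  - by move=> t; rewrite shift neg_sin.
  - by move=> t; apply/Rabs_le; have := SIN_bound (t * xi); lra.
have [N0 HN0] := scoef_tail sg (eta / (8 * T)) (proj1 Hsg) e1p.
exists N0 => N HN.
have cont1 t : 0 <= t <= T -> continuous (fun t => (1 - t / T) * Re (A t) * cos (t * xi)) t.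
  move=> Ht; apply: (continuous_mult (K := R_AbsRing)); last first.
    by apply: (ex_derive_continuous (V := R_NormedModule)); auto_derive.
  apply: (continuous_mult (K := R_AbsRing)); last exact: (proj1 (cA t Ht)).
  by apply: (ex_derive_continuous (V := R_NormedModule)); auto_derive.
have cont2 t : 0 <= t <= T -> continuous (fun t => (1 - t / T) * Im (A t) * sin (t * xi)) t.
  move=> Ht; apply: (continuous_mult (K := R_AbsRing)); last first.
    by apply: (ex_derive_continuous (V := R_NormedModule)); auto_derive.
  apply: (continuous_mult (K := R_AbsRing)); last exact: (proj2 (cA t Ht)).
  by apply: (ex_derive_continuous (V := R_NormedModule)); auto_derive.
have ex1 := ex_RInt_cont _ 0 T (Rlt_le _ _ HT) cont1.
have ex2 := ex_RInt_cont _ 0 T (Rlt_le _ _ HT) cont2.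
have i12 := is_RInt_minus (V := R_NormedModule) _ _ _ _ _ _
  (RInt_correct (V := R_CompleteNormedModule) _ _ _ ex1) (RInt_correct (V := R_CompleteNormedModule) _ _ _ ex2).
have i3 := is_RInt_minus (V := R_NormedModule) _ _ _ _ _ _ (fejer_id T xi sg N) i12.
set D := minus (fsum T xi sg N) _ in i3.
have bD : Rabs D <= (T - 0) * (2 * (eta / (8 * T))).
  rewrite -(is_RInt_unique _ _ _ _ i3); apply: abs_RInt_le_const; first lra.
    by eexists; exact: i3.
  move=> t Ht; rewrite /minus /plus /opp /= /ftrig -/(A t).
  have h1 := HN0 N HN t; rewrite -/(A t) in h1.
  set P := csum _ N in h1 |- *.
  have -> : (1 - t / T) * (cos (t * xi) * Re P - sin (t * xi) * Im P) +
     - ((1 - t / T) * Re (A t) * cos (t * xi) + - ((1 - t / T) * Im (A t) * sin (t * xi))) =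
     (1 - t / T) * (cos (t * xi) * (Re P - Re (A t)) + - (sin (t * xi) * (Im P - Im (A t)))) by ring.
  apply: Rle_trans (Rabs_le1_mult _ _ _) _.
    have : 0 <= t / T <= 1 by split; [apply: Rdiv_le_0_compat; lra | apply/Rle_div_l; lra].
    by move=> h2; apply/Rabs_le; lra.
  apply: Rle_trans (Rabs_triang _ _) _; rewrite Rabs_Ropp.
  have t1 : Rabs (cos (t * xi) * (Re P - Re (A t))) <= Cmod (P - A t)%C.
    apply: Rle_trans (Rabs_le1_mult _ _ _) (re_le_Cmod (P - A t)%C).
    by apply/Rabs_le; have := COS_bound (t * xi); lra.
  have t2 : Rabs (sin (t * xi) * (Im P - Im (A t))) <= Cmod (P - A t)%C.
    apply: Rle_trans (Rabs_le1_mult _ _ _) (im_le_Cmod (P - A t)%C).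
    by apply/Rabs_le; have := SIN_bound (t * xi); lra.
  lra.
have E : (T - 0) * (2 * (eta / (8 * T))) = eta / 4 by field; lra.
rewrite E in bD; move: bD; rewrite /D /minus /plus /opp /=.
move/Rabs_le_between: b1; move/Rabs_le_between: b2.
set I1 := RInt _ 0 T; set I2 := RInt _ 0 T => b2 b1 /Rabs_le_between bD.
apply/Rabs_le; lra.
Qed.

(* A positive (or negative) s on a whole window around xi would force the Fejer
   sum to be at least of order eps, against fejer_bound. *)
Lemma no_window eps rho : 0 < eps -> 0 < rho -> exists Xi, forall xi tau, Xi <= xi ->
  (tau = 1 \/ tau = - (1)) -> ~ (forall k, Rabs (ln (INR (S k)) - xi) <= rho -> eps / 2 <= tau * s (S k)).
Proof.
move=> He Hr; have M0 := M_ge0.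
have ir : 0 < / rho by exact: Rinv_0_lt_compat.
set F := farC rho; have F0 : 0 < F by rewrite /F /farC; nra.
(* The summand 1/rho puts the peak, of radius 1/T, inside the window; the last one brings the far
   contribution down to eps/64. *)
set T := 1 + / rho + 128 * M * F / eps.
have T0 : 0 <= 128 * M * F / eps by apply: Rdiv_le_0_compat => //; apply: Rmult_le_pos; lra.
have HT : 1 <= T by rewrite /T; lra.
have iT : 0 < / T <= 1 by split; [apply: Rinv_0_lt_compat; lra | rewrite -Rinv_1; apply: Rinv_le_contravar; lra].
have iTr : / T <= rho.
  by rewrite -(Rinv_inv rho); apply: Rinv_le_contravar => //; rewrite /T; lra.
have HMF : 2 * M / T * F <= eps / 64.
  have -> : 2 * M / T * F = (2 * M * F) / T by field; lra.
  apply/Rle_div_l; first lra.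
  have : 128 * M * F / eps * (eps / 64) <= T * (eps / 64) by apply: Rmult_le_compat_r; rewrite /T; lra.
  have -> : 128 * M * F / eps * (eps / 64) = 2 * M * F by field; lra.
  lra.
have [d Hd [Xi0 HXi]] := fejer_bound T (eps / 64) ltac:(lra) ltac:(lra).
exists (Rmax (Rmax Xi0 1) (ln (/ (/ T) + 1))) => xi tau Hxi Htau Hwin.
have x0 : Xi0 <= xi by apply: Rle_trans Hxi; apply: Rle_trans (Rmax_l _ _); exact: Rmax_l.
have x1 : 1 <= xi by apply: Rle_trans Hxi; apply: Rle_trans (Rmax_l _ _); exact: Rmax_r.
have x2 : ln (/ (/ T) + 1) <= xi by apply: Rle_trans Hxi; exact: Rmax_r.
(* Keeps n^-sg at least 3/4 of 1/n as long as ln n <= xi + 1. *)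
set del := Rmin d (/ (4 * (xi + 1))).
have delp : 0 < del by apply: Rmin_pos; [lra | apply: Rinv_0_lt_compat; lra].
have deld : del <= d by exact: Rmin_l.
have delx : del * (xi + 1) <= 1 / 4.
  have : del <= / (4 * (xi + 1)) by exact: Rmin_r.
  have -> : / (4 * (xi + 1)) = 1 / 4 / (xi + 1) by field; lra.
  by move=> h; apply/Rle_div_r; lra.
set sg := 1 + del.
have [N0 HN0] := HXi xi sg x0 ltac:(rewrite /sg; lra).
have [N1 HN1] := INR_unbounded (exp (xi + / T)).
set N := (N0 + N1)%nat.
have hN := HN0 N ltac:(rewrite /N; lia).
have hlnN : xi + / T <= ln (INR (S N)).
  rewrite -(ln_exp (xi + / T)); apply: Rlt_le; apply: ln_increasing; first exact: exp_pos.
  by apply: HN1; rewrite /N; lia.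
have cs := clamp_sum xi (/ T) N ltac:(lra) (proj1 iT) hlnN.
have fs := far_sum xi rho N Hr x1.
have Htau1 : Rabs tau = 1 by case: Htau => ->; rewrite ?Rabs_Ropp Rabs_R1.
have eT : 0 < eps * T by apply: Rmult_lt_0_compat; lra.
(* Within 1/T of xi the summand is at least eps/2 * 3/(4n) * T/4, more than eps T/(16 n), and
   [clamp] grows by at most 1/n. In the rest of the window the summand is nonnegative and [clamp]
   does not grow; outside, [far] absorbs it. *)
have term k : eps * T / 16 * (clamp xi (xi + / T) (ln (INR (S k) + 1)) - clamp xi (xi + / T) (ln (INR (S k)))) +
    - (2 * M / T) * far xi rho k <=
    tau * (s (S k) * exp (- sg * ln (INR (S k))) * fejer T (xi - ln (INR (S k)))).
  have hn := INR_S_ge1 k; set n := INR (S k) in hn |- *.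
  have [c1 c2] := clamp_step xi (/ T) n (proj1 iT) hn x2.
  set Dl := _ - _ in c1 c2 |- *.
  have ep := exp_pos (- sg * ln n).
  have in0 : 0 < / n by apply: Rinv_0_lt_compat; lra.
  have ln0 := ln_ge0 n hn.
  have kg := fejer_ge0 T (xi - ln n) ltac:(lra).
  have eu : exp (- sg * ln n) <= / n.
    have -> : / n = exp (- ln n) by rewrite exp_Ropp exp_ln //; lra.
    by apply: exp_le; rewrite /sg; nra.
  rewrite /far -/n; case: Rle_dec => Hc.
    have hw := Hwin k Hc; rewrite Rmult_0_r Rplus_0_r.
    replace (tau * (s (S k) * exp (- sg * ln n) * fejer T (xi - ln n))) with
      ((tau * s (S k)) * (exp (- sg * ln n) * fejer T (xi - ln n))) by ring.
    have pk : 0 <= exp (- sg * ln n) * fejer T (xi - ln n) by apply: Rmult_le_pos; lra.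
    apply: (Rle_trans _ (eps / 2 * (exp (- sg * ln n) * fejer T (xi - ln n)))); last exact: Rmult_le_compat_r.
    case: (Rle_dec (Rabs (ln n - xi)) (/ T)) => Hc2.
      have kn : T / 4 <= fejer T (xi - ln n).
        by apply: fejer_near; [lra | rewrite Rabs_minus_sym].
      have lnx : ln n <= xi + 1 by move/Rabs_le_between: Hc2; lra.
      have el : / n * (3 / 4) <= exp (- sg * ln n).
        have -> : - sg * ln n = - ln n + - (del * ln n) by rewrite /sg; ring.
        rewrite exp_plus exp_Ropp exp_ln; last lra.
        apply: Rmult_le_compat_l; first lra.
        have h1 := exp_ineq1_le (- (del * ln n)).
        have h2 : del * ln n <= del * (xi + 1) by apply: Rmult_le_compat_l; lra.
        lra.
      have h3 : / n * (3 / 4) * (T / 4) <= exp (- sg * ln n) * fejer T (xi - ln n).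
        by apply: Rmult_le_compat; lra.
      have h4 : Dl * (eps * T) <= / n * (eps * T) by apply: Rmult_le_compat_r; nra.
      have h5 : eps * (/ n * (3 / 4) * (T / 4)) <= eps * (exp (- sg * ln n) * fejer T (xi - ln n)).
        by apply: Rmult_le_compat_l; lra.
      have h6 : 0 <= / n * (eps * T) by apply: Rmult_le_pos; nra.
      lra.
    have := c2 ltac:(lra) => hD.
    have h1 := Rmult_le_compat_l (eps * T / 16) Dl 0 ltac:(lra) hD; rewrite Rmult_0_r in h1.
    have h2 : 0 <= eps / 2 * (exp (- sg * ln n) * fejer T (xi - ln n)) by apply: Rmult_le_pos; lra.
    lra.
  have hD := c2 ltac:(lra).
  have h1 := Rmult_le_compat_l (eps * T / 16) Dl 0 ltac:(lra) hD; rewrite Rmult_0_r in h1.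
  have un0 : xi - ln n <> 0.
    by move=> E; apply: Hc; replace (ln n - xi) with (- (xi - ln n)) by ring; rewrite E Ropp_0 Rabs_R0; lra.
  have [_ k2] := fejer_le T (xi - ln n) ltac:(lra) un0.
  set V := / ((xi - ln n) * (xi - ln n)) in k2 |- *.
  have h2 : Rabs (tau * (s (S k) * exp (- sg * ln n) * fejer T (xi - ln n))) <= 2 * M / T * (/ n * V).
    rewrite Rabs_mult Htau1 Rmult_1_l !Rabs_mult (Rabs_pos_eq (exp _)) ?(Rabs_pos_eq (fejer _ _)) //; last lra.
    have -> : 2 * M / T * (/ n * V) = M * / n * (2 / T * V) by rewrite /Rdiv; ring.
    apply: Rmult_le_compat => //.
      by apply: Rmult_le_pos; [exact: Rabs_pos | lra].
    by apply: Rmult_le_compat; [exact: Rabs_pos | lra | exact: s_le | lra].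
  move/Rabs_le_between: h2; lra.
have tot := rsum_le _ _ N (fun k _ => term k).
rewrite rsum_plus !rsum_scal cs -/(fsum T xi sg N) in tot.
have E : eps * T / 16 * / T = eps / 16 by field; lra.
rewrite E in tot.
(* Altogether eps/16 - eps/64 <= tau * fsum <= eps/64, which is absurd. *)
have h1 : tau * fsum T xi sg N <= eps / 64.
  apply: Rle_trans (Rle_abs _) _; rewrite Rabs_mult Htau1; lra.
have h2 : 2 * M / T * rsum (far xi rho) N <= 2 * M / T * F.
  by apply: Rmult_le_compat_l fs; apply: Rdiv_le_0_compat; lra.
lra.
Qed.

(** Slow decrease in multiplied form. For the averages S(n)/n it reads S(n) - S(m) >= -(n - m), true
    because each coefficient is at least -1. *)
Hypothesis slow : forall m n, (1 <= m <= n)%nat ->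
  - (INR n - INR m) <= INR n * s n - INR m * s m.

Lemma exp_small x : 0 <= x <= 1 / 2 -> exp x <= 1 + 2 * x.
Proof.
move=> H; have h := exp_ineq1_le (- x); have p := exp_pos x.
have e : exp x * exp (- x) = 1 by rewrite -exp_plus -exp_0; congr exp; ring.
have : exp x * (1 - x) <= 1 by nra.
nra.
Qed.

(** If s(n) >= eps, slow decrease keeps s >= eps/2 on a window to the right of ln n; if s(n) <=
    -eps, it keeps s <= -eps/2 on one to the left. [no_window] excludes both far out. *)
Theorem tauberian : forall eps, 0 < eps -> exists N, forall n, (N <= n)%nat -> Rabs (s n) < eps.
Proof.
have main eps : 0 < eps <= 1 -> exists N, forall n, (N <= n)%nat -> Rabs (s n) < eps.
  (* The window has length 2 rho = eps/8, so m/n stays within eps/4 of 1; eps <= 1 serves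
     [exp_small]. *)
  move=> He; set rho := eps / 16.
  have [Xi HXi] := no_window eps rho (proj1 He) ltac:(rewrite /rho; lra).
  have [N0 HN0] := INR_unbounded (exp (Xi + rho)).
  have rho0 : 0 < rho by rewrite /rho; lra.
  exists (S N0) => n Hn; case: n Hn => [|j] Hj; first lia.
  set n := INR (S j); have hn : 1 <= n by exact: INR_S_ge1.
  have hl : Xi + rho <= ln n.
    rewrite -(ln_exp (Xi + rho)); apply: Rlt_le; apply: ln_increasing; first exact: exp_pos.
    by apply: HN0; lia.
  apply: Rnot_le_lt => Habs.
  have [hs|hs] : eps <= s (S j) \/ s (S j) <= - eps.
    by move: Habs; rewrite /Rabs; case: Rcase_abs => ?; lra.
  - apply: (HXi (ln n + rho) 1 ltac:(lra) (or_introl eq_refl)) => k.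
    have hm := INR_S_ge1 k; set m := INR (S k) in hm |- *; move=> /Rabs_le_between Hk.
    have h1 : ln n <= ln m by lra.
    have h2 : n <= m by apply: Rnot_lt_le => h; have := ln_increasing m n ltac:(lra) h; lra.
    have h3 : m <= n * (1 + eps / 4).
      have -> : m = exp (ln m) by rewrite exp_ln //; lra.
      apply: (Rle_trans _ (exp (ln n + eps / 8))); first by apply: exp_le; rewrite /rho in Hk; lra.
      rewrite exp_plus exp_ln; last lra.
      by apply: Rmult_le_compat_l; [lra | have := exp_small (eps / 8); lra].
    have hjk : (S j <= S k)%nat by apply: INR_le.
    have := slow (S j) (S k) ltac:(lia); rewrite -/n -/m => hsl.
    rewrite Rmult_1_l; apply: (Rmult_le_reg_l m); first lra.
    have : n * eps <= n * s (S j) by apply: Rmult_le_compat_l; lra.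
    nra.
  - apply: (HXi (ln n - rho) (- (1)) ltac:(lra) (or_intror eq_refl)) => k.
    have hm := INR_S_ge1 k; set m := INR (S k) in hm |- *; move=> /Rabs_le_between Hk.
    have h1 : ln m <= ln n by lra.
    have h2 : m <= n by apply: Rnot_lt_le => h; have := ln_increasing n m ltac:(lra) h; lra.
    have h3 : n * (1 - eps / 4) <= m.
      have -> : m = exp (ln m) by rewrite exp_ln //; lra.
      apply: (Rle_trans _ (exp (ln n + - (eps / 8)))); last by apply: exp_le; rewrite /rho in Hk; lra.
      rewrite exp_plus exp_ln; last lra.
      by apply: Rmult_le_compat_l; [lra | have := exp_ineq1_le (- (eps / 8)); lra].
    have hjk : (S k <= S j)%nat by apply: INR_le.
    have := slow (S k) (S j) ltac:(lia); rewrite -/n -/m => hsl.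
    apply: (Rmult_le_reg_l m); first lra.
    have : n * s (S j) <= n * - eps by apply: Rmult_le_compat_l; lra.
    nra.
move=> eps He; have [N HN] := main (Rmin eps 1) ltac:(split; [apply: Rmin_pos; lra | exact: Rmin_r]).
by exists N => n Hn; apply: Rlt_le_trans (HN n Hn) (Rmin_l _ _).
Qed.

End Tauberian.

End Analytic.

From mathcomp Require Import all_boot zify.

Module PrimeCount.

Import Analytic.
Open Scope R_scope.

(** * The von Mangoldt function *)

Lemma rsum_swap (a : nat -> nat -> R) N M :
  rsum (fun i => rsum (fun j => a i j) M) N = rsum (fun j => rsum (fun i => a i j) N) M.
Proof.
elim: N => /= [|N ->]; first by elim: M => //= M <-; ring.
by rewrite -rsum_plus.
Qed.

Lemma rsum_0 n : rsum (fun _ => 0) n = 0.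
Proof. by elim: n => //= n ->; ring. Qed.

Lemma rsum_zero_ext a m n : (m <= n)%N -> (forall k, (m <= k < n)%N -> a k = 0) -> rsum a n = rsum a m.
Proof.
move=> /leP Hmn H; replace n with (m + (n - m))%coq_nat by lia; rewrite rsum_add.
rewrite (rsum_ext (fun k => a (m + k)%coq_nat) (fun _ => 0)); last by move=> k Hk; apply: H; lia.
rewrite rsum_0; ring.
Qed.

Lemma rsum_single e x n : rsum (fun d => if d == e then x else 0) n = if (e < n)%N then x else 0.
Proof.
elim: n => [|n IH] //=; rewrite IH.
have -> : (e < n.+1)%N = (e == n) || (e < n)%N by rewrite ltnS leq_eqVlt.
by rewrite (eq_sym n e); case: (ltngtP e n) => _ /=; ring.
Qed.

Lemma rsum_ltn m x n : rsum (fun j => if (j < m)%N then x else 0) n = INR (minn m n) * x.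
Proof.
elim: n => [|n IH]; first by rewrite minn0 /=; ring.
rewrite /rsum -/rsum IH; case H : (n < m)%N; last move/negbT: H => H; rewrite -?leqNgt in H.
  have -> : minn m n.+1 = n.+1 by apply/minn_idPr.
  have -> : minn m n = n by apply/minn_idPr; exact: ltnW.
  by rewrite S_INR; ring.
have -> : minn m n.+1 = m by apply/minn_idPl; exact: leqW.
have -> : minn m n = m by apply/minn_idPl.
ring.
Qed.

Lemma dvE d n : (0 < d)%N -> divb d n = (d %| n).
Proof.
move=> Hd; apply/idP/idP.
  move=> /Nat.eqb_eq /Nat.Div0.mod_divides [c ->]; exact: dvdn_mulr.
by move=> /dvdnP [k ->]; apply/Nat.eqb_eq; rewrite -multE Nat.Div0.mod_mul.
Qed.

Lemma INR_expn p k : INR (p ^ k) = INR p ^ k.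
Proof. by elim: k => [|k IH] //; rewrite expnS -multE mult_INR IH. Qed.

Lemma ln_expn p k : (0 < p)%N -> ln (INR (p ^ k)) = INR k * ln (INR p).
Proof.
move=> /ltP Hp; rewrite INR_expn; elim: k => [|k IH]; first by rewrite /= ln_1; ring.
have hp : 0 < INR p by apply: lt_0_INR.
by rewrite S_INR /= ln_mult ?IH //; [ring | exact: pow_lt].
Qed.

Lemma ln_INR_ge0 n : 0 <= ln (INR n).
Proof. case: n => [|n]; first by rewrite /= ln_0; lra. exact: ln_ge0 (INR_S_ge1 n). Qed.

(** The contribution of the prime power p^(j+1) to the von Mangoldt function at d. *)
Definition pj (p j d : nat) : R := if prime p && (p ^ j.+1 == d)%N then ln (INR p) else 0.

(* LamB uses ranges up to a common bound B, which lets double sums be exchanged. *)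
Definition LamB (B d : nat) : R := rsum (fun p => rsum (fun j => pj p j d) B) B.+1.
Definition Lam (d : nat) : R := LamB d d.

Lemma pj_ge0 p j d : 0 <= pj p j d.
Proof. rewrite /pj; case: ifP => _; [exact: ln_INR_ge0 | lra]. Qed.

Lemma pj_zero p j d : (d < p)%N || (d <= j)%N -> pj p j d = 0.
Proof.
move=> H; rewrite /pj; case: ifP => // /andP [Hp /eqP E]; exfalso.
have p1 := prime_gt1 Hp.
have h1 : (p <= d)%N by rewrite -E -{1}(expn1 p) leq_exp2l.
have h2 : (j < d)%N by rewrite -E; apply: leq_trans (ltn_expl _ p1) _; rewrite leq_exp2l.
by case/orP: H; rewrite ltnNge ?h1 // -ltnNge ltnNge h2 || rewrite leqNgt h2.
Qed.

Lemma LamB_eq B d : (d <= B)%N -> LamB B d = Lam d.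
Proof.
move=> H; rewrite /Lam /LamB (rsum_zero_ext _ d.+1 B.+1) //.
  apply: rsum_ext => p _; apply: rsum_zero_ext => // j /andP [Hj _].
  by apply: pj_zero; rewrite Hj orbT.
move=> p /andP [Hp _]; rewrite (rsum_ext _ (fun _ => 0)) ?rsum_0 // => j _.
by apply: pj_zero; rewrite Hp.
Qed.

Lemma Lam_ge0 d : 0 <= Lam d.
Proof. by apply: rsum_nonneg => p _; apply: rsum_nonneg => j _; exact: pj_ge0. Qed.

Lemma ln_prod (F : nat -> nat) m : (forall p, (0 < F p)%N) ->
  ln (INR (\prod_(0 <= p < m) F p)) = rsum (fun p => ln (INR (F p))) m.
Proof.
move=> HF; elim: m => [|m IH]; first by rewrite big_geq // /= ln_1.
rewrite big_nat_recr //= -multE mult_INR ln_mult ?IH //.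
- by apply: lt_0_INR; apply/ltP; apply: prodn_cond_gt0.
- by apply: lt_0_INR; apply/ltP.
Qed.

Lemma ln_primes n : (0 < n)%N ->
  ln (INR n) = rsum (fun p => if prime p then INR (logn p n) * ln (INR p) else 0) n.+1.
Proof.
move=> Hn; rewrite -{1}(partnT Hn) /partn ln_prod.
  apply: rsum_ext => p _; case: ifP => Hp; first by rewrite ln_expn // prime_gt0.
  by rewrite lognE Hp /= ln_1.
by move=> p; case Hp : (prime p); [rewrite expn_gt0 prime_gt0 | rewrite lognE Hp].
Qed.

(** ln n is the sum of v_p(n) ln p, and v_p(n) counts the j with p^(j+1) dividing n; the sums over d
    and over p, j are exchanged. *)
Lemma Lam_div n : (1 <= n)%coq_nat ->
  rsum (fun d => if divb (S d) n then Lam (S d) else 0) n = ln (INR n).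
Proof.
move=> /leP Hn; rewrite ln_primes //.
transitivity (rsum (fun d => rsum (fun p => rsum (fun j => if divb d.+1 n then pj p j d.+1 else 0) n) n.+1) n).
  apply: rsum_ext => d /ltP Hd; case: (divb _ _); first by rewrite -(LamB_eq n).
  by rewrite (rsum_ext _ (fun _ => 0)) ?rsum_0 // => p _; rewrite rsum_0.
rewrite rsum_swap; apply: rsum_ext => p _; rewrite rsum_swap.
transitivity (rsum (fun j => if (j < logn p n)%N then (if prime p then ln (INR p) else 0) else 0) n); last first.
  rewrite rsum_ltn; case: ifP => Hp; last by ring.
  congr (INR _ * _); apply/minn_idPl; exact: ltnW (ltn_logl p Hn).
apply: rsum_ext => j _; rewrite /pj; case Hp : (prime p) => /=; last first.
  rewrite (rsum_ext _ (fun _ => 0)) ?rsum_0; first by case: ifP.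
  by move=> d _; case: (divb _ _).
rewrite -(pfactor_dvdn j.+1 Hp Hn).
transitivity (rsum (fun d => if d == (p ^ j.+1).-1%N then (if (p ^ j.+1 %| n)%N then ln (INR p) else 0) else 0) n).
  apply: rsum_ext => d _; rewrite dvE //.
  have Hpj : (0 < p ^ j.+1)%N by rewrite expn_gt0 prime_gt0.
  have -> : (p ^ j.+1 == d.+1)%N = (d == (p ^ j.+1).-1)%N.
    by rewrite -{1}(prednK Hpj) eqSS eq_sym.
  case: (d =P (p ^ j.+1).-1%N) => [->|_]; last by case: ifP.
  by rewrite prednK.
rewrite rsum_single; case Hd : (p ^ j.+1 %| n)%N; last by case: ifP.
have -> // : ((p ^ j.+1).-1 < n)%N.
by rewrite prednK ?(dvdn_leq Hn Hd) // expn_gt0 prime_gt0.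
Qed.

(** Lam n is the term d = n of the divisor sum, whose other terms are nonnegative. *)
Lemma Lam_le n : (1 <= n)%coq_nat -> Lam n <= ln (INR n).
Proof.
move=> Hn; rewrite -Lam_div //; case: n Hn => [|n] Hn; first by lia.
rewrite /rsum -/rsum.
have -> : divb n.+1 n.+1 = true by rewrite dvE ?dvdnn.
have := rsum_nonneg (fun d => if divb d.+1 n.+1 then Lam d.+1 else 0) n; set X := rsum _ n.
move=> H; have : 0 <= X by apply: H => k _; case: ifP => _; [exact: Lam_ge0 | lra].
lra.
Qed.

(** * Chebyshev's upper bound *)

Definition psi (N : nat) : R := rsum (fun d => Lam (S d)) N.
Definition logfact (N : nat) : R := rsum (fun k => ln (INR (S k))) N.

Lemma rsum_dvd (x : R) d N : (0 < d)%N ->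
  rsum (fun k => if divb d (S k) then x else 0) N = INR (Nat.div N d) * x.
Proof.
move=> /leP Hd; elim: N => [|N IH]; first by rewrite Nat.Div0.div_0_l /=; ring.
rewrite /rsum -/rsum IH; case E : (divb d (S N)).
  by have [_ ->] := div_succ_divb d N Hd E; rewrite S_INR; ring.
by rewrite (div_succ_ndivb d N Hd E); ring.
Qed.

(** Legendre's formula: floor(N/d) of the numbers up to N are multiples of d. *)
Lemma logfact_eq N B : (N <= B)%N -> logfact N = rsum (fun d => INR (Nat.div N (S d)) * Lam (S d)) B.
Proof.
move=> /leP HB; rewrite /logfact.
transitivity (rsum (fun k => rsum (fun d => if divb (S d) (S k) then Lam (S d) else 0) B) N).
  apply: rsum_ext => k Hk; rewrite -(Lam_div_le Lam Lam_div (S k) B) //; lia.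
by rewrite rsum_swap; apply: rsum_ext => d _; rewrite rsum_dvd.
Qed.

(** floor(2N/d) - 2 floor(N/d) is never negative, and it is 1 for N < d <= 2N. *)
Lemma psi_diff N : psi (N + N)%coq_nat - psi N <= logfact (N + N)%coq_nat - 2 * logfact N.
Proof.
rewrite (logfact_eq _ (N + N)) // (logfact_eq N (N + N)) ?leq_addr // /psi !rsum_add.
set A := rsum (fun d => INR (Nat.div (N + N)%coq_nat (S d)) * _) N.
set C := rsum (fun k => INR (Nat.div N (S (N + k)%coq_nat)) * _) N.
set B := rsum (fun k => INR (Nat.div (N + N)%coq_nat (S (N + k)%coq_nat)) * _) N.
set D := rsum (fun d => INR (Nat.div N (S d)) * _) N.
have hC : C = 0.
  rewrite /C (rsum_ext _ (fun _ => 0)) ?rsum_0 // => k _.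
  by rewrite Nat.div_small; [rewrite /=; ring | lia].
have hB : rsum (fun k => Lam (S (N + k)%coq_nat)) N <= B.
  apply: rsum_le => k Hk; have h := Lam_ge0 (S (N + k)%coq_nat).
  have : 1 <= INR (Nat.div (N + N)%coq_nat (S (N + k)%coq_nat)); last nra.
  by apply: (le_INR 1); apply: Nat.div_le_lower_bound; lia.
have hA : 2 * D <= A.
  rewrite /D -rsum_scal; apply: rsum_le => k _; rewrite -Rmult_assoc.
  apply: Rmult_le_compat_r; first exact: Lam_ge0.
  have -> : 2 * INR (Nat.div N (S k)) = INR (2 * Nat.div N (S k))%coq_nat by rewrite mult_INR.
  apply: le_INR; apply: Nat.div_le_lower_bound; first lia.
  have := Nat.Div0.mul_div_le N (S k); lia.
lra.
Qed.

(** The logarithm of the central binomial coefficient; passing from N to N + 1 adds at most 2 ln 2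
    <= 2. *)
Lemma logfact_double N : logfact (N + N)%coq_nat - 2 * logfact N <= 2 * INR N.
Proof.
elim: N => [|N IH]; first by rewrite /logfact /=; lra.
replace (S N + S N)%coq_nat with (S (S (N + N)%coq_nat)) by lia.
have E1 n : logfact (S n) = logfact n + ln (INR (S n)) by [].
rewrite !E1; have hS := S_INR N.
have h : 0 < INR (S N) by have := INR_S_ge1 N; lra.
have h1 : ln (INR (S (N + N)%coq_nat)) <= ln 2 + ln (INR (S N)).
  rewrite -ln_mult //; last lra.
  apply: ln_le; first by have := INR_S_ge1 (N + N)%coq_nat; lra.
  by rewrite !S_INR plus_INR; lra.
have h2 : ln (INR (S (S (N + N)%coq_nat))) = ln 2 + ln (INR (S N)).
  by rewrite -ln_mult //; [congr ln; rewrite !S_INR plus_INR; ring | lra].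
have := ln2_le1; lra.
Qed.

(** Halving: psi(2m) <= psi(m) + 2m, with one more term Lam(2m + 1) <= 2m for odd N; the constant 4
    reproduces itself. *)
Lemma psi_le N : psi N <= 4 * INR N.
Proof.
elim/ltn_ind: N => N IH.
case: (Nat.Even_or_Odd N) => [[m Em]|[m Em]].
  case: m Em => [|m] Em; first by rewrite Em /psi /=; lra.
  have := IH m.+1 ltac:(apply/ltP; lia).
  have := psi_diff m.+1; have := logfact_double m.+1.
  have -> : N = (m.+1 + m.+1)%coq_nat by lia.
  rewrite plus_INR; have := pos_INR m.+1; lra.
have h : psi N = psi (m + m)%coq_nat + Lam N.
  by replace N with (S (m + m)%coq_nat) by lia.
have hl : Lam N <= 2 * INR m.
  apply: Rle_trans (Lam_le N _) _; first lia.
  have -> : INR N = 1 + 2 * INR m by rewrite Em Nat.add_1_r S_INR mult_INR /=; ring.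
  have := ln_le_sub1 (1 + 2 * INR m); have := pos_INR m; lra.
have := psi_diff m; have := logfact_double m.
have -> : INR N = 1 + 2 * INR m by rewrite Em Nat.add_1_r S_INR mult_INR /=; ring.
have : psi m <= 4 * INR m.
  case: m Em h hl => [|m] Em h hl; first by rewrite /psi /=; lra.
  by apply: IH; apply/ltP; lia.
rewrite h; lra.
Qed.

(** 9 = 2 * 4 + 1: the factor 1 + chi is at most 2, [psi_le] gives 4, and the subtracted ones give
    1. *)
Lemma Ssum_bound n : Rabs (Ssum Lam n) <= 9 * INR n.
Proof.
have E : Ssum Lam n = rsum (fun k => Lam (S k) * (1 + chi (S k))) n - INR n.
  rewrite /Ssum; elim: n => [|n IH]; first by rewrite /=; ring.
  by rewrite /rsum -/rsum IH (S_INR n) /fcoef; ring.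
have c k : 0 <= 1 + chi k <= 2 by case: (chi_cases k) => [->|[->|->]]; lra.
have h1 : 0 <= rsum (fun k => Lam (S k) * (1 + chi (S k))) n.
  by apply: rsum_nonneg => k _; apply: Rmult_le_pos; [exact: Lam_ge0 | have := c (S k); lra].
have h2 : rsum (fun k => Lam (S k) * (1 + chi (S k))) n <= 2 * psi n.
  rewrite /psi -rsum_scal; apply: rsum_le => k _.
  by have := Lam_ge0 (S k); have := c (S k); nra.
have := psi_le n; have := pos_INR n; rewrite E => ? ?; apply/Rabs_le; lra.
Qed.

Theorem psi_asymptotic : forall eps, 0 < eps -> exists N, forall n, (N <= n)%coq_nat ->
  Rabs (rsum (fun k => Lam (S k) * (1 + chi (S k))) n - INR n) <= eps * INR n.
Proof.
have E n : Ssum Lam n = rsum (fun k => Lam (S k) * (1 + chi (S k))) n - INR n.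
  rewrite /Ssum; elim: n => [|n IH]; first by rewrite /=; ring.
  by rewrite /rsum -/rsum IH (S_INR n) /fcoef; ring.
have M9 : 0 <= 9 by lra.
have sle := scoef_le Lam 9 Ssum_bound.
have ext := scoef_extension Lam Lam_ge0 Lam_le Lam_div 9 M9 Ssum_bound.
have mul n : INR n * scoef Lam n = Ssum Lam n.
  case: n => [|n]; first by rewrite /Ssum /=; ring.
  by rewrite /scoef; field; have := INR_S_ge1 n; lra.
have slow (m n : nat) : (1 <= m)%coq_nat /\ (m <= n)%coq_nat -> - (INR n - INR m) <= INR n * scoef Lam n - INR m * scoef Lam m.
  move=> [_ Hmn]; rewrite !mul.
  replace n with (m + (n - m))%coq_nat by lia; rewrite /Ssum rsum_add plus_INR.
  set d := (n - m)%N; clearbody d.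
  apply: (Rle_trans _ (rsum (fun k => fcoef Lam (S (m + k)%coq_nat)) d)); last by apply: Req_le; ring.
  apply: (Rle_trans _ (- INR d)); first by apply: Req_le; ring.
  elim: d => [|k IH]; first by rewrite /=; lra.
  rewrite /rsum -/rsum S_INR; suff : - (1) <= fcoef Lam (S (m + k)%coq_nat) by lra.
  rewrite /fcoef; have := Lam_ge0 (S (m + k)%coq_nat).
  have : 0 <= 1 + chi (S (m + k)%coq_nat) by case: (chi_cases (S (m + k)%coq_nat)) => [->|[->|->]]; lra.
  nra.
move=> eps He; have [N HN] := tauberian _ _ sle ext slow eps He.
exists N => n Hn; rewrite -E -mul Rabs_mult Rmult_comm (Rabs_pos_eq (INR n)); last exact: pos_INR.
by apply: Rmult_le_compat_r; [exact: pos_INR | exact: Rlt_le (HN n Hn)].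
Qed.

(** * Primes congruent to 1 modulo 3 *)

Definition pi1 (n : nat) : nat := \sum_(0 <= p < n.+1) (prime p && (p %% 3 == 1)%N).

Lemma INR_pi1 n : INR (pi1 n) = rsum (fun p => if prime p && (p %% 3 == 1)%N then 1 else 0) n.+1.
Proof.
rewrite /pi1; elim: (n.+1) => [|m IH]; first by rewrite big_geq.
by rewrite big_nat_recr //= -plusE plus_INR IH; case: (prime m && _).
Qed.

Definition psiK (N : nat) : R := rsum (fun k => Lam (S k) * (1 + chi (S k))) N.

(** The contribution to [psiK N] of all powers of the prime p up to N. *)
Definition Vp (N p : nat) : R :=
  rsum (fun j => if prime p && (p ^ j.+1 <= N)%N then ln (INR p) * (1 + chi (p ^ j.+1)) else 0) N.

Lemma psiK_eq N : psiK N = rsum (Vp N) N.+1.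
Proof.
rewrite /psiK.
transitivity (rsum (fun d => rsum (fun p => rsum (fun j => pj p j d.+1 * (1 + chi d.+1)) N) N.+1) N).
  apply: rsum_ext => d /ltP Hd; rewrite -(LamB_eq N) // /LamB Rmult_comm -rsum_scal.
  by apply: rsum_ext => p _; rewrite -rsum_scal; apply: rsum_ext => j _; ring.
rewrite rsum_swap; apply: rsum_ext => p _; rewrite rsum_swap; apply: rsum_ext => j _.
rewrite /pj; case Hp : (prime p) => /=; last by rewrite (rsum_ext _ (fun _ => 0)) ?rsum_0 // => d _; ring.
have Hpj : (0 < p ^ j.+1)%N by rewrite expn_gt0 prime_gt0.
transitivity (rsum (fun d => if d == (p ^ j.+1).-1%N then ln (INR p) * (1 + chi (p ^ j.+1)) else 0) N).
  apply: rsum_ext => d _.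
  have -> : (p ^ j.+1 == d.+1)%N = (d == (p ^ j.+1).-1)%N by rewrite -{1}(prednK Hpj) eqSS eq_sym.
  case: (d =P (p ^ j.+1).-1%N) => [->|_]; last by ring.
  by rewrite prednK.
by rewrite rsum_single prednK.
Qed.

Lemma chiE p : chi p = if (p %% 3 == 1)%N then 1 else if (p %% 3 == 2)%N then - (1) else 0.
Proof.
rewrite /chi; have -> : Nat.modulo p 3 = (p %% 3)%N.
  symmetry; apply: (Nat.mod_unique p 3 (p %/ 3)); lia.
by case: (p %% 3)%N => [|[|[|m]]].
Qed.

Lemma chi_ge k : 0 <= 1 + chi k <= 2.
Proof. by case: (chi_cases k) => [->|[->|->]]; lra. Qed.

Lemma rsum_recl a n : rsum a n.+1 = a O + rsum (fun k => a k.+1) n.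
Proof. by rewrite (rsum_add a 1 n) /=; ring. Qed.

Lemma Vp_ge N p : (0 < N)%N -> (p <= N)%N ->
  (if prime p then ln (INR p) * (1 + chi p) else 0) <= Vp N p.
Proof.
move=> HN HpN; rewrite /Vp; case: N HN HpN => [//|N] _ HpN.
rewrite rsum_recl; set X := rsum _ N.
have : 0 <= X.
  apply: rsum_nonneg => j _; case: ifP => _; last lra.
  by apply: Rmult_le_pos; [exact: ln_INR_ge0 | have := chi_ge (p ^ j.+2); lra].
rewrite expn1 HpN; case Hp : (prime p) => /=; lra.
Qed.

(** At most log_p N powers count, each with weight at most 2 ln p. *)
Lemma Vp_le N p : (0 < N)%N -> prime p -> Vp N p <= 2 * ln (INR N).
Proof.
move=> HN Hp; have p1 := prime_gt1 Hp.
apply: (Rle_trans _ (rsum (fun j => if (j < trunc_log p N)%N then 2 * ln (INR p) else 0) N)).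
  apply: rsum_le => j _; rewrite Hp /=; have h := ln_INR_ge0 p; have c := chi_ge (p ^ j.+1).
  case: (boolP (p ^ j.+1 <= N)%N) => Hj; last by case: ifP => _; lra.
  by rewrite (trunc_log_max p1 Hj); nra.
rewrite rsum_ltn.
have h : INR (trunc_log p N) * ln (INR p) <= ln (INR N).
  rewrite -ln_expn ?prime_gt0 //; apply: ln_le.
    by apply: lt_0_INR; apply/ltP; rewrite expn_gt0 prime_gt0.
  by apply: le_INR; apply/leP; exact: trunc_logP.
have h2 : INR (minn (trunc_log p N) N) <= INR (trunc_log p N) by apply: le_INR; apply/leP; exact: geq_minl.
have := ln_INR_ge0 p; nra.
Qed.

Lemma Vp_large N p : (0 < N)%N -> (p <= N)%N -> (N < p * p)%N -> prime p -> Vp N p = ln (INR p) * (1 + chi p).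
Proof.
move=> HN HpN Hpp Hp; rewrite /Vp (rsum_zero_ext _ 1) //.
  by rewrite /rsum Hp expn1 HpN /=; ring.
move=> j /andP [Hj _]; rewrite Hp /=; case: ifP => // H; exfalso.
have : (p * p <= p ^ j.+1)%N by rewrite mulnn leq_exp2l // prime_gt1.
lia.
Qed.

(** Primes up to sqrt N contribute at most 2 ln N each. A larger prime contributes its first power
    only, with weight 1 + chi p: 2 for p = 1 mod 3, 0 for p = 2 mod 3. The 2 in the bracket covers p
    = 3 and the index 0 in the range up to sqrt N. *)
Lemma psiK_le N : (0 < N)%N -> psiK N <= 2 * ln (INR N) * (INR (pi1 N) + INR (Nat.sqrt N) + 2).
Proof.
move=> HN; rewrite psiK_eq INR_pi1; have hN := ln_INR_ge0 N; set l := ln (INR N) in hN |- *.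
apply: (Rle_trans _ (rsum (fun p : nat => 2 * l * (if prime p && (p %% 3 == 1)%N then 1 else 0) +
   ((if (p < (Nat.sqrt N).+1)%N then 2 * l else 0) + (if (p == 3)%N then 2 * l else 0))) N.+1)).
  apply: rsum_le => p /ltP Hp.
  have n1 : 0 <= 2 * l * (if prime p && (p %% 3 == 1)%N then 1 else 0) by case: ifP => _; lra.
  have n2 : 0 <= (if (p < (Nat.sqrt N).+1)%N then 2 * l else 0) by case: ifP => _; lra.
  have n3 : 0 <= (if (p == 3)%N then 2 * l else 0) by case: ifP => _; lra.
  case Hpr : (prime p); last first.
    rewrite Hpr in n1; have -> : Vp N p = 0; last lra.
    by rewrite /Vp Hpr (rsum_ext _ (fun _ => 0)) ?rsum_0.
  case: (leqP (p * p) N) => Hpp.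
    have h := Vp_le N p HN Hpr; rewrite -/l in h.
    have E : (p < (Nat.sqrt N).+1)%N by apply/ltP; have := Nat.sqrt_le_square N p; lia.
    by rewrite E in n2 |- *; rewrite Hpr in n1; lra.
  have hp : ln (INR p) <= l by apply: ln_le; [apply: lt_0_INR; apply/ltP; exact: prime_gt0 | apply: le_INR; lia].
  have hp0 := ln_INR_ge0 p.
  rewrite Vp_large // chiE /=; rewrite Hpr /= in n1.
  case E1 : (p %% 3 == 1)%N; first by rewrite E1 in n1; lra.
  rewrite E1 in n1; case E2 : (p %% 3 == 2)%N; first lra.
  have d3 : (3 %| p)%N by rewrite /dvdn; lia.
  have E3 : (p == 3)%N by move: d3; rewrite dvdn_prime2 // eq_sym.
  by rewrite E3 in n3 |- *; lra.
rewrite !rsum_plus rsum_scal rsum_ltn rsum_single.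
set A := rsum _ _; have h1 : INR (minn (Nat.sqrt N).+1 N.+1) <= INR (Nat.sqrt N).+1.
  by apply: le_INR; apply/leP; exact: geq_minl.
rewrite S_INR in h1; case: ifP => _; nra.
Qed.

(** Only first powers of primes p >= y are kept, for which ln p >= ln y; at most y primes are lost.
    The useful y is close to N^(1 - dl). *)
Lemma psiK_ge N y : (0 < N)%N -> (0 < y)%N -> 2 * ln (INR y) * (INR (pi1 N) - INR y) <= psiK N.
Proof.
move=> HN Hy; rewrite psiK_eq INR_pi1; have hy := ln_INR_ge0 y; set l := ln (INR y) in hy |- *.
have h : rsum (fun p : nat => 2 * l * (if prime p && (p %% 3 == 1)%N then 1 else 0) +
   - (2 * l) * (if (p < y)%N then 1 else 0)) N.+1 <= rsum (Vp N) N.+1.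
  apply: rsum_le => p /ltP Hp; apply: Rle_trans (Vp_ge N p HN _); last lia.
  case Hpr : (prime p) => /=; last by case: ifP => _; lra.
  have c := chi_ge p; have hp := ln_INR_ge0 p.
  have prod0 : 0 <= ln (INR p) * (1 + chi p) by apply: Rmult_le_pos; lra.
  case: (ltnP p y) => Hpy; first by case: ifP => _; lra.
  case E : (p %% 3 == 1)%N; last lra.
  have : l <= ln (INR p).
    by apply: ln_le; [apply: lt_0_INR; apply/ltP | apply: le_INR; apply/leP].
  by rewrite chiE E; lra.
rewrite rsum_plus !rsum_scal rsum_ltn in h.
have h1 : INR (minn y N.+1) <= INR y by apply: le_INR; apply/leP; exact: geq_minl.
set A := rsum _ _ in h |- *; nra.
Qed.

Lemma ln_power_small dl eps : 0 < dl <= 1 / 2 -> 0 < eps -> exists N0, forall n, (N0 <= n)%N ->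
  ln (INR n) * (exp ((1 - dl) * ln (INR n)) + 2) <= eps * INR n.
Proof.
move=> Hd He.
have [N HN] := exp_ln_small (dl / 2) (6 / dl) eps ltac:(lra) ltac:(apply: Rlt_le; apply: Rdiv_lt_0_compat; lra) He.
exists N.+1 => n Hn; case: n Hn => [//|n] Hn.
have h := HN n ltac:(apply/leP; lia); have hn := INR_S_ge1 n; set x := INR n.+1 in h hn |- *.
have hl := ln_ge0 x hn.
have e1 : 1 <= exp ((1 - dl) * ln x) by have := exp_ineq1_le ((1 - dl) * ln x); have : 0 <= (1 - dl) * ln x; [apply: Rmult_le_pos; lra | lra].
have E : exp ((1 - dl) * ln x) = x * exp (- dl * ln x).
  have {2}<- : exp (ln x) = x by apply: exp_ln; lra.
  by rewrite -exp_plus; congr exp; ring.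
have h2 := lnexp_le dl x ltac:(lra).
have -> : eps * x = x * eps by ring.
apply: (Rle_trans _ (ln x * (3 * exp ((1 - dl) * ln x)))); first by apply: Rmult_le_compat_l; lra.
rewrite E; have -> : ln x * (3 * (x * exp (- dl * ln x))) = x * (3 * (ln x * exp (- dl * ln x))) by ring.
apply: Rmult_le_compat_l; first lra.
have E3 : 3 * (2 / dl) = 6 / dl by field; lra.
have := exp_pos (- (dl / 2) * ln x); rewrite -E3 in h; lra.
Qed.

Lemma pi1_lower eps : 0 < eps <= 1 -> exists N0, forall n, (N0 <= n)%N ->
  (1 - eps) * INR n <= 2 * INR (pi1 n) * ln (INR n).
Proof.
move=> He; have [N1 H1] := psi_asymptotic (eps / 2) ltac:(lra).
have [N2 H2] := ln_power_small (1 / 2) (eps / 4) ltac:(lra) ltac:(lra).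
exists (N1 + N2).+1 => n Hn.
have h1 := H1 n ltac:(apply/leP; lia); have h2 := H2 n ltac:(lia).
have h3 := psiK_le n ltac:(lia); move/Rabs_le_between: h1; rewrite -/(psiK n) => h1.
have hs : INR (Nat.sqrt n) <= exp ((1 - 1 / 2) * ln (INR n)).
  have hn : 0 < INR n by apply: lt_0_INR; lia.
  have E : exp ((1 - 1 / 2) * ln (INR n)) = sqrt (INR n).
    have -> : (1 - 1 / 2) * ln (INR n) = ln (INR n) / 2 by field.
    rewrite -(sqrt_square (exp (ln (INR n) / 2))); last by apply: Rlt_le; exact: exp_pos.
    by rewrite -exp_plus -{3}(exp_ln (INR n)) //; congr (sqrt (exp _)); field.
  rewrite E -(sqrt_square (INR (Nat.sqrt n))); last exact: pos_INR.
  apply: sqrt_le_1_alt; rewrite -mult_INR; apply: le_INR; exact: (proj1 (Nat.sqrt_spec n (Nat.le_0_l n))).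
have hl := ln_INR_ge0 n.
have : ln (INR n) * INR (Nat.sqrt n) <= ln (INR n) * exp ((1 - 1 / 2) * ln (INR n)) by apply: Rmult_le_compat_l.
lra.
Qed.

Lemma pi1_upper eps : 0 < eps <= 1 -> exists N0, forall n, (N0 <= n)%N ->
  2 * INR (pi1 n) * ln (INR n) <= (1 + eps) * INR n.
Proof.
move=> He; set dl := eps / 8.
have [N1 H1] := psi_asymptotic (eps / 8) ltac:(lra).
have [N2 H2] := ln_power_small dl (eps / 8) ltac:(rewrite /dl; lra) ltac:(lra).
exists (N1 + N2).+1 => n Hn.
have h1 := H1 n ltac:(apply/leP; lia); have h2 := H2 n ltac:(lia).
move/Rabs_le_between: h1; rewrite -/(psiK n) => h1.
have hn : 1 <= INR n by apply: (le_INR 1); lia.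
have hl := ln_INR_ge0 n; set l := ln (INR n) in h2 hl |- *.
have ep := exp_pos ((1 - dl) * l).
(* The cut-off n^(1 - dl): its logarithm is ln n up to the factor 1 - dl, while the discarded primes
   are negligible by [ln_power_small]. *)
have [y Hy] := nfloor_ex (exp ((1 - dl) * l)) (Rlt_le _ _ ep).
have h3 := psiK_ge n y.+1 ltac:(lia) ltac:(lia).
have hy1 : (1 - dl) * l <= ln (INR y.+1).
  rewrite -(ln_exp ((1 - dl) * l)); apply: ln_le => //; rewrite S_INR; lra.
have hy2 : INR y.+1 <= exp ((1 - dl) * l) + 1 by rewrite S_INR; lra.
have hp := pos_INR (pi1 n); have hyp := pos_INR y.+1; have hn0 := pos_INR n.
have hyl := ln_INR_ge0 y.+1.
(* If there are no more primes than the cut-off, [ln_power_small] alone gives the claim. *)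
case: (Rle_dec (INR (pi1 n)) (INR y.+1)) => Hc.
  have : 2 * (INR (pi1 n) * l) <= 2 * (l * (exp ((1 - dl) * l) + 2)).
    by apply: Rmult_le_compat_l; [lra | nra].
  nra.
have k1 : 2 * ((1 - dl) * l) * (INR (pi1 n) - INR y.+1) <= 2 * ln (INR y.+1) * (INR (pi1 n) - INR y.+1).
  by apply: Rmult_le_compat_r; lra.
have k2 : l * (INR (pi1 n) - INR y.+1) * (1 - dl) <= (1 + eps / 8) * INR n / 2 by lra.
have k3 : l * (INR (pi1 n) - INR y.+1) <= (1 + eps / 2) * INR n / 2.
  apply: (Rmult_le_reg_r (1 - dl)); first by rewrite /dl; lra.
  have q : 1 + eps / 8 <= (1 + eps / 2) * (1 - dl) by rewrite /dl; nra.
  apply: Rle_trans k2 _; have := Rmult_le_compat_l (INR n / 2) _ _ ltac:(lra) q; lra.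
have k4 : l * INR y.+1 <= eps / 8 * INR n by apply: Rle_trans h2; apply: Rmult_le_compat_l; lra.
lra.
Qed.

(* hnum n / n! is the n-th harmonic number. Replacing ln n by it turns the prime
   number theorem into a statement on natural numbers, which can be transferred
   from Stdlib's reals to an arbitrary realType. *)
Fixpoint hnum (n : nat) : nat := if n is m.+1 then (hnum m * m.+1 + m`!)%N else 0%N.

Lemma INR_fact_gt0 n : 0 < INR n`!.
Proof. by apply: lt_0_INR; apply/ltP; exact: fact_gt0. Qed.

Lemma hnum_eq n : INR (hnum n) = INR n`! * rsum (fun k => / INR (S k)) n.
Proof.
elim: n => [|n IH]; first by rewrite /=; ring.
rewrite /hnum -/hnum factS -plusE -!multE plus_INR !mult_INR IH /rsum -/rsum.
by field; have := INR_S_ge1 n; lra.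
Qed.

Lemma harmonic_lower n : ln (INR n.+1) <= rsum (fun k => / INR (S k)) n.
Proof.
elim: n => [|n IH]; first by rewrite /= ln_1; lra.
rewrite /rsum -/rsum (S_INR n.+1).
have [_ h2] := ln_S_diff (INR n.+1) ltac:(have := INR_S_ge1 n; lra); lra.
Qed.

Lemma harmonic_upper n : rsum (fun k => / INR (S k)) n.+1 <= ln (INR n.+1) + 1.
Proof.
elim: n => [|n IH]; first by rewrite /= ln_1; lra.
have [h1 _] := ln_S_diff (INR n.+1) ltac:(have := INR_S_ge1 n; lra).
change (rsum (fun k => / INR (S k)) n.+1 + / INR n.+2 <= ln (INR n.+2) + 1).
by rewrite (S_INR n.+1); lra.
Qed.

Lemma pi1_harmonic eps : 0 < eps <= 1 -> exists N0, forall n, (N0 <= n)%N ->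
  Rabs (2 * INR (pi1 n) * rsum (fun k => / INR (S k)) n - INR n) <= eps * INR n.
Proof.
move=> He; have [N1 H1] := pi1_lower eps He.
have [N2 H2] := pi1_upper (eps / 2) ltac:(lra).
(* Once ln n >= 4/eps, the bounded gap between the harmonic number and ln n costs at most eps/2
   times n. *)
have [N3 H3] := INR_unbounded (exp (4 / eps)).
exists (N1 + N2 + N3).+1 => n Hn.
have h1 := H1 n ltac:(lia); have h2 := H2 n ltac:(lia); have h3 := H3 n ltac:(apply/leP; lia).
case: n Hn h1 h2 h3 => [//|n] _ h1 h2 h3.
have a1 := harmonic_lower n.+1; have a2 := harmonic_upper n.
have a3 : ln (INR n.+1) <= ln (INR n.+2).
  by apply: ln_le; [have := INR_S_ge1 n; lra | apply: le_INR; lia].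
have hl : 4 / eps <= ln (INR n.+1).
  by rewrite -(ln_exp (4 / eps)); apply: Rlt_le; apply: ln_increasing => //; exact: exp_pos.
have hp := pos_INR (pi1 n.+1); have hn := pos_INR n.+1.
set H := rsum _ _ in a1 a2 |- *; set l := ln (INR n.+1) in h1 h2 hl a2 a3.
set P := INR (pi1 n.+1) in h1 h2 hp |- *; set x := INR n.+1 in h1 h2 hn a2 |- *.
have k1 : 2 * P * l <= 2 * P * H by apply: Rmult_le_compat_l; lra.
have k2 : 2 * P * H <= 2 * P * (l + 1) by apply: Rmult_le_compat_l; lra.
have k3 : 2 * P * (4 / eps) <= 2 * P * l by apply: Rmult_le_compat_l; lra.
have k4 : 2 * P <= eps / 2 * x.
  have E : 2 * P = eps / 4 * (2 * P * (4 / eps)) by field; lra.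
  have : eps / 4 * (2 * P * (4 / eps)) <= eps / 4 * (2 * x).
    by apply: Rmult_le_compat_l; nra.
  lra.
apply/Rabs_le; lra.
Qed.

(** [pi1_harmonic] for eps = 1/k, multiplied by k n!. *)
Theorem pi1_asymptotic_nat k : (0 < k)%N -> exists N0, forall n, (N0 <= n)%N ->
  (k * (2 * pi1 n * hnum n) <= k * (n * n`!) + n * n`!)%N /\
  (k * (n * n`!) <= k * (2 * pi1 n * hnum n) + n * n`!)%N.
Proof.
move=> Hk; have hk : 1 <= INR k by apply: (le_INR 1); apply/leP.
have he : 0 < / INR k <= 1.
  by split; [apply: Rinv_0_lt_compat; lra | rewrite -Rinv_1; apply: Rinv_le_contravar; lra].
have [N0 HN0] := pi1_harmonic (/ INR k) he.
exists N0 => n Hn; move/Rabs_le_between: (HN0 n Hn) => [h1 h2].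
have f0 := INR_fact_gt0 n.
have E : INR (k * (2 * pi1 n * hnum n))%N = INR k * (INR n`! * (2 * INR (pi1 n) * rsum (fun k => / INR (S k)) n)).
  by rewrite -!multE !mult_INR hnum_eq /=; ring.
have Ek : INR k * (/ INR k * INR n) = INR n by field; lra.
set X := 2 * INR (pi1 n) * _ in h1 h2 E.
split; apply/leP; apply: INR_le; rewrite -plusE plus_INR E -!multE !mult_INR.
- have : INR k * (INR n`! * X) <= INR k * (INR n`! * (INR n + / INR k * INR n)).
    by apply: Rmult_le_compat_l; [lra | apply: Rmult_le_compat_l; lra].
  have -> : INR k * (INR n`! * (INR n + / INR k * INR n)) = INR k * (INR n * INR n`!) + INR n`! * (INR k * (/ INR k * INR n)) by ring.
  rewrite Ek; lra.
- have : INR k * (INR n`! * (INR n - / INR k * INR n)) <= INR k * (INR n`! * X).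
    by apply: Rmult_le_compat_l; [lra | apply: Rmult_le_compat_l; lra].
  have -> : INR k * (INR n`! * (INR n - / INR k * INR n)) = INR k * (INR n * INR n`!) - INR n`! * (INR k * (/ INR k * INR n)) by ring.
  rewrite Ek; lra.
Qed.

End PrimeCount.

From mathcomp Require Import all_boot all_order all_algebra all_field cyclic.
From mathcomp Require Import zify ring lra.

Module EisensteinIntegers.

Import PrimeCount.
Set Implicit Arguments.
Unset Strict Implicit.
Unset Printing Implicit Defensive.
Import Order.TTheory GRing.Theory Num.Theory.
Local Open Scope ring_scope.

(** * The norm form of Z[omega] *)

Definition nrm (a : int * int) : int := a.1 ^+ 2 - a.1 * a.2 + a.2 ^+ 2.

(** A pair (x, y) stands for x + y omega; both omega^2 and the conjugate of omega are -1 - omega. *)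
Definition mulE (a b : int * int) : int * int :=
  (a.1 * b.1 - a.2 * b.2, a.1 * b.2 + a.2 * b.1 - a.2 * b.2).

Definition conjE (a : int * int) : int * int := (a.1 - a.2, - a.2).

Definition dvdE (a b : int * int) : Prop := exists c, b = mulE c a.

Lemma mulEA a b c : mulE a (mulE b c) = mulE (mulE a b) c.
Proof. by rewrite /mulE /=; congr pair; ring. Qed.

Lemma mulEC a b : mulE a b = mulE b a.
Proof. by rewrite /mulE /=; congr pair; ring. Qed.

Lemma mulE1 a : mulE a (1, 0) = a.
Proof. by case: a => x y; rewrite /mulE /=; congr pair; ring. Qed.

Lemma nrmM a b : nrm (mulE a b) = nrm a * nrm b.
Proof. by rewrite /nrm /mulE /=; ring. Qed.

Lemma nrm_conj a : nrm (conjE a) = nrm a.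
Proof. by rewrite /nrm /conjE /=; ring. Qed.

Lemma mulE_conj a : mulE (conjE a) a = (nrm a, 0).
Proof. by rewrite /nrm /mulE /conjE /=; congr pair; ring. Qed.

Lemma nrm_ge0 a : 0 <= nrm a.
Proof. rewrite /nrm; nia. Qed.

Lemma nrm_eq0 a : nrm a = 0 -> a = (0, 0).
Proof.
case: a => x y; rewrite /nrm /= => H.
have H1 : 4 * (x ^+ 2 - x * y + y ^+ 2) = (2 * x - y) ^+ 2 + 3 * y ^+ 2 by ring.
rewrite H in H1.
have y0 : y = 0 by nia.
have x0 : x = 0 by rewrite y0 in H; nia.
by rewrite x0 y0.
Qed.

(** 4 (x^2 - x y + y^2) = (2 x - y)^2 + 3 y^2, and the same with x and y exchanged, bound both
    coordinates by 1. *)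
Lemma nrm_eq1 a : nrm a = 1 ->
  a \in [:: (1, 0); (-1, 0); (0, 1); (0, -1); (1, 1); (-1, -1)].
Proof.
case: a => x y; rewrite /nrm /= => H.
have H1 : 4 * (x ^+ 2 - x * y + y ^+ 2) = (2 * x - y) ^+ 2 + 3 * y ^+ 2 by ring.
have H2 : 4 * (x ^+ 2 - x * y + y ^+ 2) = (2 * y - x) ^+ 2 + 3 * x ^+ 2 by ring.
rewrite H in H1 H2.
have hy : -1 <= y <= 1 by apply/andP; split; nia.
have hx : -1 <= x <= 1 by apply/andP; split; nia.
rewrite !inE !xpair_eqE; nia.
Qed.

Lemma nrm_eq1P u : nrm u = 1 ->
  [\/ u.1 = 1 /\ u.2 = 0, u.1 = -1 /\ u.2 = 0, u.1 = 0 /\ u.2 = 1 |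
   [\/ u.1 = 0 /\ u.2 = -1, u.1 = 1 /\ u.2 = 1 | u.1 = -1 /\ u.2 = -1]].
Proof.
case: u => u v /nrm_eq1; rewrite !inE !xpair_eqE /=.
by do !case/orP; case/andP => /eqP -> /eqP ->;
 first [by apply: Or41 | by apply: Or42 | by apply: Or43 | by apply: Or44; apply: Or31
   | by apply: Or44; apply: Or32 | by apply: Or44; apply: Or33].
Qed.

Lemma dvdz_prime_mul (p : nat) (a b : int) : prime p -> (p %| a * b)%Z -> (p %| a)%Z || (p %| b)%Z.
Proof. by move=> Hp; rewrite !dvdzE abszM Euclid_dvdM. Qed.

Lemma dvdz_prime_sqr (p : nat) (a : int) : prime p -> (p %| a ^+ 2)%Z -> (p %| a)%Z.
Proof. by move=> Hp; rewrite expr2 => /(dvdz_prime_mul Hp); rewrite orbb. Qed.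

(** Takes the place of unique factorisation. For the two elements alpha and gamma, p divides the
    product of the omega-coordinates of alpha conj(gamma) and alpha gamma, hence one of them; the
    norm p^2 makes p divide the other coordinate too, and the quotient by p is the unit sought. *)
Lemma nrm_prime_unique (p : nat) (a b c d : int) : prime p ->
  nrm (a, b) = p%:Z -> nrm (c, d) = p%:Z ->
  (exists2 u, nrm u = 1 & (a, b) = mulE u (c, d)) \/
  (exists2 u, nrm u = 1 & (a, b) = mulE u (conjE (c, d))).
Proof.
move=> Hp Ha Hc; have p0 : p%:Z != 0 by rewrite eqz_nat -lt0n prime_gt0.
have key g h : nrm (a, b) = p%:Z -> nrm (g, h) = p%:Z ->
    (p %| (mulE (a, b) (conjE (g, h))).2)%Z -> exists2 u, nrm u = 1 & (a, b) = mulE u (g, h).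
  move=> Hab Hgh; set w := mulE _ _ => Hv.
  have Hw : nrm w = p%:Z ^+ 2 by rewrite /w nrmM nrm_conj Hab Hgh expr2.
  have Hu : (p %| w.1)%Z.
    apply: (dvdz_prime_sqr Hp).
    have -> : w.1 ^+ 2 = p%:Z * p%:Z + w.2 * (w.1 - w.2) by rewrite -expr2 -Hw /nrm; ring.
    by apply: rpredD; rewrite ?dvdz_mulr.
  case/dvdzP: Hv => v Ev; case/dvdzP: Hu => u Eu.
  have Hn : nrm (u, v) = 1.
    have E : p%:Z ^+ 2 * nrm (u, v) = nrm w by rewrite {2}/nrm Ev Eu /nrm /=; ring.
    by apply: (mulfI (expf_neq0 2 p0)); rewrite E Hw mulr1.
  exists (u, v) => //.
  have E : mulE w (g, h) = (p%:Z * a, p%:Z * b).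
    by rewrite /w -mulEA mulE_conj Hgh /mulE /=; congr pair; ring.
  have E1 : w.1 * g - w.2 * h = p%:Z * a := congr1 fst E.
  have E2 : w.1 * h + w.2 * g - w.2 * h = p%:Z * b := congr1 snd E.
  rewrite Ev Eu in E1 E2.
  rewrite /mulE /=; congr pair; apply: (mulfI p0); [rewrite -E1 | rewrite -E2]; ring.
have Hcc : nrm (conjE (c, d)) = p%:Z by rewrite nrm_conj.
have prod : (p %| (mulE (a, b) (conjE (c, d))).2 * (mulE (a, b) (conjE (conjE (c, d)))).2)%Z.
  have -> : (mulE (a, b) (conjE (c, d))).2 * (mulE (a, b) (conjE (conjE (c, d)))).2 =
     b ^+ 2 * nrm (c, d) - d ^+ 2 * nrm (a, b) by rewrite /mulE /conjE /nrm /=; ring.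
  by rewrite Ha Hc -mulrBl; exact: dvdz_mull.
case/orP: (dvdz_prime_mul Hp prod) => H; [left | right]; exact: key.
Qed.

(** The equation x^2 - x y + y^2 = p with x y moved to the right, so that it lives in the natural
    numbers. *)
Definition sol (p : nat) (z : nat * nat) : bool :=
  (0 < z.1)%N && (z.1 * z.1 + z.2 * z.2 == p + z.1 * z.2)%N.

Lemma sol_nrmP p x y : sol p (x, y) = (0 < x)%N && (nrm (x%:Z, y%:Z) == p%:Z).
Proof. by rewrite /sol /nrm /=; case: (0 < x)%N => //=; apply/eqP/eqP; lia. Qed.

(** Twelve candidates, six units times the element or its conjugate; the signs leave four. *)
Lemma sol_unique p a b c d : prime p -> (0 < b < a)%N -> sol p (a, b) -> sol p (c, d) ->
  (c, d) \in [:: (a, b); (b, a); (a, a - b)%N; (a - b, a)%N].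
Proof.
move=> Hp Hab; rewrite !sol_nrmP => /andP [_ /eqP Ha] /andP [c0 /eqP Hc].
rewrite !inE !xpair_eqE.
case: (nrm_prime_unique Hp Ha Hc) => [[u Hu]|[u Hu]];
  case: (nrm_eq1P Hu) => [[eu ev]|[eu ev]|[eu ev]|[[eu ev]|[eu ev]|[eu ev]]];
  rewrite /mulE /conjE /= eu ev => -[E1 E2]; lia.
Qed.

(** A repetition in the list would need a = 2 b, and then p = 3 b^2 forces p = 3. *)
Lemma sol_list p a b : prime p -> p != 3%N -> (0 < b < a)%N -> sol p (a, b) ->
  [/\ sol p (b, a), sol p (a, a - b)%N & sol p (a - b, a)%N] /\
  uniq [:: (a, b); (b, a); (a, a - b)%N; (a - b, a)%N].
Proof.
move=> Hp Hp3 Hab; rewrite !sol_nrmP => /andP [_ /eqP Ha].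
have ab : (a != 2 * b)%N.
  apply/eqP => E; move: Ha; rewrite /nrm /= E => H.
  have {}H : (p = 3 * b * b)%N by lia.
  have : (b %| p)%N by rewrite H dvdn_mull.
  have := prime_gt1 Hp; case/primeP: (Hp) => _ hd p1 /hd /orP [/eqP b1|/eqP bp].
    by move: Hp3; rewrite H b1.
  by nia.
split; last by rewrite /= !inE !xpair_eqE; lia.
have e : ((a - b)%N)%:Z = a%:Z - b%:Z by lia.
rewrite /nrm /= in Ha *; split; apply/andP; split; try lia; apply/eqP; rewrite ?e -Ha; ring.
Qed.

Lemma prime_not_square p n : prime p -> (n * n)%N != p.
Proof.
move=> Hp; apply/eqP => E; move: (Hp); rewrite -E => /primeP [n1 /(_ n (dvdn_mulr _ (dvdnn n)))].
by case/orP => /eqP h; nia.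
Qed.

(** * Representation of the primes p = 1 mod 3 by the norm form *)

Lemma Fp_natr_eq0 p n : prime p -> (n%:R == 0 :> 'F_p) = (p %| n)%N.
Proof. by move=> Hp; rewrite (dvdn_pcharf (pchar_Fp Hp)). Qed.

(** The multiplicative group is cyclic of order p - 1, a multiple of 3, so a power of a generator is
    a primitive cube root of unity. *)
Lemma cube_root_mod p : prime p -> (p %% 3 = 1)%N -> exists z : 'F_p, z ^+ 2 + z + 1 = 0.
Proof.
move=> Hp Hp3; have p1 := prime_gt1 Hp.
pose rs := [seq x <- enum 'F_p | x != 0].
have szrs : size rs = p.-1.
  rewrite size_filter -sum1_count big_enum_cond /= sum1_card cardC1 card_Fp //.
have unity x : x != 0 -> x ^+ p.-1 = 1 :> 'F_p.
  move=> x0; apply: (mulfI x0); rewrite -exprS prednK ?prime_gt0 // mulr1.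
  by have := expf_card x; rewrite card_Fp.
have /hasP [w _ Hw] : has p.-1.-primitive_root rs.
  apply: has_prim_root; rewrite ?szrs //; first by lia.
    by apply/allP => x; rewrite mem_filter => /andP [x0 _]; apply/unity_rootP; exact: unity.
  by rewrite filter_uniq // enum_uniq.
pose q := (p %/ 3)%N; have Eq : (p.-1 = q * 3)%N by rewrite /q; lia.
exists (w ^+ q); have z3 : (w ^+ q) ^+ 3 = 1 by rewrite -exprM -Eq prim_expr_order.
have z1 : w ^+ q - 1 != 0.
  rewrite subr_eq0 -(prim_order_dvd Hw) Eq; apply/negP => /dvdn_leq.
  by rewrite /q; move=> /(_ ltac:(lia)); lia.
by apply: (mulfI z1); rewrite mulr0; transitivity ((w ^+ q) ^+ 3 - 1); [ring | rewrite z3 subrr].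
Qed.

Lemma isqrt_ex p : exists k, (k * k <= p < k.+1 * k.+1)%N.
Proof.
have ex : exists k, (p < k.+1 * k.+1)%N by exists p; nia.
case: (ex_minnP ex) => k Hk Hmin; exists k; rewrite Hk andbT.
case: k Hk Hmin => [//|k] Hk Hmin; rewrite leqNgt; apply/negP => H.
by have := Hmin k H; rewrite ltnn.
Qed.

(* Thue's pigeonhole argument. *)
Lemma thue p : prime p -> (p %% 3 = 1)%N -> exists x y : int, x ^+ 2 + x * y + y ^+ 2 = p%:Z.
Proof.
move=> Hp Hp3; have p1 := prime_gt1 Hp.
have [z Hz] := cube_root_mod Hp Hp3; have [k /andP [Hk1 Hk2]] := isqrt_ex p.
pose f (uv : 'I_k.+1 * 'I_k.+1) : 'F_p := (uv.1 : nat)%:R - z * (uv.2 : nat)%:R.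
(* There are (k + 1)^2 > p pairs for p residues. *)
have /injectivePn [[u v] [[u' v'] Hne Hf]] : ~~ injectiveb f.
  apply/negP => /injectiveP /leq_card; rewrite card_Fp // card_prod card_ord.
  by rewrite leqNgt Hk2.
pose x : int := (u : nat)%:Z - (u' : nat)%:Z; pose y : int := (v : nat)%:Z - (v' : nat)%:Z.
have Hxy : x%:~R = z * y%:~R :> 'F_p.
  rewrite /x /y !rmorphB /= -!pmulrn mulrBr; move: Hf; rewrite /f /= => Hf.
  apply/eqP; rewrite -subr_eq0; apply/eqP.
  transitivity (((u : nat)%:R - z * (v : nat)%:R) - ((u' : nat)%:R - z * (v' : nat)%:R) : 'F_p); first by ring.
  by rewrite Hf subrr.
have Hle (i j : 'I_k.+1) : ((i : nat)%:Z - (j : nat)%:Z) ^+ 2 <= (k * k)%N%:Z.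
  by have := ltn_ord i; have := ltn_ord j; nia.
have Hx : x ^+ 2 <= (k * k)%N%:Z by exact: Hle.
have Hy : y ^+ 2 <= (k * k)%N%:Z by exact: Hle.
have n0 : 0 < x ^+ 2 + x * y + y ^+ 2.
  have : x != 0 \/ y != 0.
    move: Hne; rewrite xpair_eqE negb_and -!val_eqE /= => /orP [H|H]; [left | right]; rewrite /x /y; lia.
  nia.
set n := x ^+ 2 + x * y + y ^+ 2 in n0.
have Hn : (p %| `|n|)%N.
  rewrite -Fp_natr_eq0 //; have -> : (`|n|%N)%:R = n%:~R :> 'F_p by rewrite pmulrn gez0_abs // ltW.
  rewrite /n !rmorphD !rmorphXn /= rmorphM /= Hxy; apply/eqP.
  transitivity (y%:~R ^+ 2 * (z ^+ 2 + z + 1)); [ring | by rewrite Hz mulr0].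
have kp : (k * k < p)%N by rewrite ltn_neqAle prime_not_square.
have n3 : n < 3 * p%:Z by rewrite /n; nia.
(* p divides n and 0 < n < 3 p, so n is p or 2 p. *)
case/dvdnP: Hn => t Ht.
have [t1|t2] : t = 1%N \/ t = 2%N by nia.
  by exists x, y; rewrite -/n; lia.
(* The case n = 2 p: x^2 + x y + y^2 is even only for x and y both even, and then 4 divides 2 p. *)
have En : n = 2 * p%:Z by lia.
exfalso; move: En; rewrite /n => En.
have Ex : x = 2 * (x %/ 2)%Z + (x %% 2)%Z by rewrite {1}(divz_eq x 2) mulrC.
have Ey : y = 2 * (y %/ 2)%Z + (y %% 2)%Z by rewrite {1}(divz_eq y 2) mulrC.
have rx : (x %% 2)%Z = 0 \/ (x %% 2)%Z = 1 by lia.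
have ry : (y %% 2)%Z = 0 \/ (y %% 2)%Z = 1 by lia.
move: En Ex Ey; set X := (x %/ 2)%Z; set Y := (y %/ 2)%Z => En Ex Ey.
case: rx => rx; case: ry => ry; rewrite rx ry in Ex Ey; rewrite Ex Ey in En; last 3 first.
- have : exists m : int, 2 * m = 1 by exists (p%:Z - (2 * X ^+ 2 + 2 * X * Y + X + 2 * Y ^+ 2 + 2 * Y)); rewrite mulrBr -En; ring.
  by case=> m; lia.
- have : exists m : int, 2 * m = 1 by exists (p%:Z - (2 * X ^+ 2 + 2 * X + 2 * X * Y + Y + 2 * Y ^+ 2)); rewrite mulrBr -En; ring.
  by case=> m; lia.
- have : exists m : int, 2 * m = 1.
    by exists (p%:Z - (2 * X ^+ 2 + 3 * X + 2 * X * Y + 3 * Y + 2 * Y ^+ 2 + 1)); rewrite mulrBr -En; ring.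
  by case=> m; lia.
have [m Em] : exists m : int, p%:Z = 2 * m.
  by exists (X ^+ 2 + X * Y + Y ^+ 2); apply: (@mulfI int 2) => //; rewrite -En; ring.
have : (2 %| p)%N by lia.
by rewrite dvdn_prime2 // => /eqP E2; rewrite -E2 in Hp3.
Qed.

Lemma sol_exists p : prime p -> (p %% 3 = 1)%N -> exists a b, (0 < b < a)%N /\ sol p (a, b).
Proof.
move=> Hp Hp3; have [x [y E]] := thue Hp Hp3.
have sq n := prime_not_square n Hp; have p1 := prime_gt1 Hp.
pose X := `|x|%N; pose Y := `|y|%N.
have X0 : (0 < X)%N by rewrite lt0n; apply/eqP => H; have := sq Y; rewrite /X /Y in H *; nia.
have Y0 : (0 < Y)%N by rewrite lt0n; apply/eqP => H; have := sq X; rewrite /X /Y in H *; nia.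
(* Thue gives the form with + x y. If x and y have the same sign, the point (X + Y, X) represents p
   by the form with - x y; otherwise X and Y do so already. *)
have [Exy|Exy] : (X * X + X * Y + Y * Y = p)%N \/ (X * X + Y * Y = p + X * Y)%N.
  by rewrite /X /Y; case: (lerP 0 (x * y)) => H; [left | right]; nia.
- exists (X + Y)%N, X; split; first by rewrite X0 -{1}(addn0 X) ltn_add2l.
  by rewrite /sol /= addn_gt0 X0 -Exy; apply/eqP; ring.
- have [H|H|H] := ltngtP X Y.
  + by exists Y, X; split; [lia | rewrite /sol /=; apply/andP; split; lia].
  + by exists X, Y; split; [lia | rewrite /sol /=; apply/andP; split; lia].
  + by have := sq X; rewrite -H in Exy; lia.
Qed.

(** * Prime elements *)

Definition primeE (a : int * int) : Prop :=
  [/\ a <> (0, 0), ~ dvdE a (1, 0) & forall b c, dvdE a (mulE b c) -> dvdE a b \/ dvdE a c].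

(** x^2 - x y + y^2 = (x + y)^2 - 3 x y is a square modulo 3. *)
Lemma nrm_mod3 (x y : int) q : nrm (x, y) = q%:Z -> (q %% 3 != 2)%N.
Proof.
rewrite /nrm /= => H.
have E : q%:Z = (x + y) ^+ 2 - 3 * (x * y) by rewrite -H; ring.
have Es : x + y = 3 * ((x + y) %/ 3)%Z + ((x + y) %% 3)%Z by rewrite {1}(divz_eq (x + y) 3) mulrC.
have r3 : [\/ ((x + y) %% 3)%Z = 0, ((x + y) %% 3)%Z = 1 | ((x + y) %% 3)%Z = 2].
  have : 0 <= ((x + y) %% 3)%Z < 3 by lia.
  by case: ((x + y) %% 3)%Z => [[|[|[|n]]]|n] //= _; [apply: Or31 | apply: Or32 | apply: Or33].
move: E Es; set s := x + y; set t := (s %/ 3)%Z; set xy := x * y => E Es.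
have [m Em] : exists m : int, q%:Z = 3 * m \/ q%:Z = 3 * m + 1.
  case: r3 => r; rewrite -/s r in Es.
  - by exists (3 * t ^+ 2 - xy); left; rewrite E Es; ring.
  - by exists (3 * t ^+ 2 + 2 * t - xy); right; rewrite E Es; ring.
  - by exists (3 * t ^+ 2 + 4 * t + 1 - xy); right; rewrite E Es; ring.
lia.
Qed.

(** The least prime factor of m is split off: a divides it or the smaller cofactor. *)
Lemma dvdE_nat_prime a m : (0 < m)%N -> ~ dvdE a (1, 0) ->
  (forall b c, dvdE a (mulE b c) -> dvdE a b \/ dvdE a c) -> dvdE a (m%:Z, 0) ->
  exists2 q, prime q & dvdE a (q%:Z, 0).
Proof.
move=> + Hu Hpr; elim/ltn_ind: m => m IH m0 Hm.
have [m1|m1] := eqVneq m 1%N; first by rewrite m1 in Hm.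
have Hq : prime (pdiv m) by apply: pdiv_prime; lia.
have Hd := pdiv_dvd m; case/dvdnP: Hd => m' Em.
have E : (m%:Z, 0) = mulE ((pdiv m)%:Z, 0) (m'%:Z, 0) by rewrite {1}Em /mulE /=; congr pair; lia.
rewrite E in Hm; case: (Hpr _ _ Hm) => H; first by exists (pdiv m).
have m'0 : (0 < m')%N by case: m' Em {E Hm H} => // Em; rewrite Em in m0.
apply: (IH m') => //; rewrite {1}Em; have := prime_gt1 Hq; nia.
Qed.

(** Since a divides nrm a, it divides a rational prime q, and nrm a divides q^2. It is not 1; if it
    is q^2, the cofactor of a in q has norm 1. *)
Lemma primeE_nrm a : primeE a -> exists2 q, prime q &
  nrm a = q%:Z \/ exists2 u, nrm u = 1 & a = mulE (q%:Z, 0) u.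
Proof.
move=> [a0 au apr].
have n0 : 0 < nrm a by rewrite lt_def nrm_ge0 andbT; apply/eqP => /nrm_eq0.
have unitN : nrm a <> 1.
  by move=> H; apply: au; exists (conjE a); rewrite mulE_conj H.
have [q Hq [c Hc]] : exists2 q, prime q & dvdE a (q%:Z, 0).
  apply: (@dvdE_nat_prime a `|nrm a|) => //; first by lia.
  by exists (conjE a); rewrite mulE_conj; congr pair; lia.
exists q => //.
have EN : q%:Z ^+ 2 = nrm a * nrm c by rewrite -nrmM mulEC -Hc /nrm /=; ring.
have Hd : (`|nrm a| %| q ^ 2)%N.
  by apply/dvdnP; exists `|nrm c|%N; rewrite -abszM mulrC -EN abszX.
case/(dvdn_pfactor _ _ Hq): Hd => j Hj Ej.
have Ea : nrm a = (q ^ j)%N%:Z by lia.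
case: j Hj Ej Ea => [|[|[|j]]] // _ _ Ea.
- by left; rewrite Ea expn1.
- right; have q0 : q%:Z ^+ 2 != 0 by rewrite expf_neq0 // eqz_nat -lt0n prime_gt0.
  have Nc : nrm c = 1 by apply: (mulfI q0); rewrite mulr1 {2}EN Ea; congr (_ * _); lia.
  exists (conjE c); first by rewrite nrm_conj.
  by rewrite Hc (mulEC c) -mulEA (mulEC c) mulE_conj Nc mulE1.
Qed.

(** The quotient by a + b omega is the field with p elements: a + b omega divides c + d omega
    exactly when p divides b c - a d. Modulo p the product of two such forms is b times the form of
    the product, so Euclid's lemma applies. *)
Lemma nrm_prime_primeE p a b : prime p -> nrm (a, b) = p%:Z -> primeE (a, b).
Proof.
move=> Hp Hn; have p0 : p%:Z != 0 by rewrite eqz_nat -lt0n prime_gt0.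
have bp : ~~ (p %| b)%Z.
  apply/negP => /dvdzP [k Ek].
  have : (p %| a ^+ 2)%Z.
    have -> : a ^+ 2 = p%:Z + b * (a - b) by rewrite -Hn /nrm /=; ring.
    by rewrite Ek; apply: rpredD => //; rewrite -mulrA mulrCA dvdz_mulr.
  move/(dvdz_prime_sqr Hp)/dvdzP => [l El].
  have E : p%:Z * 1 = p%:Z * (p%:Z * (l ^+ 2 - l * k + k ^+ 2)).
    by rewrite mulr1 -{1}Hn /nrm /= Ek El; ring.
  have E1 := mulfI p0 E.
  have : (p %| (1 : int)%R)%Z by rewrite E1 dvdz_mulr.
  by rewrite dvdzE /= dvdn1 => /eqP p1; move: (prime_gt1 Hp); rewrite p1.
have lin c d : dvdE (a, b) (c, d) <-> (p %| b * c - a * d)%Z.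
  split.
    case=> -[e f]; rewrite /mulE /= => -[-> ->].
    have -> : b * (e * a - f * b) - a * (e * b + f * a - f * b) = - f * nrm (a, b) by rewrite /nrm /=; ring.
    by rewrite Hn dvdz_mull.
  move=> /dvdzP [v Ev].
  pose u := a * c - a * d + b * d.
  have Hu : (p %| u)%Z.
    apply: (dvdz_prime_sqr Hp).
    have -> : u ^+ 2 = p%:Z * nrm (c, d) + (b * c - a * d) * (u - (b * c - a * d)).
      by rewrite -Hn /nrm /u /=; ring.
    by rewrite Ev; apply: rpredD; [exact: dvdz_mulr | rewrite -mulrA mulrCA dvdz_mulr].
  case/dvdzP: Hu => w Ew.
  have ea : a = p%:Z * 0 + a by rewrite mulr0 add0r.
  exists (w - v, - v); rewrite /mulE /=; congr pair; apply: (mulfI p0).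
    transitivity (a * (w * p%:Z) - (a - b) * (v * p%:Z)); last by ring.
    by rewrite -Ew -Ev -Hn /u /nrm /=; ring.
  transitivity (b * (w * p%:Z) - a * (v * p%:Z)); last by ring.
  by rewrite -Ew -Ev -Hn /u /nrm /=; ring.
split.
- by move=> [a0 b0]; move: bp; rewrite b0 dvdz0.
- by move/lin; rewrite mulr1 mulr0 subr0; apply/negP.
move=> [c d] [e f] /lin H.
have {}H : (p %| (b * c - a * d) * (b * e - a * f))%Z.
  have -> : (b * c - a * d) * (b * e - a * f) =
     b * (b * (mulE (c, d) (e, f)).1 - a * (mulE (c, d) (e, f)).2) + p%:Z * (d * f).
    by rewrite -Hn /nrm /mulE /=; ring.
  by apply: rpredD; [exact: dvdz_mull | exact: dvdz_mulr].
by case/orP: (dvdz_prime_mul Hp H) => h; [left | right]; apply/lin.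
Qed.

(** * Lattice points of prime norm *)

Definition grid (B : nat) : seq (nat * nat) := [seq (x, y) | x <- iota 0 B, y <- iota 0 B].

Lemma mem_grid B x y : ((x, y) \in grid B) = (x < B)%N && (y < B)%N.
Proof.
apply/allpairsP/andP => [[[u v] /= [Hu Hv [-> ->]]]|[Hx Hy]].
  by move: Hu Hv; rewrite !mem_iota.
by exists (x, y); rewrite !mem_iota.
Qed.

Lemma grid_uniq B : uniq (grid B).
Proof. by apply: allpairs_uniq; rewrite ?iota_uniq // => -[a b] [c d] _ _ [-> ->]. Qed.

Lemma sol_lt p x y B : (p < B)%N -> sol p (x, y) -> (x < B)%N && (y < B)%N.
Proof.
move=> HB; rewrite /sol /= => /andP [x0 /eqP E]; case: y E => [|y] E; first by nia.
by apply/andP; split; nia.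
Qed.

Lemma count_sol p B : prime p -> (p %% 3 = 1)%N -> (p < B)%N -> count (sol p) (grid B) = 4%N.
Proof.
move=> Hp Hp3 HB; have [a [b [Hab Hs]]] := sol_exists Hp Hp3.
have p3 : p != 3%N by apply/eqP => E; rewrite E in Hp3.
have [[s1 s2 s3] Hu] := sol_list Hp p3 Hab Hs.
rewrite -size_filter.
suff /perm_size -> : perm_eq [seq z <- grid B | sol p z] [:: (a, b); (b, a); (a, a - b)%N; (a - b, a)%N] by [].
apply: uniq_perm => //; first by rewrite filter_uniq // grid_uniq.
move=> [c d]; rewrite mem_filter mem_grid; apply/idP/idP => [/andP [H _]|].
  exact: (sol_unique Hp Hab Hs H).
move=> H; suff H1 : sol p (c, d) by rewrite H1 (sol_lt HB H1).
by move: H; rewrite !inE => /or4P [] /eqP ->.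
Qed.

(** Truncated subtraction is exact here, because x y <= x^2 + y^2. *)
Definition nnrm (z : nat * nat) : nat := (z.1 * z.1 + z.2 * z.2 - z.1 * z.2)%N.

Lemma nnrmE x y : (nnrm (x, y))%:Z = nrm (x%:Z, y%:Z).
Proof. by rewrite /nnrm /nrm /=; nia. Qed.

Lemma sol_nnrm p z : sol p z = (0 < z.1)%N && (nnrm z == p).
Proof. by case: z => x y; rewrite sol_nrmP -nnrmE eqz_nat. Qed.

Definition good (N : nat) (z : nat * nat) : bool :=
  [&& (0 < z.1)%N, prime (nnrm z), (nnrm z %% 3 == 1)%N & (nnrm z <= N)%N].

(** The points are grouped by their norm p, and [count_sol] gives four for each p. *)
Lemma count_good N B : (N < B)%N -> count (good N) (grid B) = (4 * pi1 N)%N.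
Proof.
move=> HB; rewrite /pi1 big_distrr /=.
transitivity (\sum_(z <- grid B) \sum_(0 <= p < N.+1) (prime p && (p %% 3 == 1)%N) * sol p z)%N.
  rewrite -sum1_count big_mkcond; apply: eq_bigr => z _ /=.
  under eq_bigr => p _ do rewrite sol_nnrm.
  rewrite /good; case: (0 < z.1)%N; last by rewrite big1 // => p _; exact: muln0.
  have E p : ((prime p && (p %% 3 == 1)) * (true && (nnrm z == p)))%N =
      (if p == nnrm z then nat_of_bool (prime p && (p %% 3 == 1)%N) else 0%N).
    by rewrite andTb (eq_sym (nnrm z)); case: (p == nnrm z); [exact: muln1 | exact: muln0].
  under eq_bigr => p _ do rewrite E.
  rewrite -big_mkcond /=; case: (leqP (nnrm z) N) => Hz.
    rewrite big_nat1_eq /= ltnS Hz andbT; by case: (_ && _).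
  rewrite !andbF big_nat1_eq /=; by case: ifP => //; lia.
rewrite exchange_big big_nat [RHS]big_nat; apply: eq_bigr => p /andP [_ Hp].
rewrite -big_distrr /= mulnC; case Hpr : (prime p && (p %% 3 == 1)%N); last by rewrite !muln0.
move/andP: Hpr => [Hpr /eqP Hp3]; congr (_ * _)%N.
have HpB : (p < B)%N by lia.
rewrite -(count_sol Hpr Hp3 HpB) -sum1_count [RHS]big_mkcond.
by apply: eq_bigr => z _; case: (sol p z).
Qed.

End EisensteinIntegers.

Require Import Defs.
From mathcomp Require Import all_boot all_order all_algebra.
From mathcomp Require Import finmap complex.
From mathcomp Require Import all_classical all_reals all_analysis.
From mathcomp Require Import measurable_realfun.
From mathcomp Require Import zify ring lra.
Set Implicit Arguments.
Unset Strict Implicit.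
Unset Printing Implicit Defensive.
Import Order.TTheory GRing.Theory Num.Theory.
Import numFieldNormedType.Exports.
Import PrimeCount EisensteinIntegers.
Local Open Scope classical_set_scope.
Local Open Scope ring_scope.

(** * Primes of Z[omega] in the sector *)

Section Counting.
Local Open Scope complex_scope.
Variable R : realType.

Lemma omega_sqr : omega R * omega R = - 1 - omega R.
Proof.
have s3 : (Num.sqrt 3%:R : R) ^+ 2 = 3%:R by rewrite sqr_sqrtr.
rewrite omegaE; set s := Num.sqrt _ in s3 *.
apply/eqP; rewrite eq_complex /=; apply/andP; split; apply/eqP; last by field.
transitivity (4^-1 - s ^+ 2 / 4 : R); first by field.
by rewrite s3; field.
Qed.

(** Translates between primality in [Zomega], a statement about complex numbers, and [primeE] on
    integer pairs. *)
Definition emb (a : int * int) : R[i] := Defs.point (int_point R a).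

Lemma embM a b : emb (mulE a b) = emb a * emb b.
Proof.
rewrite /emb /mulE /Defs.point /int_point /= !(rmorphD, rmorphB, rmorphM, rmorphN) /=.
set a1 := _%:C; set b1 := _%:C; set a2 := _%:C; set b2 := _%:C.
transitivity (a1 * b1 + a2 * b2 * (- 1 - omega R) + (a1 * b2 + a2 * b1) * omega R); first by ring.
by rewrite -omega_sqr; ring.
Qed.

Lemma emb_inj : injective emb.
Proof.
move=> [x y] [u v] /eqP; rewrite /emb /Defs.point omegaE /= eq_complex /= => /andP [/eqP H1 /eqP H2].
have s0 : Num.sqrt 3%:R / 2%:R != 0 :> R.
  by rewrite mulf_neq0 ?invr_eq0 ?pnatr_eq0 // sqrtr_eq0 -ltNge ltr0n.
have yv : y = v.
  apply: (@intr_inj R); apply: (mulIf s0); move: H2; rewrite !mul0r !add0r !addr0 //.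
have xu : x = u by apply: (@intr_inj R); move: H1; rewrite yv; lra.
by rewrite xu yv.
Qed.

Lemma Zomega_emb z : Zomega z <-> exists a, z = emb a.
Proof. by split=> [[a _ <-]|[a ->]]; exists a. Qed.

Lemma dvd_emb a b : dvd_in (@Zomega R) (emb a) (emb b) <-> dvdE a b.
Proof.
split=> [[c /Zomega_emb [c' ->]]|[c ->]].
  by rewrite -embM => /emb_inj ->; exists c'.
by exists (emb c); [apply/Zomega_emb; exists c | rewrite embM].
Qed.

Lemma emb1 : emb (1, 0) = 1.
Proof. by rewrite /emb /Defs.point /int_point /= mul0r addr0. Qed.

Lemma emb0 : emb (0, 0) = 0.
Proof. by rewrite /emb /Defs.point /int_point /= mul0r addr0. Qed.

Lemma prime_emb a : prime_in (@Zomega R) (emb a) <-> primeE a.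
Proof.
split.
- move=> [_ a0 au ap]; split.
  + by move=> E; apply: a0; rewrite E emb0.
  + by move=> H; apply: au; rewrite -emb1; apply/dvd_emb.
  + move=> b c /dvd_emb; rewrite embM => H.
    have Zb : Zomega (emb b) by apply/Zomega_emb; exists b.
    have Zc : Zomega (emb c) by apply/Zomega_emb; exists c.
    by case: (ap _ _ Zb Zc H) => /dvd_emb h; [left | right].
- move=> [a0 au ap]; split.
  + by apply/Zomega_emb; exists a.
  + by rewrite -emb0 => /emb_inj.
  + by rewrite -emb1 => /dvd_emb.
  + move=> _ _ /Zomega_emb [b ->] /Zomega_emb [c ->].
    by rewrite -embM => /dvd_emb /ap [] h; [left | right]; apply/dvd_emb.
Qed.

Lemma region_sector (r : R) (a : int * int) : primes_in_region (sector r) a <->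
  [/\ 0 < a.1, 0 <= a.2, (nrm a)%:~R <= r ^+ 2 & primeE a].
Proof.
rewrite /primes_in_region /sector /= ltr0z ler0z normE_point lecR /=.
have -> : a.1%:~R ^+ 2 - a.1%:~R * a.2%:~R + a.2%:~R ^+ 2 = (nrm a)%:~R :> R.
  by rewrite /nrm !(rmorphD, rmorphB, rmorphXn, rmorphM) /= rmorphN /= rmorphM.
by split=> [[[h1 h2 h3] /prime_emb h4]|[h1 h2 h3 /prime_emb h4]].
Qed.

Definition toint (z : nat * nat) : int * int := (z.1%:Z, z.2%:Z).

Lemma toint_inj : injective toint.
Proof. by move=> [a b] [c d] [-> ->]. Qed.

Definition nprimes (r : R) : nat := #|` fset_set (primes_in_region (sector r))|.

Lemma mem_nprimes (r : R) a : (a \in fset_set (primes_in_region (sector r))) <-> primes_in_region (sector r) a.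
Proof.
rewrite in_fset_set; last exact: finite_primes_in_sector.
by rewrite inE.
Qed.

Lemma nprimes_lower (r : R) (N : nat) : N%:R <= r ^+ 2 -> (4 * pi1 N <= nprimes r)%N.
Proof.
move=> HN; rewrite -(count_good (ltnSn N)) -size_filter -(size_map toint).
apply: uniq_leq_size.
  by rewrite map_inj_uniq; [rewrite filter_uniq // grid_uniq | exact: toint_inj].
move=> a /mapP [[x y]]; rewrite mem_filter => /andP [/and4P [/= x0 Hp _ Hle] _] ->.
apply/mem_nprimes/region_sector; rewrite /toint /=; split => //.
- rewrite -nnrmE -pmulrn; apply: le_trans HN; by rewrite ler_nat.
- by apply: (nrm_prime_primeE Hp); rewrite -nnrmE.
Qed.

(** The four lists hold the points of prime norm 1 mod 3, the rational primes q on the axis y = 0,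
    their associates q (1 + omega) on the diagonal, and norm 3; the other associates of q leave the
    sector. The middle two have M + 1 entries each, as coordinates are at most r there, and the 3 by
    3 grid for norm 3 has 9. *)
Lemma nprimes_upper (r : R) (N M : nat) : 0 <= r -> r ^+ 2 < N.+1%:R -> r < M.+1%:R ->
  (nprimes r <= 4 * pi1 N + (2 * M.+1 + 9))%N.
Proof.
move=> r0 HN HM.
pose s1 := [seq toint z | z <- [seq z <- grid N.+1 | good N z]].
pose s2 := [seq toint (x, 0%N) | x <- iota 0 M.+1].
pose s3 := [seq toint (x, x) | x <- iota 0 M.+1].
pose s4 := [seq toint z | z <- grid 3].
have -> : (4 * pi1 N + (2 * M.+1 + 9))%N = size (s1 ++ (s2 ++ s3) ++ s4).
  rewrite !size_cat !size_map size_filter (count_good (ltnSn N)) !size_iota.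
  by rewrite size_allpairs !size_iota mul2n -addnn.
apply: uniq_leq_size; first exact: fset_uniq.
move=> [x y] /mem_nprimes /region_sector [/= x0 y0 Hr Hpr].
case: x x0 Hr Hpr => // x x0; case: y y0 => // y y0 Hr Hpr.
rewrite -nnrmE -pmulrn in Hr.
have HnN : (nnrm (x, y) <= N)%N by rewrite -ltnS -(ltr_nat R); exact: le_lt_trans Hr HN.
have small n : (n * n <= nnrm (x, y))%N -> (n < M.+1)%N.
  move=> Hn; rewrite -(ltr_nat R); apply: le_lt_trans HM.
  rewrite -(ler_sqr (ler0n _ _) r0); apply: le_trans Hr.
  by rewrite expr2 -natrM ler_nat.
rewrite (mem_cat _ s1) (mem_cat _ (s2 ++ s3)) (mem_cat _ s2).
have [q Hq [Hn|[[u v] Hu E]]] := primeE_nrm Hpr.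
- have q3 := nrm_mod3 Hn; have Enq : nnrm (x, y) = q by apply/eqP; rewrite -eqz_nat nnrmE Hn.
  have [q1|q1] := eqVneq (q %% 3)%N 1%N.
    suff -> : (x%:Z, y%:Z) \in s1 by [].
    have xp : (0 < x)%N by lia.
    have Hs : sol q (x, y) by rewrite sol_nnrm Enq eqxx andbT.
    apply/mapP; exists (x, y) => //; rewrite mem_filter mem_grid; apply/andP; split.
      by rewrite /good xp Enq Hq q1 -Enq HnN.
    by apply: sol_lt Hs; rewrite ltnS -Enq.
  have q0 : (3 %| q)%N by rewrite /dvdn; lia.
  move: q0; rewrite dvdn_prime2 // => /eqP q0.
  suff -> : (x%:Z, y%:Z) \in s4 by rewrite !orbT.
  apply/mapP; exists (x, y) => //; rewrite mem_grid; move: Enq; rewrite -q0 /nnrm /= => Enq.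
  by apply/andP; split; nia.
- have qp := prime_gt0 Hq.
  have xq : [\/ y = 0%N, x = y | False].
    case: (nrm_eq1P Hu) E => /= [[-> ->]|[-> ->]|[-> ->]|[[-> ->]|[-> ->]|[-> ->]]]; rewrite /mulE /= => -[E1 E2].
    + by apply: Or31; lia.
    + by apply: Or33; lia.
    + by apply: Or33; lia.
    + by apply: Or33; lia.
    + by apply: Or32; lia.
    + by apply: Or33; lia.
  case: xq => // Exy.
    suff -> : (x%:Z, y%:Z) \in s2 by rewrite orbT.
    apply/mapP; exists x; last by rewrite Exy.
    by rewrite mem_iota /=; apply: small; rewrite /nnrm Exy /=; lia.
  suff -> : (x%:Z, y%:Z) \in s3 by rewrite !orbT.
  apply/mapP; exists x; last by rewrite -Exy.
  by rewrite mem_iota /=; apply: small; rewrite /nnrm -Exy /=; lia.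
Qed.

End Counting.

(** * The area of the sector *)

Section EllipseIntegral.
Variable R : realType.
Variable r : R.
Hypothesis r0 : 0 < r.

Let q : R := Num.sqrt 3.
Let q2 : q ^+ 2 = 3. Proof. by rewrite sqr_sqrtr. Qed.
Let q0 : 0 < q. Proof. by rewrite sqrtr_gt0. Qed.
Let qn0 : q != 0. Proof. by rewrite gt_eqF. Qed.

(** The length of the vertical chord of the ellipse at abscissa x: solving for y gives the ends (x -
    chord)/2 and (x + chord)/2. *)
Definition chord (x : R) : R := Num.sqrt (4 * r ^+ 2 - 3 * x ^+ 2).
Definition xmax : R := 2 * r / q.

Lemma xmax_sqr : 3 * xmax ^+ 2 = 4 * r ^+ 2.
Proof. by rewrite /xmax expr_div_n q2 exprMn; field. Qed.

Lemma xmax_gt0 : 0 < xmax. Proof. by rewrite divr_gt0 // mulr_gt0. Qed.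

Lemma lt_r_xmax : r < xmax.
Proof.
rewrite -(@ltr_pXn2r _ 2) ?nnegrE ?(ltW r0) ?(ltW xmax_gt0) //.
have h : 0 < r ^+ 2 by rewrite exprn_gt0.
by have := xmax_sqr; lra.
Qed.

Lemma chord_ge0 x : 0 <= chord x. Proof. exact: sqrtr_ge0. Qed.

Lemma chord_sqr x : 0 <= x <= xmax -> chord x ^+ 2 = 4 * r ^+ 2 - 3 * x ^+ 2.
Proof.
move=> /andP [x0 xm]; rewrite sqr_sqrtr // subr_ge0 -xmax_sqr ler_pM2l //.
by rewrite ler_pXn2r // nnegrE // ltW // xmax_gt0.
Qed.

Lemma chord_gt0 x : 0 <= x < xmax -> 0 < chord x.
Proof.
move=> /andP [x0 xm]; rewrite sqrtr_gt0 subr_gt0 -xmax_sqr ltr_pM2l //.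
by rewrite ltr_pXn2r // nnegrE // ltW // xmax_gt0.
Qed.

Lemma chord_xmax : chord xmax = 0.
Proof. by rewrite /chord xmax_sqr subrr sqrtr0. Qed.

Lemma chord_r : chord r = r.
Proof.
have -> : chord r = Num.sqrt (r ^+ 2) by rewrite /chord; congr Num.sqrt; ring.
by rewrite sqrtr_sqr gtr0_norm.
Qed.

Lemma chord_continuous : continuous chord.
Proof.
move=> x; rewrite /chord; apply: continuous_comp; last exact: sqrt_continuous.
apply: continuousB; first exact: cst_continuous.
by apply: continuousM; [exact: cst_continuous | exact: exprn_continuous].
Qed.

Lemma chord_derive x : 0 <= x < xmax -> is_derive x 1 chord (- 3 * x / chord x).
Proof.
move=> Hx; have c0 := chord_gt0 Hx.
have p0 : 0 < 4 * r ^+ 2 - 3 * x ^+ 2 by rewrite -sqrtr_gt0.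
have dp : is_derive x 1 (fun y : R => 4 * r ^+ 2 - 3 * y ^+ 2) (- (6 * x)).
  by apply: is_derive_eq; rewrite /GRing.scale /= ; ring.
have ds := is_derive1_sqrt p0.
have := @is_derive1_comp R Num.sqrt (fun y : R => 4 * r ^+ 2 - 3 * y ^+ 2) x _ _ ds dp.
move=> h; apply: is_derive_eq h _; rewrite -/(chord x); field.
by rewrite gt_eqF.
Qed.

(* Antiderivative of chord; the half-angle form of the arcsine keeps it
   differentiable up to the end point where chord vanishes. *)
Definition chordint (x : R) : R := x / 2 * chord x + 4 * r ^+ 2 / q * atan (q * x / (2 * r + chord x)).

Lemma den_gt0 x : 0 < 2 * r + chord x.
Proof. by rewrite ltr_pwDl ?chord_ge0 // mulr_gt0. Qed.

Lemma chordint_continuous : continuous chordint.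
Proof.
move=> x; rewrite /chordint; apply: cvgD.
  apply: cvgM; last exact: chord_continuous.
  by apply: cvgM; [exact: cvg_id | exact: cvg_cst].
apply: cvgM; first exact: cvg_cst.
apply: (@continuous_comp _ _ _ (fun y => q * y / (2 * r + chord y)) atan); last exact: continuous_atan.
apply: cvgM; first by apply: cvgM; [exact: cvg_cst | exact: cvg_id].
apply: cvgV; first by rewrite gt_eqF // den_gt0.
by apply: cvgD; [exact: cvg_cst | exact: chord_continuous].
Qed.

Lemma chordint_derive x : 0 <= x < xmax -> is_derive x 1 chordint (chord x).
Proof.
move=> Hx; have c0 := chord_gt0 Hx; have d0 := den_gt0 x.
have c2 : chord x ^+ 2 = 4 * r ^+ 2 - 3 * x ^+ 2.
  by apply: chord_sqr; case/andP: Hx => -> /ltW ->.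
have dc := chord_derive Hx; have cn0 : chord x != 0 by rewrite gt_eqF.
have dn0 : 2 * r + chord x != 0 by rewrite gt_eqF.
have dd : is_derive x 1 (fun y => (2 * r + chord y)^-1) (- (- 3 * x / chord x) / (2 * r + chord x) ^+ 2).
  have h : is_derive x 1 (fun y => 2 * r + chord y) (- 3 * x / chord x).
    by have h := is_deriveD (is_derive_cst (2 * r : R) x (1 : R)) dc; apply: is_derive_eq h _; rewrite add0r.
  have h2 := @is_deriveV R (fun y => 2 * r + chord y) x _ _ dn0 h; apply: is_derive_eq h2 _.
  by rewrite /GRing.scale /=; field; rewrite cn0 dn0.
have dw : is_derive x 1 (fun y => q * y / (2 * r + chord y))
   (q / (2 * r + chord x) + q * x * (3 * x / chord x) / (2 * r + chord x) ^+ 2).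
  have h1 : is_derive x 1 (fun y : R => q * y) q by apply: is_derive_eq; rewrite /GRing.scale /=; ring.
  have h := is_deriveM h1 dd; apply: is_derive_eq h _.
  by rewrite /GRing.scale /=; field; rewrite cn0 dn0.
have da := @is_derive1_comp R atan (fun y => q * y / (2 * r + chord y)) x _ _ (is_derive1_atan _) dw.
have h3 : is_derive x 1 (fun y : R => y / 2) (2^-1).
  by apply: is_derive_eq; rewrite /GRing.scale /=; ring.
have h4 := is_deriveM h3 dc.
have h5 := is_deriveZ (4 * r ^+ 2 / q) da.
have h6 := is_deriveD h4 h5.
apply: is_derive_eq h6 _; rewrite /GRing.scale /=.
set C := chord x in c0 c2 cn0 dn0 d0 *; set W := q * x / (2 * r + C).
have W0 : 1 + W ^+ 2 != 0 by rewrite gt_eqF // ltr_pwDl // sqr_ge0.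
(* (2 r + C)^2 + 3 x^2 = 8 r^2 + 4 r C, because C^2 = 4 r^2 - 3 x^2. *)
have E1 : 1 + W ^+ 2 = 4 * r / (2 * r + C).
  rewrite /W !expr_div_n exprMn q2; apply: (mulIf (expf_neq0 2 dn0)).
  rewrite mulrDl mul1r divfK ?expf_neq0 //.
  transitivity (4 * r ^+ 2 + 4 * r * C + C ^+ 2 + 3 * x ^+ 2); first by ring.
  by rewrite c2; field.
rewrite E1; have rn0 : r != 0 by rewrite gt_eqF.
have E2 : 3 * x ^+ 2 = 4 * r ^+ 2 - C ^+ 2 by rewrite c2; ring.
have -> : x / 2 * (- 3 * x / C) + C * 2^-1 +
  4 * r ^+ 2 / q * ((4 * r / (2 * r + C))^-1 * (q / (2 * r + C) + q * x * (3 * x / C) / (2 * r + C) ^+ 2)) =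
  - (3 * x ^+ 2) / (2 * C) + C / 2 + r * (1 + (3 * x ^+ 2) / (C * (2 * r + C))).
  by field; rewrite qn0 cn0 dn0 rn0.
by rewrite E2; field; rewrite cn0 dn0.
Qed.

Lemma chordint_0 : chordint 0 = 0.
Proof. by rewrite /chordint mulr0 !mul0r atan0 mulr0 addr0. Qed.

(** For this angle cos a = sqrt 3 / 2 and cos 2a = 1/2, whence cos 3a = 0 with 3a between 0 and
    pi. *)
Lemma atan_inv_sqrt3 : atan (q^-1) = pi / 6.
Proof.
set a := atan _.
have pi0 : 0 < (pi : R) := pi_gt0 R.
have cosa : cos a = q / 2.
  rewrite /a cos_atan exprVn q2; have -> : 1 + 3^-1 = (2 / q) ^+ 2 :> R by rewrite expr_div_n q2; field.
  by rewrite sqrtr_sqr gtr0_norm ?invf_div // divr_gt0.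
have cos2a : cos (a *+ 2) = 2^-1.
  by rewrite cos_mulr2n cosa expr_div_n q2 mulr2n; field.
have a0 : 0 < a.
  have : tan 0 < tan a :> R by rewrite tan0 /a atanK invr_gt0.
  rewrite ltr_tan // ?in_itv /= ?atan_gtNpi2 ?atan_ltpi2 //.
  by apply/andP; split; lra.
have a1 : a < pi / 2 by exact: atan_ltpi2.
have a2 : a *+ 2 < pi / 2.
  have i1 : 0 <= a *+ 2 <= pi by rewrite mulr2n; apply/andP; split; lra.
  have i2 : 0 <= (pi : R) / 2 <= pi by apply/andP; split; lra.
  by rewrite -ltr_cos ?in_itv /= ?cos_pihalf ?cos2a ?invr_gt0.
have cos3a : cos (a *+ 2 + a) = cos (pi / 2).
  have s2 : sin a ^+ 2 = 4^-1 by rewrite sin2cos2 cosa expr_div_n q2; field.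
  rewrite cosD cos2a cosa sin_mulr2n cosa cos_pihalf.
  transitivity (q / 4 - q * sin a ^+ 2); first by field.
  by rewrite s2; field.
have a3 : a + a < pi / 2 by rewrite -mulr2n.
have i1 : 0 <= a *+ 2 + a <= pi by rewrite mulr2n; apply/andP; split; lra.
have i2 : 0 <= (pi : R) / 2 <= pi by apply/andP; split; lra.
have : a *+ 2 + a = pi / 2 by apply: cos_inj; rewrite ?in_itv.
by rewrite mulr2n; lra.
Qed.

Lemma chordint_r : chordint r = r ^+ 2 / 2 + 2 * r ^+ 2 * pi / (3 * q).
Proof.
rewrite /chordint chord_r.
have -> : q * r / (2 * r + r) = q^-1.
  have rn0 : r != 0 by rewrite gt_eqF.
  apply: (mulIf qn0); rewrite mulVf //.
  transitivity (q ^+ 2 * r / (3 * r)); first by field; rewrite rn0 /=; apply/eqP; lra.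
  by rewrite q2; field.
by rewrite atan_inv_sqrt3; field.
Qed.

Lemma chordint_xmax : chordint xmax = r ^+ 2 * pi / q.
Proof.
rewrite /chordint chord_xmax mulr0 add0r addr0.
have -> : q * xmax / (2 * r) = 1 by rewrite /xmax; field; rewrite qn0 gt_eqF.
by rewrite atan1; field.
Qed.

Lemma chordint_LR a b : 0 <= a -> b <= xmax -> derivable_oo_LRcontinuous chordint a b.
Proof.
move=> a0 bm; split.
- move=> x; rewrite in_itv /= => /andP [ax xb].
  have Hx : 0 <= x < xmax by rewrite (ltW (le_lt_trans a0 ax)) (lt_le_trans xb bm).
  by have [] := chordint_derive Hx.
- exact/cvg_at_right_filter/chordint_continuous.
- exact/cvg_at_left_filter/chordint_continuous.
Qed.

Lemma integral_chord_right :
  (\int[lebesgue_measure]_(x in `[r, xmax]) (chord x)%:E = (chordint xmax)%:E - (chordint r)%:E)%E.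
Proof.
apply: continuous_FTC2.
- exact: lt_r_xmax.
- by apply: continuous_subspaceT => x; exact: chord_continuous.
- by apply: chordint_LR => //; exact: ltW.
- move=> x; rewrite in_itv /= => /andP [rx xm].
  have Hx : 0 <= x < xmax by rewrite (ltW (lt_trans r0 rx)) xm.
  by rewrite derive1E; have [_ ->] := chordint_derive Hx.
Qed.

Definition leftint (x : R) : R := x ^+ 2 / 4 + chordint x / 2.

Lemma integral_chord_left :
  (\int[lebesgue_measure]_(x in `[0%R, r]) (((x + chord x) / 2)%R)%:E = (leftint r)%:E - (leftint 0)%:E)%E.
Proof.
have cl : continuous leftint.
  move=> x; apply: cvgD.
    by apply: cvgM; [exact: exprn_continuous | exact: cvg_cst].
  by apply: cvgM; [exact: chordint_continuous | exact: cvg_cst].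
have dl x : 0 <= x < xmax -> is_derive x 1 leftint ((x + chord x) / 2).
  move=> Hx; have d := chordint_derive Hx.
  have h1 : is_derive x 1 (fun y : R => y ^+ 2 / 4) (x / 2).
    by apply: is_derive_eq; rewrite /GRing.scale /=; field.
  have h2 : is_derive x 1 (fun y : R => chordint y / 2) (chord x / 2).
    have h := is_deriveM d (is_derive_cst (2^-1 : R) x (1 : R)); apply: is_derive_eq h _.
    by rewrite /GRing.scale /=; ring.
  by have h := is_deriveD h1 h2; apply: is_derive_eq h _; field.
apply: continuous_FTC2 => //.
- apply: continuous_subspaceT => x; apply: cvgM; last exact: cvg_cst.
  by apply: cvgD; [exact: cvg_id | exact: chord_continuous].
- split.
  + move=> x; rewrite in_itv /= => /andP [ax xb].
    have Hx : 0 <= x < xmax by rewrite (ltW ax) (lt_trans xb lt_r_xmax).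
    by have [] := dl _ Hx.
  + exact/cvg_at_right_filter/cl.
  + exact/cvg_at_left_filter/cl.
- move=> x; rewrite in_itv /= => /andP [ax xb].
  have Hx : 0 <= x < xmax by rewrite (ltW ax) (lt_trans xb lt_r_xmax).
  by rewrite derive1E; have [_ ->] := dl _ Hx.
Qed.

Lemma chord_total : (leftint r - leftint 0) + (chordint xmax - chordint r) = 2 * pi * r ^+ 2 / (3 * q).
Proof. by rewrite /leftint chordint_0 chordint_r chordint_xmax; field. Qed.

End EllipseIntegral.

Section Area.
Variable R : realType.
Variable r : R.
Hypothesis r0 : 0 < r.

Lemma sectorE (x y : R) : sector r (x, y) <-> [/\ 0 < x, 0 <= y & x ^+ 2 - x * y + y ^+ 2 <= r ^+ 2].
Proof. by rewrite /sector /= normE_point lecR. Qed.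

Lemma sector_section (x : R) : xsection (sector r) x =
  [set y | [/\ 0 < x, 0 <= y & x ^+ 2 - x * y + y ^+ 2 <= r ^+ 2]].
Proof.
by apply/seteqP; split => y; rewrite xsectionP sectorE.
Qed.

Lemma disc_section (x y : R) : 0 <= x <= xmax r ->
  (x ^+ 2 - x * y + y ^+ 2 <= r ^+ 2) = ((x - chord r x) / 2 <= y <= (x + chord r x) / 2).
Proof.
move=> Hx; have c0 := chord_ge0 r x; have c2 := chord_sqr r0 Hx.
apply/idP/andP => [H|[H1 H2]].
  have : (2 * y - x) ^+ 2 <= chord r x ^+ 2 by rewrite c2; lra.
  rewrite -real_normK ?num_real // ler_sqr ?nnegrE // ler_norml => /andP [h1 h2].
  by split; lra.
have : (2 * y - x) ^+ 2 <= chord r x ^+ 2.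
  rewrite -real_normK ?num_real // ler_sqr ?nnegrE // ler_norml; apply/andP; split; lra.
by rewrite c2; lra.
Qed.

Lemma itv_measure (a b : R) : a <= b -> lebesgue_measure `[a, b]%classic = (b - a)%:E.
Proof.
move=> ab; rewrite lebesgue_measure_itv /= lte_fin.
by case: ltgtP ab => // -> _; rewrite subrr.
Qed.

(** The lower end (x - chord)/2 of the chord is negative for x < r, where the condition y >= 0 cuts
    the chord, and positive for x > r. *)
Definition height (x : R) : \bar R :=
  if x <= r then (((x + chord r x) / 2)%R)%:E else (chord r x)%:E.

Lemma section_measure (x : R) :
  lebesgue_measure (xsection (sector r) x) = (height \_ `]0%R, xmax r]) x.
Proof.
rewrite sector_section patchE; case: ifPn => Hm; last first.
  have Hx : ~ (0 < x <= xmax r) by move=> h; move/negP: Hm; apply; rewrite inE /= in_itv.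
  suff -> : [set y | [/\ 0 < x, 0 <= y & x ^+ 2 - x * y + y ^+ 2 <= r ^+ 2]] = set0 by rewrite measure0.
  apply/seteqP; split => // y /= [x0 y0 H]; apply: Hx; rewrite x0 /=.
  rewrite -(@ler_pXn2r _ 2) ?nnegrE ?(ltW x0) ?(ltW (xmax_gt0 r0)) //.
  have := xmax_sqr r; have := sqr_ge0 (2 * y - x); lra.
have : 0 < x <= xmax r by move: Hm; rewrite inE /= in_itv.
move=> /andP [x0 xm]; have Hx : 0 <= x <= xmax r by rewrite (ltW x0).
have c0 := chord_ge0 r x; have c2 := chord_sqr r0 Hx.
rewrite /height; case: (lerP x r) => Hxr.
  have xc : x <= chord r x.
    rewrite -(@ler_pXn2r _ 2) ?nnegrE ?(ltW x0) // c2.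
    have : x ^+ 2 <= r ^+ 2 by rewrite ler_pXn2r ?nnegrE ?(ltW x0) ?(ltW r0).
    by lra.
  have -> : [set y | [/\ 0 < x, 0 <= y & x ^+ 2 - x * y + y ^+ 2 <= r ^+ 2]] = `[0, (x + chord r x) / 2]%classic.
    apply/seteqP; split => y /=; rewrite in_itv /= disc_section //.
      by move=> [_ -> /andP [_ ->]].
    by move=> /andP [y0 yb]; split => //; apply/andP; split => //; lra.
  by rewrite itv_measure ?subr0 //; lra.
have xc : chord r x <= x.
  rewrite -(@ler_pXn2r _ 2) ?nnegrE ?(ltW x0) // c2.
  have : r ^+ 2 <= x ^+ 2 by rewrite ler_pXn2r ?nnegrE ?(ltW x0) ?(ltW r0) // ltW.
  by lra.
have -> : [set y | [/\ 0 < x, 0 <= y & x ^+ 2 - x * y + y ^+ 2 <= r ^+ 2]] = `[(x - chord r x) / 2, (x + chord r x) / 2]%classic.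
  apply/seteqP; split => y /=; rewrite in_itv /= disc_section //.
    by move=> [_ _ ->].
  by move=> H; split => //; case/andP: H => h1 h2; lra.
rewrite itv_measure; last by lra.
by congr (_%:E); field.
Qed.

Lemma area_sector : area (sector r) = (2 * pi * r ^+ 2 / (3 * Num.sqrt 3))%:E.
Proof.
rewrite /area /product_measure1 /=.
under eq_integral => x _ do rewrite /= section_measure.
rewrite -integral_mkcond.
(* The integral is split at x = r, where the formula for [height] changes. *)
have U : `]0%R, xmax r]%classic = `]0%R, r] `|` `]r, xmax r].
  apply/seteqP; split => x /=; rewrite !in_itv /=.
    by move=> /andP [x0 xm]; case: (lerP x r) => H; [left; rewrite x0 | right; rewrite xm].
  have rm := lt_r_xmax r0; have r0' := r0.
  by case=> /andP [h1 h2]; apply/andP; split => //; lra.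
have mf1 : measurable_fun setT (fun x : R => ((x + chord r x) / 2)).
  apply: continuous_measurable_fun => x; apply: cvgM; last exact: cvg_cst.
  by apply: cvgD; [exact: cvg_id | exact: chord_continuous].
have mf2 : measurable_fun setT (chord r).
  by apply: continuous_measurable_fun => x; exact: chord_continuous.
have mh : measurable_fun setT height.
  have -> : height = EFin \o (fun x => if x <= r then (x + chord r x) / 2 else chord r x).
    by apply/funext => x; rewrite /height /=; case: ifP.
  apply: measurableT_comp => //; apply: measurable_fun_ifT => //.
  exact: measurable_fun_ler.
have pos x : (`]0%R, r] `|` `]r, xmax r])%classic x -> (0 <= height x)%E.
  move=> /=; rewrite !in_itv /= => Hx; rewrite /height.
  have x0 : 0 < x by case: Hx => /andP [] // /(lt_trans r0).
  by case: ifP => _; rewrite lee_fin ?chord_ge0 // divr_ge0 // addr_ge0 ?chord_ge0 // ltW.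
have dis : [disjoint `]0%R, r]%classic & `]r, xmax r]%classic].
  apply/disj_setPS => x /= []; rewrite !in_itv /= => /andP [_ h1] /andP [h2 _].
  by move: h1; rewrite leNgt h2.
rewrite U ge0_integral_setU //=; last exact: measurable_funTS.
have E1 : (\int[lebesgue_measure]_(x in `]0%R, r]) height x =
    \int[lebesgue_measure]_(x in `[0%R, r]) (((x + chord r x) / 2)%R)%:E)%E.
  rewrite -integral_itv_obnd_cbnd; last by apply/measurable_funTS/measurable_EFinP.
  by apply: eq_integral => x; rewrite inE /= in_itv /= /height => /andP [_ ->].
have E2 : (\int[lebesgue_measure]_(x in `]r, xmax r]) height x =
    \int[lebesgue_measure]_(x in `[r, xmax r]) (chord r x)%:E)%E.
  rewrite -integral_itv_obnd_cbnd; last by apply/measurable_funTS/measurable_EFinP.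
  by apply: eq_integral => x; rewrite inE /= in_itv /= /height => /andP [h _]; rewrite leNgt h.
rewrite E1 E2 integral_chord_left // integral_chord_right // -!EFinB -EFinD; congr (_%:E).
exact: chord_total.
Qed.

End Area.

(** * Asymptotics *)

Section Limit.
Variable R : realType.

Lemma ln_le_sub1_R (y : R) : 0 < y -> ln y <= y - 1.
Proof. by move=> y0; have := expR_ge1Dx (ln y); rewrite lnK ?posrE //; lra. Qed.

Definition harm (n : nat) : R := (hnum n)%:R / (n`!)%:R.

Lemma harmS n : harm n.+1 = harm n + n.+1%:R^-1.
Proof.
have f0 : (n`!)%:R != 0 :> R by rewrite pnatr_eq0 -lt0n fact_gt0.
rewrite /harm /hnum -/hnum factS natrD !natrM; field.
by rewrite f0 ?natr1 ?nat1r pnatr_eq0.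
Qed.

Lemma harm_ge n : ln (n.+1%:R) <= harm n.
Proof.
elim: n => [|n IH]; first by rewrite ln1 /harm /= mul0r.
rewrite harmS; have n1 : 0 < n.+1%:R :> R by rewrite ltr0n.
have n2 : 0 < n.+2%:R :> R by rewrite ltr0n.
have h := ln_le_sub1_R (divr_gt0 n2 n1); rewrite ln_div ?posrE // in h.
have E : n.+2%:R / n.+1%:R - 1 = n.+1%:R^-1 :> R.
  by rewrite -(natr1 n.+1); field; rewrite gt_eqF.
by move: h; rewrite E lerBlDr => /le_trans; apply; rewrite addrC lerD2r.
Qed.

Lemma harm_le n : harm n.+1 <= ln (n.+1%:R) + 1.
Proof.
elim: n => [|n IH]; first by rewrite harmS ln1 add0r /harm mul0r add0r invr1.
rewrite harmS; have n1 : 0 < n.+1%:R :> R by rewrite ltr0n.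
have n2 : 0 < n.+2%:R :> R by rewrite ltr0n.
have h := ln_le_sub1_R (divr_gt0 n1 n2); rewrite ln_div ?posrE // in h.
have E : n.+1%:R / n.+2%:R - 1 = - n.+2%:R^-1 :> R.
  apply: (mulIf (lt0r_neq0 n2)); rewrite mulrBl divfK ?gt_eqF // mulNr mulVf ?gt_eqF //.
  by rewrite mul1r -(natr1 n.+1) opprD addrA subrr sub0r.
rewrite E lerBlDr in h; apply: le_trans (lerD IH (lexx _)) _.
by rewrite addrAC lerD2r -lerBrDr addrC.
Qed.

Lemma pi1_harm (e : R) : 0 < e -> exists N0, forall n, (N0 <= n)%N ->
  (1 - e) * n%:R <= 2 * (pi1 n)%:R * harm n <= (1 + e) * n%:R.
Proof.
move=> e0; have [k kp ke] : exists2 k, (0 < k)%N & k%:R^-1 <= e.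
  exists (Num.truncn e^-1).+1 => //.
  by rewrite invf_ple ?posrE // ?ltr0n // ltW // truncnS_gt.
have [N0 HN0] := pi1_asymptotic_nat k kp.
exists N0 => n Hn; have [h1 h2] := HN0 n Hn.
have f0 : 0 < (n`!)%:R :> R by rewrite ltr0n fact_gt0.
have k0 : 0 < k%:R :> R by rewrite (ltr_nat R 0).
have Eh : harm n * (n`!)%:R = (hnum n)%:R by rewrite /harm divfK // gt_eqF.
move: h1 h2; rewrite -!(ler_nat R) !natrD !natrM -Eh => h1 h2.
have n0 : 0 <= n%:R :> R by [].
set P := (pi1 n)%:R in h1 h2 *; set H := harm n in h1 h2 *; set x : R := n%:R in h1 h2 n0 *.
have g1 : k%:R * (2 * P * H) <= k%:R * x + x.
  rewrite -(ler_pM2r f0); apply: le_trans (_ : k%:R * (2 * P * (H * (n`!)%:R)) <= _); first by rewrite le_eqVlt; apply/orP; left; apply/eqP; ring.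
  by apply: le_trans h1 _; rewrite le_eqVlt; apply/orP; left; apply/eqP; ring.
have g2 : k%:R * x <= k%:R * (2 * P * H) + x.
  rewrite -(ler_pM2r f0); apply: le_trans (_ : k%:R * (x * (n`!)%:R) <= _); first by rewrite le_eqVlt; apply/orP; left; apply/eqP; ring.
  by apply: le_trans h2 _; rewrite le_eqVlt; apply/orP; left; apply/eqP; ring.
have kx : x <= k%:R * (e * x).
  by rewrite mulrA ler_peMl // -{1}(mulfV (lt0r_neq0 k0)) ler_pM2l //.
apply/andP; split; rewrite -(ler_pM2l k0); lra.
Qed.

Lemma ln_le_sqrt (x : R) : 0 < x -> ln x <= 2 * Num.sqrt x.
Proof.
move=> x0; have s0 : 0 < Num.sqrt x by rewrite sqrtr_gt0.
rewrite -{1}(sqr_sqrtr (ltW x0)) lnXn // -[ln _ *+ 2]mulr_natl ler_pM2l //.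
by apply: le_trans (ln_le_sub1_R s0) _; lra.
Qed.

(** With N = floor(r^2), ln N is close to 2 ln r, so four times [pi1 N] is about 4 N / (2 * 2 ln r),
    that is r^2 / ln r; the O(r) remaining primes disappear against this. *)
Lemma nprimes_asymptotic : (nprimes r)%:R * ln r / r ^+ 2 @[r --> +oo] --> (1 : R).
Proof.
apply/cvgrPdist_le => e e0.
(* The upper estimate loses 2 d and the lower one 3 d; hence d <= e/4. *)
pose d := Num.min (e / 4) (1 / 2).
have d0 : 0 < d by rewrite lt_min divr_gt0 //= divr_gt0.
have de : d <= e / 4 by rewrite ge_min lexx.
have d2 : d <= 1 / 2 by rewrite ge_min lexx orbT.
have [N0 HN0] := pi1_harm d0.
near=> r.
have r1 : 2 <= r by near: r; apply: nbhs_pinfty_ge; rewrite num_real.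
have rN : N0.+1%:R <= r by near: r; apply: nbhs_pinfty_ge; rewrite num_real.
have rs : (26 / d) ^+ 2 <= r by near: r; apply: nbhs_pinfty_ge; rewrite num_real.
have rl : expR (2 / d) <= r by near: r; apply: nbhs_pinfty_ge; rewrite num_real.
have rd : d^-1 <= r by near: r; apply: nbhs_pinfty_ge; rewrite num_real.
have r0 : 0 < r by lra.
have rr0 : 0 < r ^+ 2 by rewrite exprn_gt0.
have rr : r <= r ^+ 2 by rewrite expr2 ler_peMr ?(ltW r0) //; lra.
pose N := Num.truncn (r ^+ 2); have /andP [HN1 HN2] : N%:R <= r ^+ 2 < N.+1%:R by exact/truncn_itv/ltW.
pose M := Num.truncn r; have /andP [HM1 HM2] : M%:R <= r < M.+1%:R by exact/truncn_itv/ltW.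
have NN0 : (N0 <= N)%N.
  by rewrite -ltnS -(ltr_nat R); apply: lt_le_trans (_ : N0.+1%:R <= _); [rewrite ltr_nat | exact: le_trans rN (le_trans rr (ltW HN2))].
have /andP [p1 p2] := HN0 N NN0.
have lo := nprimes_lower HN1; have up := nprimes_upper (ltW r0) HN2 HM2.
move: lo up; rewrite -!(ler_nat R) !natrD !natrM -(natr1 M) => lo up.
have n3 : 3 < N%:R + 1 :> R.
  have r2 : 2 * r <= r ^+ 2 by rewrite expr2 ler_pM2r.
  by rewrite natr1; apply: lt_trans HN2; lra.
have N1 : (0 < N)%N by rewrite -(ltr_nat R); lra.
have Nr0 : 0 < N%:R :> R by rewrite ltr0n.
have h1 := harm_ge N; have h2 : harm N <= ln N%:R + 1 by have := harm_le N.-1; rewrite prednK.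
have l1 : ln N%:R <= 2 * ln r.
  by rewrite [2 * ln r]mulr_natl -lnXn // ler_ln ?posrE.
have l2 : 2 * ln r <= ln N.+1%:R by rewrite [2 * ln r]mulr_natl -lnXn // ler_ln ?posrE // ltW.
have l0 : 2 / d <= ln r by rewrite -(expRK (2 / d)) ler_ln ?posrE ?expR_gt0.
have lp : 0 < ln r by apply: lt_le_trans l0; rewrite divr_gt0.
have sq0 : 0 < Num.sqrt r by rewrite sqrtr_gt0.
have sq : 26 / d <= Num.sqrt r.
  by rewrite -(ler_sqr (x := 26 / d)) ?nnegrE ?divr_ge0 ?(ltW d0) ?(ltW sq0) // sqr_sqrtr // ltW.
have sq2 : 26 <= d * Num.sqrt r by move: sq; rewrite ler_pdivrMr // mulrC.
have rE : r = Num.sqrt r * Num.sqrt r by rewrite -expr2 sqr_sqrtr // ltW.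
(* The error 2 r + 11 from [nprimes_upper] is at most 13 r; ln r <= 2 sqrt r turns 13 into the 26
   above. *)
have k1 : 13 * r * ln r <= d * r ^+ 2.
  have a1 : r * (13 * ln r) <= r * (26 * Num.sqrt r).
    by rewrite ler_pM2l //; have := ln_le_sqrt r0; lra.
  have a2 : r * (26 * Num.sqrt r) <= r * (d * r).
    by rewrite ler_pM2l // {2}rE mulrA ler_pM2r.
  have -> : d * r ^+ 2 = r * (d * r) by ring.
  by lra.
have P0 : 0 <= (pi1 N)%:R :> R by [].
set P : R := (pi1 N)%:R in p1 p2 lo up P0.
set c : R := (nprimes r)%:R in lo up *.
set n : R := N%:R in p1 p2 HN1 Nr0 h2 l1 n3.
set H := harm N in p1 p2 h1 h2.
have dr1 : 1 <= d * r ^+ 2.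
  apply: le_trans (_ : d * r <= _); last by rewrite ler_pM2l.
  by rewrite -(mulfV (lt0r_neq0 d0)) ler_pM2l.
have n1 : r ^+ 2 < n + 1 by rewrite /n natr1.
clearbody d P c n H.
clear - e0 d0 de d2 r1 r0 rr0 lp l0 l1 l2 h1 h2 p1 p2 lo up P0 HN1 HM1 Nr0 n1 k1 dr1.
have u1 : c * ln r <= (1 + 2 * d) * r ^+ 2.
  have b1 : c * ln r <= (4 * P + 2 * r + 11) * ln r by rewrite ler_pM2r //; lra.
  have b2 : P * (2 * ln r) <= P * H by rewrite ler_wpM2l //; lra.
  have b3 : (1 + d) * n <= (1 + d) * r ^+ 2 by rewrite ler_wpM2l //; lra.
  have b4 : 11 * ln r <= 11 * (r * ln r) by rewrite ler_pM2l // ler_peMl //; lra.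
  by lra.
(* [H] may exceed 2 ln r by up to 1; as [H] is at least 4/d, this costs no more than another d n. *)
have w1 : (1 - 3 * d) * r ^+ 2 <= c * ln r.
  have b1 : 4 * P * ln r <= c * ln r by rewrite ler_pM2r //; lra.
  have b2 : P * (H - 1) <= P * (2 * ln r) by rewrite ler_wpM2l //; lra.
  have b3 : P * (4 / d) <= P * H by rewrite ler_wpM2l //; lra.
  have b4 : 2 * P <= d * n.
    have -> : 2 * P = d / 2 * (P * (4 / d)) by field; rewrite gt_eqF.
    have -> : d * n = d / 2 * (2 * n) by field.
    rewrite ler_pM2l ?divr_gt0 //; apply: le_trans b3 _.
    have dn : d * n <= 1 / 2 * n by rewrite ler_pM2r.
    by lra.
  have b5 : d * n <= d * r ^+ 2 by rewrite ler_pM2l.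
  have b6 : (1 - d) * (r ^+ 2 - d * r ^+ 2) <= (1 - d) * n by rewrite ler_wpM2l //; lra.
  have b7 : 0 <= d * (d * r ^+ 2) by rewrite !mulr_ge0 // ?ltW.
  by lra.
rewrite (_ : 1 - _ = (r ^+ 2 - c * ln r) / r ^+ 2); last by field; rewrite gt_eqF.
rewrite normrM (gtr0_norm (x := _^-1)) ?invr_gt0 // ler_pdivrMr //.
have : 3 * d * r ^+ 2 <= e * r ^+ 2 by rewrite ler_pM2r //; lra.
have dr0 : 0 <= d * r ^+ 2 by rewrite mulr_ge0 // ltW.
by rewrite ler_norml => k2; apply/andP; split; lra.
Unshelve. all: by end_near. Qed.

End Limit.

Theorem corollary4p6 (R : realType) :
  asymp_eq (fun r : R => prime_density (sector r))
           (fun r : R => 3%:R * Num.sqrt 3%:R / (2%:R * pi * ln r)).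
Proof.
(* For r > 1 the constants of the area and of the claimed density cancel, and the quotient is the
   one of [nprimes_asymptotic]. *)
apply: cvg_trans (@nprimes_asymptotic R); apply: near_eq_cvg; near=> r.
have r1 : 1 < r by near: r; apply: nbhs_pinfty_gt; rewrite num_real.
have r0 : 0 < r by lra.
have l0 : ln r != 0 by rewrite gt_eqF // ln_gt0.
have s0 : Num.sqrt 3%:R != 0 :> R by rewrite sqrtr_eq0 -ltNge.
have p0 : (pi : R) != 0 by rewrite gt_eqF // pi_gt0.
rewrite /prime_density area_sector // [fine _]/= -/(nprimes r).
set P := pi in p0 *; move: P p0 => P p0; field.
by rewrite l0 s0 p0 gt_eqF.
Unshelve. all: by end_near. Qed.
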